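(* Let $X$ be an infinite-dimensional complex Banach space and $T\in L(X)$. The following are equivalent: (i) $\sigma_{gKR}(T)=\emptyset$; (ii) $\sigma_{gDR}(T)=\emptyset$; (iii) $T$ is polynomially Riesz; (iv) $\sigma_{\mathcal B}(T)$ is a finite set; (v) $\theta(T)$ is a finite set, where $\theta$ is one of $\sigma_{eK}$, $\sigma_{\Phi_+}$, $\sigma_{\Phi_-}$, $\sigma_{\Phi}$, $\sigma_{\mathcal W_+}$, $\sigma_{\mathcal W_-}$, $\sigma_{\mathcal W}$, $\sigma_{\mathcal B_+}$, $\sigma_{\mathcal B_-}$.
   Context: $S$ is Kato if $R(S)$ is closed and $N(S)\subset R(S^n)$ for all $n$; $S$ is Riesz if $S-\lambda$ is Fredholm for all $\lambda\ne0$. $\sigma_{gKR}(T)$ is the set of $\lambda$ for which there are no closed $(T-\lambda)$-invariant $M,N$ with $X=M\oplus N$, $(T-\lambda)_M$ Kato and $(T-\lambda)_N$ Riesz. $\sigma_{gDR}(T)$ is the set of $\lambda$ such that $T-\lambda$ is not generalized Drazin-Riesz invertible, where $A$ is generalized Drazin-Riesz invertible if there is $S\in L(X)$ with $AS=SA$, $SAS=S$ and $ASA-A$ Riesz. $T$ is polynomially Riesz if $p(T)$ is Riesz for some nonzero complex polynomial $p$. $S$ is essentially Kato if there are closed $S$-invariant $M,N$ with $X=M\oplus N$, $N$ finite-dimensional, $S_M$ Kato and $S_N$ nilpotent; $\sigma_{eK}(T)$ is the set of $\lambda$ with $T-\lambda$ not essentially Kato. $\Phi_+$: finite-dimensional kernel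 and closed range; $\Phi_-$: finite-codimensional range; $\Phi=\Phi_+\cap\Phi_-$; $\mathcal W_+$, $\mathcal W_-$, $\mathcal W$: those in $\Phi_+$, $\Phi_-$, $\Phi$ with index $\le0$, $\ge0$, $=0$; $\mathcal B_+$: $\Phi_+$ with finite ascent; $\mathcal B_-$: $\Phi_-$ with finite descent; $\mathcal B$: Fredholm with finite ascent and descent; $\sigma_{\mathbf R}(T)=\{\lambda:T-\lambda\notin\mathbf R\}$. *)

(* Defs.v *)
(* The scalar field C is modelled as R[i] = complex R (mathcomp real_closed)
   for an arbitrary R : realType; a complex Banach space is a
   completeNormedModType R[i]. *)
From HB Require Import structures.
From mathcomp Require Import all_boot all_order all_algebra.
From mathcomp Require Import all_classical all_reals all_analysis.
From mathcomp Require Export complex.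
Set Implicit Arguments.
Unset Strict Implicit.
Unset Printing Implicit Defensive.
Import Order.TTheory GRing.Theory Num.Theory.
Import numFieldNormedType.Exports.
Local Open Scope classical_set_scope.
Local Open Scope ring_scope.

Section OperatorTheory.
Context {K : numFieldType} {V : normedModType K}.

Definition bounded_op (A : V -> V) : Prop :=
  (forall (a : K) (x y : V), A (a *: x + y) = a *: A x + A y) /\ continuous A.

Definition subspace (M : set V) : Prop :=
  M 0 /\ forall (a : K) (x y : V), M x -> M y -> M (a *: x + y).
Definition closed_subspace (M : set V) : Prop := subspace M /\ closed M.
Definition invariant (A : V -> V) (M : set V) : Prop :=
  forall x, M x -> M (A x).

Definition sumS (M N : set V) : set V :=
  [set x | exists a b, M a /\ N b /\ x = a + b].

Definition direct_sum_decomp (M N : set V) : Prop :=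
  sumS M N = setT /\ M `&` N = [set 0].

Definition spanS (s : seq V) : set V :=
  [set x | exists c : 'I_(size s) -> K, x = \sum_(i < size s) c i *: s`_i].

Definition fin_dim (S : set V) : Prop := exists s : seq V, S = spanS s.
Definition has_dim (S : set V) (n : nat) : Prop :=
  (exists s : seq V, size s = n /\ S = spanS s) /\
  (forall s : seq V, S = spanS s -> (n <= size s)%N).

Definition fin_codim_in (M S : set V) : Prop :=
  exists s : seq V, (forall x, x \in s -> M x) /\ M = sumS S (spanS s).
Definition has_codim_in (M S : set V) (n : nat) : Prop :=
  (exists s : seq V, size s = n /\ (forall x, x \in s -> M x) /\
     M = sumS S (spanS s)) /\
  (forall s : seq V, (forall x, x \in s -> M x) -> M = sumS S (spanS s) ->
     (n <= size s)%N).

Definition kerM (M : set V) (A : V -> V) : set V := [set x | M x /\ A x = 0].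
Definition rngM (M : set V) (A : V -> V) : set V := A @` M.

Definition shift (A : V -> V) (l : K) : V -> V := fun x => A x - l *: x.

Definition Phi_plus (M : set V) (A : V -> V) : Prop :=
  fin_dim (kerM M A) /\ closed (rngM M A).
Definition Phi_minus (M : set V) (A : V -> V) : Prop :=
  fin_codim_in M (rngM M A).
Definition Fredholm (M : set V) (A : V -> V) : Prop :=
  Phi_plus M A /\ Phi_minus M A.

(* index conditions; ind = dim N(A) - codim R(A) in Z U {+oo,-oo} *)
Definition Weyl_plus (M : set V) (A : V -> V) : Prop :=
  Phi_plus M A /\ forall k n, has_dim (kerM M A) k ->
     has_codim_in M (rngM M A) n -> (k <= n)%N.
Definition Weyl_minus (M : set V) (A : V -> V) : Prop :=
  Phi_minus M A /\ forall k n, has_dim (kerM M A) k ->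
     has_codim_in M (rngM M A) n -> (n <= k)%N.
Definition Weyl (M : set V) (A : V -> V) : Prop :=
  Fredholm M A /\ forall k n, has_dim (kerM M A) k ->
     has_codim_in M (rngM M A) n -> k = n.

Definition fin_ascent (M : set V) (A : V -> V) : Prop :=
  exists p : nat, kerM M (iter p A) = kerM M (iter p.+1 A).
Definition fin_descent (M : set V) (A : V -> V) : Prop :=
  exists q : nat, rngM M (iter q A) = rngM M (iter q.+1 A).

Definition Browder_plus (M : set V) (A : V -> V) : Prop :=
  Phi_plus M A /\ fin_ascent M A.
Definition Browder_minus (M : set V) (A : V -> V) : Prop :=
  Phi_minus M A /\ fin_descent M A.
Definition Browder (M : set V) (A : V -> V) : Prop :=
  Fredholm M A /\ fin_ascent M A /\ fin_descent M A.

Definition Riesz (M : set V) (A : V -> V) : Prop :=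
  forall l : K, l != 0 -> Fredholm M (shift A l).

Definition Kato (M : set V) (A : V -> V) : Prop :=
  closed (rngM M A) /\ forall n : nat, kerM M A `<=` rngM M (iter n A).

Definition nilpotent_on (M : set V) (A : V -> V) : Prop :=
  exists k : nat, forall x, M x -> iter k A x = 0.

Definition essentially_Kato (A : V -> V) : Prop :=
  exists M N : set V, closed_subspace M /\ closed_subspace N /\
    invariant A M /\ invariant A N /\ direct_sum_decomp M N /\
    fin_dim N /\ Kato M A /\ nilpotent_on N A.

Definition gKato_Riesz (A : V -> V) : Prop :=
  exists M N : set V, closed_subspace M /\ closed_subspace N /\
    invariant A M /\ invariant A N /\ direct_sum_decomp M N /\
    Kato M A /\ Riesz N A.

Definition gDrazin_Riesz_invertible (A : V -> V) : Prop :=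
  exists S : V -> V, bounded_op S /\ A \o S = S \o A /\
    S \o A \o S = S /\ Riesz setT (fun x => A (S (A x)) - A x).

Definition poly_op (p : {poly K}) (A : V -> V) : V -> V :=
  fun x => \sum_(i < size p) p`_i *: iter i A x.

Definition polynomially_Riesz (A : V -> V) : Prop :=
  exists p : {poly K}, p != 0 /\ Riesz setT (poly_op p A).

Definition spec (P : (V -> V) -> Prop) (T : V -> V) : set K :=
  [set l | ~ P (shift T l)].

End OperatorTheory.

(* Main.v *)
(* All the conditions are compared with the finiteness of the Browder spectrum.

   If A is Kato and A - l is invertible for arbitrarily small l, then A is
   invertible: a kernel vector of A lies in the hyperrange and can be continued
   to a kernel vector of A - l.  If A is upper (lower) semi-Fredholm, its
   restriction to the range of A^n is Kato for large n, because the chains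
   N(A) /\ R(A^n) (R(A) + N(A^n)) stabilise; so a semi-Fredholm operator which is a
   limit of invertible A - l is Browder.  Similarly, at a limit of resolvent
   points a Kato + Riesz decomposition has an invertible Kato part, and all nearby
   points are Browder.  Starting from infinity and moving along a ray which avoids
   a given finite set, this propagates to the whole plane, and compactness of the
   spectrum gives finiteness.

   If p(T) is Riesz, then T - l is Fredholm unless p(l) = 0; conversely, if T - l
   is Fredholm outside the roots of p = X prod (X - l_i), then so is each factor of
   p(T) - m for m != 0.

   Finally, if the Browder spectrum is finite, every l is the centre of a circle
   of radius r free of spectrum.  With B = (T - l) / r, the Riesz projection of the
   disc is the limit of (1 - B^n)^-1 over n = 2^k; it splits T - l into an
   invertible part and a Riesz part. *)

(* All notions are relative to a subset M of X, so that the Kato and Riesz summands need not become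
   spaces of their own; finite dimension and finite codimension are both read through [fdm], which
   replaces quotient spaces. Neumann series are replaced by [approx_surj]: it asks only for
   approximate solutions whose residual is at most half of the datum and stays in the same subspace.
   Browder operators are handled through [BrowderP]: Fredholm, and bijective on the range of some
   power. The obstacle in the continuation is that a Kato-Riesz point need not be a Browder point,
   so what travels along the ray is the Browder property in a punctured disc; the centre is dealt
   with separately where the hypothesis at the centre allows it. The Riesz projection is a limit of
   means of resolvents over 2^k-th roots of unity. Doubling the number of nodes makes each mean the
   half-sum of two rotated earlier ones, so convergence is geometric and idempotence reduces to an
   identity between rational functions. *)
Require Import Defs.
From HB Require Import structures.
From mathcomp Require Import all_boot all_order all_algebra.
From mathcomp Require Import all_classical all_reals all_analysis.
From mathcomp Require Import complex ring lra.
(* Imported again so that [subspace], [invariant] and [shift] are those of Defs. *)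
Require Import Defs.
Import Order.TTheory GRing.Theory Num.Theory.
Import numFieldNormedType.Exports.
Local Open Scope classical_set_scope.
Local Open Scope ring_scope.
Set Implicit Arguments.
Unset Strict Implicit.
Unset Printing Implicit Defensive.

(** * Linear identities by reflection *)
Section LinearReflection.
Context {K : comPzRingType} {V : lmodType K}.

Inductive lexp := LVar of nat | LZero | LAdd of lexp & lexp | LOpp of lexp | LScale of K & lexp.

Fixpoint lval (env : seq V) e : V :=
  match e with
  | LVar n => env`_n
  | LZero => 0
  | LAdd e f => lval env e + lval env f
  | LOpp e => - lval env e
  | LScale a e => a *: lval env e
  end.

Fixpoint lcoef e (i : nat) : K :=
  match e with
  | LVar n => if i == n then 1 else 0
  | LZero => 0
  | LAdd e f => lcoef e i + lcoef f i
  | LOpp e => - lcoef e i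
  | LScale a e => a * lcoef e i
  end.

Lemma lvalE env e : lval env e = \sum_(i < size env) lcoef e i *: env`_i.
Proof.
elim: e => [n||e IHe f IHf|e IHe|a e IHe] /=.
- have [ln|gn] := ltnP n (size env); last first.
    rewrite nth_default // big1 // => i _; case: eqP => [E|_]; last by rewrite scale0r.
    by have := ltn_ord i; rewrite E ltnNge gn.
  rewrite (bigD1 (Ordinal ln)) //= eqxx scale1r big1 ?addr0 // => i ni.
  by case: eqP => [E|_]; [case/eqP: ni; apply: val_inj|rewrite scale0r].
- by rewrite big1 // => i _; rewrite scale0r.
- by rewrite IHe IHf -big_split; apply: eq_bigr => i _; rewrite scalerDl.
- by rewrite IHe -sumrN; apply: eq_bigr => i _; rewrite scaleNr.
- by rewrite IHe scaler_sumr; apply: eq_bigr => i _; rewrite scalerA.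
Qed.

(** A conjunction by recursion on the length: on a concrete environment [cbn] unfolds it into one
    coefficient identity per atom. *)
Definition alln (P : nat -> Prop) := fix loop n := if n is m.+1 then P m /\ loop m else True.

Lemma lval_eq env e f : alln (fun i => lcoef e i = lcoef f i) (size env) ->
  lval env e = lval env f.
Proof.
move=> h; rewrite !lvalE; apply: eq_bigr => i _; congr (_ *: _).
move: (size env) i h => n; elim: n => [[]//|n IH] i /= [hn /IH h].
have := ltn_ord i; rewrite ltnS leq_eqVlt => /orP[/eqP->//|li].
exact: (h (Ordinal li)).
Qed.
End LinearReflection.
Arguments lexp K : clear implicits.

(* Atoms are compared up to conversion: equal vectors may carry different
   instances of the same structure. *)
Ltac lmod_index x env :=
  match env with
  | (?y :: _)%SEQ => let _ := match constr:(tt) with _ => unify x y end in constr:(0%N)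
  | (_ :: ?env')%SEQ => let n := lmod_index x env' in constr:(S n)
  end.
Ltac lmod_atoms e env :=
  lazymatch e with
  | (?x + ?y)%R => let env := lmod_atoms x env in lmod_atoms y env
  | (- ?x)%R => lmod_atoms x env
  | (_ *: ?x)%R => lmod_atoms x env
  | (0)%R => env
  | _ => match env with
         | _ => let n := lmod_index e env in env
         | _ => constr:((e :: env)%SEQ)
         end
  end.
Ltac lmod_reify K e env :=
  lazymatch e with
  | (?x + ?y)%R => let a := lmod_reify K x env in let b := lmod_reify K y env in constr:(LAdd a b)
  | (- ?x)%R => let a := lmod_reify K x env in constr:(LOpp a)
  | (?c *: ?x)%R => let a := lmod_reify K x env in constr:(@LScale K c a)
  | (0)%R => constr:(@LZero K)
  | _ => let n := lmod_index e env in constr:(@LVar K n)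
  end.
(* Reduces an identity between linear combinations over [K] to the equality of
   the coefficients, left to [ring] and then [field]. *)
Ltac lmod K :=
  lazymatch goal with
  | |- @eq ?T ?x ?y =>
    let env := lmod_atoms x (@nil T) in
    let env := lmod_atoms y env in
    let a := lmod_reify K x env in
    let b := lmod_reify K y env in
    refine (@lval_eq K _ env a b _); cbn [size alln lcoef]; rewrite ?[eq_op _ _]/=;
    repeat split; try ring
  end.

(* The norms of R[i] and of X are valued in R[i]; [cn] and [nrm] are their real
   versions. *)
Section RealNorm.
Context {R : realType}.
Implicit Types a b : R[i].

Definition cn a : R := complex.Re `|a|.

Lemma cnE a : `|a| = (cn a)%:C%C.
Proof. by rewrite /cn; case: a => x y; rewrite normc_def. Qed.
Lemma cn_ge0 a : 0 <= cn a.
Proof. by rewrite -ler0c -cnE. Qed.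
Lemma cn_eq0 a : (cn a == 0) = (a == 0).
Proof. by rewrite -(normr_eq0 a) cnE -(inj_eq (@complexI _)). Qed.
Lemma cn_gt0 a : (0 < cn a) = (a != 0).
Proof. by rewrite lt_def cn_eq0 cn_ge0 andbT. Qed.
Lemma cnM a b : cn (a * b) = cn a * cn b.
Proof. by apply: (@complexI R); rewrite rmorphM /= -!cnE normrM. Qed.
Lemma cnD a b : cn (a + b) <= cn a + cn b.
Proof. by rewrite -lecR rmorphD /= -!cnE ler_normD. Qed.
Lemma cnN a : cn (- a) = cn a.
Proof. by rewrite /cn normrN. Qed.
Lemma cnBC a b : cn (a - b) = cn (b - a).
Proof. by rewrite /cn distrC. Qed.
Lemma cn0 : cn 0 = 0.
Proof. by rewrite /cn normr0. Qed.
Lemma cn1 : cn 1 = 1.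
Proof. by rewrite /cn normr1. Qed.
Lemma cnV a : cn a^-1 = (cn a)^-1.
Proof. by apply: (@complexI R); rewrite fmorphV /= -!cnE normfV. Qed.
Lemma cnX a n : cn (a ^+ n) = cn a ^+ n.
Proof. by elim: n => [|n IH]; rewrite ?expr0 ?cn1 // !exprS cnM IH. Qed.
Lemma cnR (t : R) : cn t%:C%C = `|t|.
Proof. by rewrite /cn normc_def /= expr0n /= addr0 sqrtr_sqr. Qed.
Lemma cn_tri a b (c : R[i]) : cn (a - c) <= cn (a - b) + cn (b - c).
Proof. by rewrite -[a - c](subrKA b); apply: cnD. Qed.
Lemma Re_le_cn a : complex.Re a <= cn a.
Proof.
case: a => x y; rewrite /cn normc_def /=.
apply: (le_trans (ler_norm x)); rewrite -sqrtr_sqr ler_wsqrtr // lerDl.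
exact: sqr_ge0.
Qed.
Lemma absRe_le_cn a : `|complex.Re a| <= cn a.
Proof. by rewrite ler_norml lerNl; apply/andP; split; [rewrite -cnN -raddfN|]; apply: Re_le_cn. Qed.
Lemma absIm_le_cn a : `|complex.Im a| <= cn a.
Proof.
case: a => x y; rewrite /cn normc_def /= -sqrtr_sqr ler_wsqrtr // lerDr.
exact: sqr_ge0.
Qed.
Lemma cn_le_ReIm (x y : R) : cn (x +i* y)%C <= `|x| + `|y|.
Proof.
have -> : (x +i* y)%C = x%:C%C + 'i%C * y%:C%C by simpc.
apply: (le_trans (cnD _ _)); rewrite cnM !cnR.
suff -> : cn 'i%C = 1 :> R by rewrite mul1r.
by rewrite /cn normc_def /= expr0n expr1n add0r sqrtr1.
Qed.
(** The parallelogram law for [a] and 1, from which [near_sqrt] bounds |z + 1| from below. *)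
Lemma cn_square (a : R[i]) :
  cn (a + 1) ^+ 2 + cn (a - 1) ^+ 2 = 2 * cn a ^+ 2 + 2.
Proof.
case: a => x y; rewrite /cn !normc_def /= !sqr_sqrtr;
  by [ring|rewrite addr_ge0 ?sqr_ge0].
Qed.
Lemma expr_small (t e : R) : 0 <= t -> t < 1 -> 0 < e -> exists n, t ^+ n < e.
Proof.
move=> t0 t1 e0; have nt : `|t| < 1 by rewrite ger0_norm.
have /cvgrPdist_lt /(_ _ e0) [n _ /(_ n (leqnn n))] /= := cvg_expr nt.
by rewrite sub0r normrN ger0_norm ?exprn_ge0 //; exists n.
Qed.

Lemma real_geometric (u : nat -> R) (c t : R) : 0 <= t -> t < 1 -> 0 <= c ->
  (forall n, `|u n.+1 - u n| <= c * t ^+ n) ->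
  exists l, forall n, `|l - u n| <= c * t ^+ n / (1 - t).
Proof.
move=> t0 t1 c0 hu; have t1' : 0 < 1 - t by rewrite subr_gt0.
(* [d n] bounds the whole tail after n: the intervals [u n - d n, u n + d n] are nested, and the
   limit is the supremum of their left endpoints. *)
pose d n := c * t ^+ n / (1 - t).
have dE n : d n = c * t ^+ n + d n.+1.
  by rewrite /d exprS; apply: (mulIf (lt0r_neq0 t1')); rewrite mulrDl !divfK ?gt_eqF //; ring.
have d0 n : 0 <= d n by rewrite divr_ge0 ?mulr_ge0 ?exprn_ge0 // ltW.
have zi m k : u m - d m <= u (m + k)%N - d (m + k)%N.
  elim: k => [|k IH]; rewrite ?addn0 // addnS; apply: le_trans IH _.
  have := hu (m + k)%N; rewrite ler_norml (dE (m + k)%N) => /andP[h _]; lra.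
have wi m k : u (m + k)%N + d (m + k)%N <= u m + d m.
  elim: k => [|k IH]; rewrite ?addn0 // addnS; apply: le_trans IH.
  have := hu (m + k)%N; rewrite ler_norml (dE (m + k)%N) => /andP[_ h]; lra.
have zw m n : u m - d m <= u n + d n.
  have := zi m n; have := wi n m; rewrite addnC; have := d0 (m + n)%N; lra.
pose S := range (fun n => u n - d n).
have Sne : S !=set0 by exists (u 0%N - d 0%N), 0%N.
have Sub n : ubound S (u n + d n) by move=> _ [m _ <-]; apply: zw.
exists (sup S) => n; rewrite ler_norml; apply/andP; split.
  have : u n - d n <= sup S by apply: ub_le_sup; [exists (u 0%N + d 0%N)|exists n].
  rewrite -/(d n); lra.
have : sup S <= u n + d n by apply: ge_sup.
rewrite -/(d n); lra.
Qed.

Lemma complex_geometric (u : nat -> R[i]) (c t : R) : 0 <= t -> t < 1 -> 0 <= c ->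
  (forall n, cn (u n.+1 - u n) <= c * t ^+ n) ->
  exists l, forall n, cn (l - u n) <= 2 * (c * t ^+ n / (1 - t)).
Proof.
move=> t0 t1 c0 hu.
have [n|l hl] := @real_geometric (fun n => complex.Re (u n)) c t t0 t1 c0.
  by apply: le_trans (hu n); rewrite -raddfB; apply: absRe_le_cn.
have [n|m hm] := @real_geometric (fun n => complex.Im (u n)) c t t0 t1 c0.
  by apply: le_trans (hu n); rewrite -raddfB; apply: absIm_le_cn.
exists (l +i* m)%C => n; move: (hl n) (hm n); case: (u n) => x y /= h1 h2.
apply: le_trans (cn_le_ReIm _ _) _; lra.
Qed.
End RealNorm.

(** * Closedness, boundedness and completeness in terms of the real norm *)

Section Interface.
Context {R : realType} {X : completeNormedModType R[i]}.
Implicit Types (x y z : X) (M : set X) (A : X -> X).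

Definition nrm x : R := complex.Re `|x|.

Lemma nrmE x : `|x| = (nrm x)%:C%C.
Proof.
have : `|x| \is Num.real by exact: normr_real.
by move=> /RRe_real; rewrite /nrm => ->.
Qed.
Lemma nrm_ge0 x : 0 <= nrm x.
Proof. by rewrite -ler0c -nrmE. Qed.
Lemma nrm_eq0 x : (nrm x == 0) = (x == 0).
Proof. by rewrite -(normr_eq0 x) nrmE -(inj_eq (@complexI _)). Qed.
Lemma nrm_gt0 x : (0 < nrm x) = (x != 0).
Proof. by rewrite lt_def nrm_eq0 nrm_ge0 andbT. Qed.
Lemma nrm0 : nrm 0 = 0.
Proof. by rewrite /nrm normr0. Qed.
Lemma nrmZ a x : nrm (a *: x) = cn a * nrm x.
Proof. by apply: (@complexI R); rewrite rmorphM /= -nrmE -cnE -nrmE normrZ. Qed.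
Lemma nrmD x y : nrm (x + y) <= nrm x + nrm y.
Proof. by rewrite -lecR rmorphD /= -!nrmE ler_normD. Qed.
Lemma nrmN x : nrm (- x) = nrm x.
Proof. by rewrite /nrm normrN. Qed.
Lemma nrmBC x y : nrm (x - y) = nrm (y - x).
Proof. by rewrite /nrm distrC. Qed.
Lemma nrmB x y : nrm (x - y) <= nrm x + nrm y.
Proof. by rewrite -(nrmN y) nrmD. Qed.
Lemma nrm_tri x y z : nrm (x - z) <= nrm (x - y) + nrm (y - z).
Proof. by rewrite -[x - z](subrKA y); apply: nrmD. Qed.
Lemma nrm_small x : (forall e, 0 < e -> nrm x < e) -> x = 0.
Proof.
move=> h; apply/eqP; rewrite -nrm_eq0; apply/negPn/negP => x0.
by have := h (nrm x); rewrite ltxx lt_def x0 nrm_ge0 => /(_ isT).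
Qed.

Lemma ballE x (e : R) y : ball x e%:C%C y <-> nrm (x - y) < e.
Proof. by rewrite -ball_normE /ball_ /= nrmE ltcR. Qed.

Lemma nbhsE x (B : set X) :
  nbhs x B <-> exists2 e : R, 0 < e & forall y, nrm (x - y) < e -> B y.
Proof.
split=> [/nbhs_ballP[e /= e0 h]|[e e0 h]].
  have eE : (complex.Re e)%:C%C = e by apply: RRe_real; exact: gtr0_real.
  exists (complex.Re e); first by rewrite -ltcR eE.
  by move=> y /ballE; rewrite eE; apply: h.
apply/nbhs_ballP; exists e%:C%C => /=; first by rewrite ltcR.
by move=> y /ballE; apply: h.
Qed.

Lemma closedE M : closed M <->
  forall x, (forall e : R, 0 < e -> exists2 y, M y & nrm (x - y) < e) -> M x.
Proof.
split=> h x hx.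
  apply: h => B /nbhsE[e e0 hB]; have [y My xy] := hx e e0.
  by exists y; split => //; apply: hB.
apply: h => e e0; have [|y [My /= xy]] := hx [set y | nrm (x - y) < e].
  by apply/nbhsE; exists e.
by exists y.
Qed.

(** Completeness of X enters here; limits in X are taken with this explicit rate, on which the later
    estimates rely. *)
Lemma cvg_geometric (u : nat -> X) (c t : R) : 0 <= t -> t < 1 -> 0 <= c ->
  (forall n, nrm (u n.+1 - u n) <= c * t ^+ n) ->
  exists l, forall n, nrm (l - u n) <= c * t ^+ n / (1 - t).
Proof.
move=> t0 t1 c0 hu.
have t1' : 0 < 1 - t by rewrite subr_gt0.
have step n k : nrm (u (n + k)%N - u n) <= c * t ^+ n * (1 - t ^+ k) / (1 - t).
  elim: k => [|k IH]; first by rewrite addn0 subrr nrm0 expr0 subrr mulr0 mul0r.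
  rewrite addnS; apply: le_trans (nrm_tri _ (u (n + k)%N) _) _.
  apply: le_trans (lerD (hu _) IH) _.
  rewrite ler_pdivlMr // mulrDl divfK ?gt_eqF // exprD exprS.
  by rewrite le_eqVlt; apply/orP; left; apply/eqP; ring.
have bnd n k : nrm (u (n + k)%N - u n) <= c * t ^+ n / (1 - t).
  apply: le_trans (step n k) _; apply: ler_wpM2r; first by rewrite invr_ge0 ltW.
  apply: ler_piMr; first by rewrite mulr_ge0 ?exprn_ge0.
  by rewrite gerBl exprn_ge0.
have small (e : R) : 0 < e -> exists n, c * t ^+ n / (1 - t) < e.
  move=> e0.
  have c1 : 0 < c + 1 by lra.
  have e1 : 0 < e * (1 - t) / (c + 1) by rewrite divr_gt0 // mulr_gt0.
  have [n hn] := expr_small t0 t1 e1; exists n; rewrite ltr_pdivrMr //.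
  move: hn; rewrite ltr_pdivlMr //; apply: le_lt_trans.
  have := exprn_ge0 n t0; nra.
have : cauchy (u @ \oo).
  apply/cauchy_ballP => e e0.
  have eE : (complex.Re e)%:C%C = e by apply: RRe_real; exact: gtr0_real.
  have e1 : 0 < complex.Re e by rewrite -ltcR eE.
  have [n hn] := small (complex.Re e / 2) (divr_gt0 e1 (ltr0Sn R 1)).
  exists ([set x | nrm (u n - x) < complex.Re e / 2], [set x | nrm (u n - x) < complex.Re e / 2]).
    split; exists n => // k /= /subnKC <-; rewrite nrmBC; exact: le_lt_trans (bnd _ _) hn.
  move=> [x y] [/= hx hy]; rewrite -eE; apply/ballE.
  apply: le_lt_trans (nrm_tri _ (u n) _) _; rewrite (nrmBC x); lra.
move=> /cauchy_cvgP /cvg_ex[l /cvgrPdist_lt hl]; exists l => n.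
apply/ler_addgt0Pr => e e0.
have [|m _ hm] := hl e%:C%C; first by rewrite ltcR.
have := hm (n + m)%N (leq_addl _ _); rewrite /= nrmE ltcR => h.
apply: le_trans (nrm_tri _ (u (n + m)%N) _) _.
by rewrite addrC lerD ?bnd // ltW.
Qed.

Lemma bounded_opP A : bounded_op A <->
  (forall a x y, A (a *: x + y) = a *: A x + A y) /\
  exists2 C : R, 0 < C & forall x, nrm (A x) <= C * nrm x.
Proof.
split=> [[lin cont]|[lin [C C0 hC]]]; split => //.
  have A0 : A 0 = 0.
    by have := lin 1 0 0; rewrite !scale1r addr0 => /esym/eqP; rewrite -subr_eq0 addrK => /eqP.
  have : nbhs (A 0) [set y | nrm (A 0 - y) < 1] by apply/nbhsE; exists 1.
  move=> /(cont 0) /nbhsE[e e0 he].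
  have e2 : 0 < e / 2 by rewrite divr_gt0.
  exists (2 / e); first by rewrite divr_gt0.
  move=> x; have [->|x0] := eqVneq x 0; first by rewrite A0 nrm0 mulr0.
  have nx : 0 < nrm x by rewrite nrm_gt0.
  (* The multiple of x of norm e / 2 lies in the ball where A is bounded by 1; hence the constant 2
     / e. *)
  pose a : R[i] := (e / 2 / nrm x)%:C%C.
  have ca : cn a = e / 2 / nrm x by rewrite /a cnR ger0_norm // ltW // divr_gt0.
  have /he /= : nrm (0 - a *: x) < e.
    rewrite sub0r nrmN nrmZ ca divfK ?gt_eqF //; lra.
  have := lin a x 0; rewrite A0 !addr0 => ->.
  rewrite sub0r nrmN nrmZ ca mulrAC ltr_pdivrMr // mul1r => h.
  rewrite mulrAC ler_pdivlMr //; nra.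
move=> x B /nbhsE[e e0 hB]; apply/nbhsE; exists (e / C); first exact: divr_gt0.
move=> y xy; apply: hB.
have -> : A x - A y = A (x - y).
  by have := lin (-1) y x; rewrite !scaleN1r ![- _ + _]addrC => <-.
by apply: le_lt_trans (hC _) _; rewrite mulrC -ltr_pdivlMr.
Qed.

End Interface.

(** * Linear algebra modulo a subspace *)
Section LinearAlgebra.
Context {K : numFieldType} {V : normedModType K}.
Implicit Types (x y z v : V) (M N D E F : set V) (A B : V -> V) (s t : seq V).

Definition lin A := forall (a : K) x y, A (a *: x + y) = a *: A x + A y.

(** Invertibility of a linear A on M. That A maps M into M is not included and is supplied
    separately by [invariant]. *)
Definition bij_on M A :=
  (forall x, M x -> A x = 0 -> x = 0) /\ forall y, M y -> exists2 x, M x & A x = y.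

Lemma linD A : lin A -> forall x y, A (x + y) = A x + A y.
Proof. by move=> h x y; have := h 1 x y; rewrite !scale1r. Qed.
Lemma lin0 A : lin A -> A 0 = 0.
Proof.
by move=> h; have /esym/eqP := linD h 0 0; rewrite addr0 -subr_eq0 addrK => /eqP.
Qed.
Lemma linZ A : lin A -> forall a x, A (a *: x) = a *: A x.
Proof. by move=> h a x; have := h a x 0; rewrite (lin0 h) !addr0. Qed.
Lemma linN A : lin A -> forall x, A (- x) = - A x.
Proof. by move=> h x; rewrite -scaleN1r (linZ h) scaleN1r. Qed.
Lemma linB A : lin A -> forall x y, A (x - y) = A x - A y.
Proof. by move=> h x y; rewrite (linD h) (linN h). Qed.
Lemma lin_sum A : lin A -> forall n (f : 'I_n -> V), A (\sum_i f i) = \sum_i A (f i).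
Proof. by move=> h n f; apply: (big_morph _ (linD h) (lin0 h)). Qed.
Lemma lin_comp A B : lin A -> lin B -> lin (A \o B).
Proof. by move=> hA hB a x y; rewrite /= hB hA. Qed.
Lemma lin_iter A n : lin A -> lin (iter n A).
Proof. by move=> hA; elim: n => [|n IH] a x y //=; rewrite IH hA. Qed.
Lemma lin_shift A l : lin A -> lin (shift A l).
Proof.
by move=> hA a x y; rewrite /shift hA scalerDr scalerBr addrACA -opprD !scalerA (mulrC l).
Qed.

Section Subspace.
Variables (M : set V) (hM : subspace M).
Lemma subsp0 : M 0. Proof. by case: hM. Qed.
Lemma subspD x y : M x -> M y -> M (x + y).
Proof. by move=> Mx My; rewrite -[x]scale1r; apply: hM.2. Qed.
Lemma subspZ a x : M x -> M (a *: x).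
Proof. by move=> Mx; rewrite -[_ *: _]addr0; apply: hM.2 => //; apply: subsp0. Qed.
Lemma subspN x : M x -> M (- x).
Proof. by rewrite -scaleN1r; apply: subspZ. Qed.
Lemma subspB x y : M x -> M y -> M (x - y).
Proof. by move=> Mx My; apply: subspD => //; apply: subspN. Qed.
Lemma subsp_sum n (f : 'I_n -> V) : (forall i, M (f i)) -> M (\sum_i f i).
Proof. by move=> h; apply: (big_ind M) => //; [apply: subsp0|apply: subspD]. Qed.
End Subspace.

Lemma subspace_set0 : subspace ([set 0] : set V).
Proof. by split=> //= a x y -> ->; rewrite scaler0 addr0. Qed.
Lemma set0_sub M : subspace M -> [set 0] `<=` M.
Proof. by move=> hM _ ->; apply: subsp0. Qed.
Lemma subspaceI M N : subspace M -> subspace N -> subspace (M `&` N).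
Proof.
move=> hM hN; split; first by split; apply: subsp0.
by move=> a x y [? ?] [? ?]; split; [apply: hM.2|apply: hN.2].
Qed.
Lemma subspace_sum M N : subspace M -> subspace N -> subspace (sumS M N).
Proof.
move=> hM hN; split; first by exists 0, 0; rewrite addr0; split; [|split]; rewrite //; apply: subsp0.
move=> a _ _ [x [y [Mx [Ny ->]]]] [x' [y' [Mx' [Ny' ->]]]].
exists (a *: x + x'), (a *: y + y'); split; first exact: hM.2.
by split; [exact: hN.2|rewrite scalerDr addrACA].
Qed.
Lemma subspace_ker M A : lin A -> subspace M -> subspace (kerM M A).
Proof.
move=> hA hM; split; first by split; [apply: subsp0|apply: lin0].
by move=> a x y [Mx Ax] [My Ay]; split; [exact: hM.2|rewrite hA Ax Ay scaler0 addr0].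
Qed.
Lemma subspace_rng M A : lin A -> subspace M -> subspace (rngM M A).
Proof.
move=> hA hM; split; first by exists 0; [apply: subsp0|apply: lin0].
by move=> a _ _ [x Mx <-] [y My <-]; exists (a *: x + y); [exact: hM.2|rewrite hA].
Qed.
Lemma sumS_l M N : subspace N -> M `<=` sumS M N.
Proof. by move=> hN x Mx; exists x, 0; rewrite addr0; split=> //; split=> //; apply: subsp0. Qed.
Lemma sumS_r M N : subspace M -> N `<=` sumS M N.
Proof. by move=> hM x Nx; exists 0, x; rewrite add0r; split=> //; apply: subsp0. Qed.
Lemma sumS_min M N D : subspace D -> M `<=` D -> N `<=` D -> sumS M N `<=` D.
Proof. by move=> hD MD ND _ [x [y [Mx [Ny ->]]]]; apply: subspD; auto. Qed.

Lemma span_nil : spanS [::] = [set 0 : V].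
Proof.
apply/seteqP; split=> x /=; first by case=> c ->; rewrite big_ord0.
by move=> ->; exists (fun=> 0); rewrite big_ord0.
Qed.
Lemma span_cons v s x :
  spanS (v :: s) x <-> exists a w, spanS s w /\ x = a *: v + w.
Proof.
split.
  case=> c ->; rewrite big_ord_recl /=; exists (c ord0).
  by eexists; split; [exists (fun i => c (lift ord0 i))|].
case=> a [_ [[c ->] ->]].
exists (fun i => if unlift ord0 i is Some j then c j else a).
rewrite big_ord_recl /= unlift_none; congr (_ + _).
by apply: eq_bigr => i _; rewrite liftK.
Qed.
Lemma subspace_span s : subspace (spanS s).
Proof.
split; first by exists (fun=> 0); rewrite big1 // => i _; rewrite scale0r.
move=> a _ _ [c ->] [d ->]; exists (fun i => a * c i + d i).
by rewrite scaler_sumr -big_split; apply: eq_bigr => i _; rewrite scalerDl scalerA.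
Qed.
Lemma span_cons_sub v s : spanS s `<=` spanS (v :: s).
Proof. by move=> x hx; apply/span_cons; exists 0, x; rewrite scale0r add0r. Qed.
Lemma span_mem s v : v \in s -> spanS s v.
Proof.
elim: s => // u s IH; rewrite inE => /orP[/eqP->|/IH]; last exact: span_cons_sub.
apply/span_cons; exists 1, 0; rewrite scale1r addr0; split => //.
exact: subsp0 (subspace_span s).
Qed.
Lemma span_min s D : subspace D -> (forall v, v \in s -> D v) -> spanS s `<=` D.
Proof.
move=> hD; elim: s => [|u s IH] h x; first by rewrite span_nil => ->; apply: subsp0.
move=> /span_cons[a [w [sw ->]]]; apply: hD.2; first by apply: h; rewrite inE eqxx.
by apply: IH => // v vs; apply: h; rewrite inE vs orbT.
Qed.
Lemma span_subl s t : {subset s <= t} -> spanS s `<=` spanS t.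
Proof. by move=> st; apply: span_min => [|v /st]; [apply: subspace_span|apply: span_mem]. Qed.
Lemma span_map A s : lin A -> rngM (spanS s) A `<=` spanS (map A s).
Proof.
move=> hA _ [x xs <-]; move: x xs.
apply: (@span_min s [set x | spanS (map A s) (A x)]).
  have h := subspace_span (map A s).
  split=> /=; first by rewrite lin0 //; apply: subsp0.
  by move=> a x y /= hx hy; rewrite hA; apply: h.2.
by move=> v vs /=; apply: span_mem; apply: map_f.
Qed.
Lemma span_rng A D s : lin A -> subspace D -> (forall v, v \in s -> rngM D A v) ->
  exists t, [/\ size t = size s, (forall v, v \in t -> D v) & s = map A t].
Proof.
move=> hA hD; elim: s => [|v s IH] h; first by exists [::].
have [|t [st tD ->]] := IH; first by move=> u us; apply: h; rewrite inE us orbT.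
have [|x Dx <-] := h v; first by rewrite inE eqxx.
exists (x :: t); split; rewrite /= ?size_map // => u; rewrite inE => /orP[/eqP->//|]; exact: tD.
Qed.

Lemma sum_span_cons E v s x : sumS E (spanS (v :: s)) x <->
  exists a r, sumS E (spanS s) r /\ x = a *: v + r.
Proof.
split=> [[e [_ [Ee [/span_cons[a [w [sw ->]]] ->]]]]|[a [_ [[e [w [Ee [sw ->]]]] ->]]]].
  by exists a, (e + w); split; [exists e, w|rewrite addrCA].
by exists e, (a *: v + w); split=> //; split; [apply/span_cons; exists a, w|rewrite addrCA].
Qed.

(** E + span (v :: s) exceeds E + span s by at most one dimension, so one vector x outside the
    smaller space absorbs the direction of v. This exchange step stands in for dimension counting in
    the inductions below. *)
Lemma sum_span_cons_red E v s x y : subspace (sumS E (spanS s)) ->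
  sumS E (spanS (v :: s)) x -> sumS E (spanS (v :: s)) y -> ~ sumS E (spanS s) x ->
  exists c, sumS E (spanS s) (y - c *: x).
Proof.
move=> hs /sum_span_cons[a [r [sr ->]]] /sum_span_cons[b [q [sq ->]]] nx.
have a0 : a != 0 by apply/eqP => a0; apply: nx; rewrite a0 scale0r add0r.
exists (b / a); rewrite scalerDr scalerA divfK // opprD addrACA subrr add0r.
by apply: subspB => //; apply: subspZ.
Qed.

(* [indep E s]: the classes of the members of [s] are linearly independent in V / E. *)
Fixpoint indep E s : Prop :=
  if s is v :: s' then indep E s' /\ ~ sumS E (spanS s') v else True.

Lemma indep_meet E s x : subspace E -> indep E s -> spanS s x -> E x -> x = 0.
Proof.
move=> hE; elim: s x => [|v s IH] x /=; first by rewrite span_nil.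
move=> [si nv] /span_cons[a [w [sw xE]]] Ex.
have [a0|a0] := eqVneq a 0; first by move: xE Ex; rewrite a0 scale0r add0r => -> /(IH _ si sw).
exfalso; apply: nv; exists (a^-1 *: x), (- (a^-1 *: w)); split; first exact: subspZ.
split; first by apply: subspN; [apply: subspace_span|apply: subspZ => //; apply: subspace_span].
by rewrite xE scalerDr scalerA mulVf // scale1r addrK.
Qed.

(** Induction on s, applied to D cut by E + span s; if D is larger than the cut, a single further
    vector of D suffices. The gain is that the generators lie in D and are independent modulo E. *)
Lemma sub_span_mod E D s : subspace E -> subspace D -> E `<=` D ->
  D `<=` sumS E (spanS s) ->
  exists t, [/\ (size t <= size s)%N, (forall v, v \in t -> D v),
    D = sumS E (spanS t) & indep E t].
Proof.
move=> hE; elim: s D => [|v s IH] D hD ED Ds.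
  exists [::]; split=> //; apply/seteqP; split=> //.
  by apply: sumS_min => //; rewrite span_nil => _ ->; apply: subsp0.
have hs := subspace_sum hE (subspace_span s).
have [t [ts tD DE ti]] := IH (D `&` sumS E (spanS s)) (subspaceI hD hs)
  (fun x Ex => conj (ED x Ex) (sumS_l (subspace_span s) Ex)) (@subIsetr _ _ _).
have [Dsub|/existsNP[x /not_implyP[Dx nx]]] := pselect (D `<=` sumS E (spanS s)).
  exists t; split=> //; [exact: leqW|by move=> u /tD[]|].
  by rewrite -DE; apply/esym/setIidl.
have tsub : sumS E (spanS t) `<=` sumS E (spanS s) by rewrite -DE; apply: subIsetr.
exists (x :: t); split=> //=; last by split => // /tsub.
  by move=> u; rewrite inE => /orP[/eqP->//|/tD[]].
apply/seteqP; split; last first.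
  apply: sumS_min => //; apply: span_min => // u; rewrite inE => /orP[/eqP->//|/tD[]//].
move=> y Dy; have [c sc] := sum_span_cons_red hs (Ds x Dx) (Ds y Dy) nx.
have : (D `&` sumS E (spanS s)) (y - c *: x) by split=> //; apply: subspB => //; apply: subspZ.
rewrite DE => h; apply/sum_span_cons; exists c, (y - c *: x); split=> //.
by rewrite addrC subrK.
Qed.

(** Either the chain stays inside E + span s, or from some index on it contains a vector outside; it
    is then determined by its traces on E + span s, which stabilise by induction. *)
Lemma incr_chain (C : nat -> set V) E s : subspace E -> (forall n, subspace (C n)) ->
  (forall n, E `<=` C n) -> (forall n, C n `<=` sumS E (spanS s)) ->
  (forall n, C n `<=` C n.+1) -> exists n0, forall n, (n0 <= n)%N -> C n `<=` C n0.
Proof.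
move=> hE; elim: s C => [|v s IH] C hC EC Cs Ci.
  exists 0%N => n _ x /Cs[e [w [Ee []]]]; rewrite span_nil => -> ->; rewrite addr0; exact: EC.
have mono m n : (m <= n)%N -> C m `<=` C n.
  by move=> /subnKC <-; elim: (n - m)%N => [|k IHk]; rewrite ?addn0 // addnS; apply: subset_trans IHk _.
have hs := subspace_sum hE (subspace_span s).
have [n1 hn1] := IH (fun n => C n `&` sumS E (spanS s)) (fun n => subspaceI (hC n) hs)
  (fun n x Ex => conj (EC n x Ex) (sumS_l (subspace_span s) Ex)) (fun n => @subIsetr _ _ _)
  (fun n x h => conj (Ci n x h.1) h.2).
have [h|] := pselect (forall n, C n `<=` sumS E (spanS s)).
  by exists n1 => n /hn1 hn x Cx; case: (hn x) => //; split=> //; apply: h Cx.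
move=> /existsNP[n2 /existsNP[x /not_implyP[Cx nx]]].
exists (maxn n1 n2) => n; rewrite geq_max => /andP[nn1 nn2] y Cy.
have [c sc] := sum_span_cons_red hs (Cs _ x Cx) (Cs _ y Cy) nx.
have : (C n `&` sumS E (spanS s)) (y - c *: x).
  by split=> //; apply: subspB => //; apply: subspZ => //; apply: mono Cx.
move=> /(hn1 _ nn1)[h _]; rewrite -(subrK (c *: x) y); apply: subspD => //.
  exact: mono (leq_maxl _ _) _ h.
by apply: subspZ => //; apply: mono Cx; apply: leq_maxr.
Qed.

(** The case split is dual to that of [incr_chain]: either some member falls into span s and the
    chain is restarted there, or every member has a vector outside span s and the traces decide. *)
Lemma decr_chain (C : nat -> set V) s : (forall n, subspace (C n)) ->
  (forall n, C n `<=` spanS s) -> (forall n, C n.+1 `<=` C n) ->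
  exists n0, forall n, (n0 <= n)%N -> C n0 `<=` C n.
Proof.
elim: s C => [|v s IH] C hC Cs Cd.
  by exists 0%N => n _ x /Cs; rewrite span_nil => ->; apply: subsp0.
have mono m n : (m <= n)%N -> C n `<=` C m.
  by move=> /subnKC <-; elim: (n - m)%N => [|k IHk]; rewrite ?addn0 // addnS; apply: subset_trans IHk.
have [[n2 h]|h] := pselect (exists n2, C n2 `<=` spanS s).
  have [n1 hn1] := IH (fun n => C (n + n2)%N) (fun n => hC _)
    (fun n => subset_trans (mono _ _ (leq_addl _ _)) h) (fun n => Cd _).
  exists (n1 + n2)%N => n nn; rewrite -(@subnK n2 n) ?(leq_trans (leq_addl _ _) nn) //.
  by apply: hn1; rewrite leq_subRL ?(leq_trans (leq_addl _ _) nn) // addnC.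
have [n1 hn1] := IH (fun n => C n `&` spanS s) (fun n => subspaceI (hC n) (subspace_span s))
  (fun n => @subIsetr _ _ _) (fun n x h => conj (Cd n x h.1) h.2).
exists n1 => n nn y Cy.
have [x Cx nx] : exists2 x, C n x & ~ spanS s x.
  by apply: contrapT => hx; apply: h; exists n => x Cx; apply: contrapT => nx; apply: hx; exists x.
have s0 t : sumS [set 0] (spanS t) = spanS t.
  apply/seteqP; split; last exact: sumS_r subspace_set0.
  by apply: sumS_min; [apply: subspace_span|move=> _ ->; apply: subsp0 (subspace_span _)|].
have [c] : exists c, sumS [set 0] (spanS s) (y - c *: x).
  by apply: (@sum_span_cons_red _ v); rewrite !s0 //; [apply: subspace_span|apply: Cs Cx|apply: Cs Cy].
rewrite s0 => sc.
have [|h' _] := hn1 n nn (y - c *: x).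
  by split=> //; apply: subspB => //; apply: subspZ => //; apply: mono Cx.
by rewrite -(subrK (c *: x) y); apply: subspD => //; apply: subspZ.
Qed.

(* [D] is finite-dimensional modulo [E]; [E] need not be contained in [D]. *)
Definition fdm D E := exists s, D `<=` sumS E (spanS s).

Lemma fdmS D D' E E' : D' `<=` D -> E `<=` E' -> fdm D E -> fdm D' E'.
Proof.
move=> DD EE [s h]; exists s => x /DD /h [e [w [Ee [sw ->]]]].
by exists e, w; split; [apply: EE|].
Qed.
Lemma fdm_trans D E F : fdm D E -> fdm E F -> fdm D F.
Proof.
move=> [s hs] [t ht]; exists (t ++ s) => x /hs[e [w [/ht[f [u [Ff [tu ->]]]] [sw ->]]]].
exists f, (u + w); split=> //; split; last by rewrite addrA.
apply: (subspD (subspace_span _)); [apply: span_subl tu|apply: span_subl sw] => v vs;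
  by rewrite mem_cat vs ?orbT.
Qed.
Lemma fdm_rng D E A : lin A -> fdm D E -> fdm (rngM D A) (rngM E A).
Proof.
move=> hA [s hs]; exists (map A s) => _ [x /hs[e [w [Ee [sw ->]]]] <-].
exists (A e), (A w); split; first by exists e.
by split; [apply: span_map => //; exists w|rewrite linD].
Qed.
Lemma fdm_span s E : subspace E -> fdm (spanS s) E.
Proof. by move=> hE; exists s; apply: sumS_r. Qed.
Lemma fdm_refl D E : D `<=` E -> fdm D E.
Proof.
move=> DE; exists [::] => x /DE Ex; exists x, 0; split=> //; split; last by rewrite addr0.
exact: subsp0 (subspace_span _).
Qed.
Lemma fin_dimP M : subspace M -> fin_dim M <-> fdm M [set 0].
Proof.
move=> hM; split=> [[s ->]|[s hs]]; first exact: fdm_span subspace_set0.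
have [t [_ _ -> _]] := sub_span_mod subspace_set0 hM (set0_sub hM) hs.
exists t; apply/seteqP; split; last exact: sumS_r subspace_set0.
by apply: sumS_min; [apply: subspace_span|move=> _ ->; apply: subsp0 (subspace_span _)|].
Qed.

Lemma fin_codimP M E : subspace M -> subspace E -> E `<=` M ->
  fin_codim_in M E <-> fdm M E.
Proof.
move=> hM hE EM; split=> [[s [_ h]]|[s hs]]; first by exists s; rewrite -h.
by have [t [_ tM ME _]] := sub_span_mod hE hM EM hs; exists t.
Qed.

(** Rank-nullity without numbers: lifted generators of the image, together with the kernel, generate
    D. *)
Lemma fdm_ker D A : lin A -> subspace D -> fdm (rngM D A) [set 0] -> fdm (kerM D A) [set 0] ->
  fdm D [set 0].
Proof.
move=> hA hD [s hs] hk; apply: fdm_trans hk.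
have hR := subspace_rng hA hD.
have [t [_ tR RE _]] := sub_span_mod subspace_set0 hR (set0_sub hR) hs.
have [u [_ uD tE]] := span_rng hA hD tR.
exists u => x Dx.
have : rngM D A (A x) by exists x.
rewrite RE => -[_ [w [-> [tw]]]]; rewrite add0r => Ax.
have [y uy Ay] : rngM (spanS u) A w.
  suff : spanS t `<=` rngM (spanS u) A by apply.
  apply: span_min; first exact: subspace_rng (subspace_span _).
  by move=> v; rewrite tE => /mapP[v' v'u ->]; exists v' => //; apply: span_mem.
exists (x - y), y; rewrite subrK; split=> //; split; last by rewrite linB // Ay Ax subrr.
by apply: subspB => //; apply: span_min uy.
Qed.

End LinearAlgebra.

(** * The open mapping theorem *)
Section Banach.
Context {R : realType} {X : completeNormedModType R[i]}.
Implicit Types (x y z v : X) (M N D E F Y : set X) (A B : X -> X) (s t : seq X).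

Lemma bounded_lin A : bounded_op A -> lin A.
Proof. by case/bounded_opP. Qed.

Lemma closed_subspaceT : closed_subspace (setT : set X).
Proof. by split=> //; exact: closedT. Qed.
Lemma closed_subspace0 : closed_subspace ([set 0] : set X).
Proof.
split; first exact: subspace_set0.
apply/closedE => x h; apply: nrm_small => e /h[_ -> ]; by rewrite subr0.
Qed.
Lemma closed_ker M A : bounded_op A -> closed_subspace M -> closed_subspace (kerM M A).
Proof.
move=> hA [hM cM]; split; first exact: subspace_ker (bounded_lin hA) hM.
have [lA [C C0 hC]] := (bounded_opP A).1 hA.
apply/closedE => x hx; split.
  by move/closedE: cM; apply => e /hx[y [My _] xy]; exists y.
apply: nrm_small => e e0; have [|y [_ Ay] xy] := hx (e / C); first exact: divr_gt0.
rewrite -[A x]subr0 -Ay -linB //; apply: le_lt_trans (hC _) _.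
by rewrite mulrC -ltr_pdivlMr.
Qed.

Lemma closed_add_line E v : closed_subspace E ->
  closed [set x | exists a r, E r /\ x = a *: v + r].
Proof.
move=> [hE cE]; have [Ev|nEv] := pselect (E v).
  rewrite (_ : [set x | _] = E) //; apply/seteqP; split=> [_ [a [r [Er ->]]]|x Ex].
    exact: hE.2.
  by exists 0, x; rewrite scale0r add0r.
have [d d0 hd] : exists2 d : R, 0 < d & forall r, E r -> d <= nrm (v - r).
  apply: contrapT => h; apply: nEv; move/closedE: cE; apply => e e0.
  apply: contrapT => h'; apply: h; exists e => // r Er; rewrite leNgt; apply/negP => hr.
  by apply: h'; exists r.
have hd' a r : E r -> cn a * d <= nrm (a *: v + r).
  move=> Er; have [->|a0] := eqVneq a 0; first by rewrite cn0 mul0r nrm_ge0.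
  have -> : a *: v + r = a *: (v - (- a^-1 *: r)).
    by rewrite scaleNr opprK scalerDr scalerA divff // scale1r.
  by rewrite nrmZ ler_wpM2l ?cn_ge0 //; apply: hd; apply: subspZ.
apply/closedE => x hx.
have h2 : (0 : R) <= 2^-1 /\ (2^-1 : R) < 1 by split; lra.
have /choice[g hg] : forall n, exists p : R[i] * X, E p.2 /\
    nrm (x - (p.1 *: v + p.2)) < 2^-1 ^+ n.
  move=> n; have [|_ [a [r [Er ->]]] h] := hx (2^-1 ^+ n).
    by rewrite exprn_gt0 // invr_gt0.
  by exists (a, r).
have [n|l hl] := @complex_geometric R (fun n => (g n).1) (2 / d) _ h2.1 h2.2 (ltW (divr_gt0 (ltr0Sn R 1) d0)).
  rewrite mulrAC ler_pdivlMr //.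
  have [E1 h1] := hg n; have [E2 h2'] := hg n.+1.
  apply: le_trans (hd' _ ((g n.+1).2 - (g n).2) (subspB hE E2 E1)) _.
  have -> : ((g n.+1).1 - (g n).1) *: v + ((g n.+1).2 - (g n).2) =
    ((g n.+1).1 *: v + (g n.+1).2) - ((g n).1 *: v + (g n).2).
    by rewrite scalerBl opprD addrACA.
  apply: le_trans (nrm_tri _ x _) _; rewrite nrmBC.
  move: h2'; rewrite exprS; have : (0:R) < 2^-1 ^+ n by rewrite exprn_gt0 // invr_gt0.
  lra.
exists l, (x - l *: v); split; last by rewrite addrC subrK.
move/closedE: cE; apply => e e0.
(* The 1 pays for the approximation of x; the rest pays for the coefficient, whose error 2 (2 / d)
   2^-n / (1 - 1/2) equals 4 (2 / d) 2^-n. *)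
pose c := 1 + 4 * (2 / d) * nrm v.
have c0 : 0 < c.
  rewrite /c ltr_wpDr // !mulr_ge0 ?nrm_ge0 ?invr_ge0 //; exact: ltW.
have [n hn] := expr_small h2.1 h2.2 (divr_gt0 e0 c0).
have [En hgn] := hg n; exists (g n).2 => //.
have -> : x - l *: v - (g n).2 = (x - ((g n).1 *: v + (g n).2)) - (l - (g n).1) *: v.
  by lmod R[i].
apply: le_lt_trans (nrmB _ _) _; rewrite nrmZ.
apply: lt_le_trans (ltr_leD hgn (ler_wpM2r (nrm_ge0 _) (hl n))) _.
move: hn; rewrite ltr_pdivlMr // => hn; apply: le_trans (ltW hn); rewrite /c.
have -> : (1 - 2^-1 : R) = 2^-1 by lra.
by rewrite invrK le_eqVlt; apply/orP; left; apply/eqP; ring.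
Qed.

Lemma closed_sum_span E s : closed_subspace E -> closed_subspace (sumS E (spanS s)).
Proof.
move=> hE; elim: s => [|v s IH].
  rewrite span_nil (_ : sumS _ _ = E) //; apply/seteqP; split; last exact: sumS_l subspace_set0.
  by apply: sumS_min; [exact: hE.1| |apply: set0_sub hE.1].
split; first exact: subspace_sum hE.1 (subspace_span _).
rewrite (_ : sumS _ _ = [set x | exists a r, sumS E (spanS s) r /\ x = a *: v + r]).
  exact: closed_add_line.
by apply/seteqP; split=> x /sum_span_cons.
Qed.

Lemma closed_span s : closed_subspace (spanS s : set X).
Proof.
rewrite (_ : spanS s = sumS [set 0] (spanS s)); first exact: closed_sum_span closed_subspace0.
apply/seteqP; split; first exact: sumS_r subspace_set0.
by apply: sumS_min => //; [apply: subspace_span|apply: set0_sub; apply: subspace_span].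
Qed.

(* The successive approximation half of the open mapping theorem, for the map
   [(x, f) |-> A x + f] on [M * F]; [Y] need not be closed. *)
Lemma approx_surj M F A Y (C : R) : closed_subspace M -> closed_subspace F -> bounded_op A ->
  0 <= C ->
  (forall y, Y y -> exists x f, [/\ M x, F f, nrm x <= C * nrm y, nrm f <= C * nrm y &
     nrm (y - (A x + f)) <= nrm y / 2 /\ Y (y - (A x + f))]) ->
  forall y, Y y -> exists x f, [/\ M x, F f, y = A x + f, nrm x <= 2 * C * nrm y &
     nrm f <= 2 * C * nrm y].
Proof.
move=> [hM cM] [hF cF] /bounded_opP[lA [K K0 hK]] C0 hY y Yy.
have /choice[g hg] : forall z, exists p : X * X, Y z ->
    [/\ M p.1, F p.2, nrm p.1 <= C * nrm z, nrm p.2 <= C * nrm z &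
     nrm (z - (A p.1 + p.2)) <= nrm z / 2 /\ Y (z - (A p.1 + p.2))].
  move=> z.
  have [Yz|nYz] := pselect (Y z); last by exists (0, 0).
  by have [x [f h]] := hY z Yz; exists (x, f).
(* [r n] is the residual after n corrections, [u n] and [w n] below are the sums of the corrections
   in M and F. Residuals halve and stay in Y, so both sums converge, to at most C |y| (1 + 1/2 +
   ...) = 2 C |y|. *)
pose r n := iter n (fun y => y - (A (g y).1 + (g y).2)) y.
have hr n : Y (r n) /\ nrm (r n) <= nrm y * 2^-1 ^+ n.
  elim: n => [|n [Yn IH]]; first by rewrite expr0 mulr1.
  have [_ _ _ _ [h1 h2]] := hg _ Yn; split=> //=.
  by apply: le_trans h1 _; rewrite exprSr mulrA ler_pM2r // invr_gt0.
pose u n := \sum_(i < n) (g (r i)).1; pose w n := \sum_(i < n) (g (r i)).2.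
have Mu n : M (u n) by apply: subsp_sum => // i; have [] := hg _ (hr i).1.
have Fw n : F (w n) by apply: subsp_sum => // i; have [] := hg _ (hr i).1.
have uS n : u n.+1 = u n + (g (r n)).1 by rewrite /u big_ord_recr.
have wS n : w n.+1 = w n + (g (r n)).2 by rewrite /w big_ord_recr.
have rS n : r n.+1 = r n - (A (g (r n)).1 + (g (r n)).2) by [].
have rE n : y - r n = A (u n) + w n.
  elim: n => [|n IH]; first by rewrite /u /w !big_ord0 subrr (lin0 lA) addr0.
  rewrite uS wS rS (linD lA) addrACA -IH; lmod R[i].
have h2 : (0 : R) <= 2^-1 /\ (2^-1 : R) < 1 by split; lra.
have h3 : (1 - 2^-1 : R) = 2^-1 by lra.
have c0 : 0 <= C * nrm y by rewrite mulr_ge0 ?nrm_ge0.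
have stepb n (b : R) : b <= C * nrm (r n) -> b <= C * nrm y * 2^-1 ^+ n.
  by move=> h; apply: le_trans h _; rewrite -mulrA ler_wpM2l //; case: (hr n).
have [n|l hl] := @cvg_geometric R X u _ _ h2.1 h2.2 c0.
  by rewrite uS [_ - _]addrAC subrr add0r; apply: stepb; have [] := hg _ (hr n).1.
have [n|f hf] := @cvg_geometric R X w _ _ h2.1 h2.2 c0.
  by rewrite wS [_ - _]addrAC subrr add0r; apply: stepb; have [] := hg _ (hr n).1.
have lim e n : 0 < e -> 2^-1 ^+ n < e / (2 * (C * nrm y) + 1) -> C * nrm y * 2^-1 ^+ n / (1 - 2^-1) < e.
  move=> e0; rewrite ltr_pdivlMr; last by lra.
  rewrite h3 invrK => h; apply: le_lt_trans h.
  have : (0:R) < 2^-1 ^+ n by rewrite exprn_gt0 // invr_gt0.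
  nra.
have c1 : 0 < 2 * (C * nrm y) + 1 by lra.
exists l, f; split.
- move/closedE: cM; apply => e e0.
  have [n hn] := expr_small h2.1 h2.2 (divr_gt0 e0 c1).
  by exists (u n) => //; apply: le_lt_trans (hl n) _; apply: lim.
- move/closedE: cF; apply => e e0.
  have [n hn] := expr_small h2.1 h2.2 (divr_gt0 e0 c1).
  by exists (w n) => //; apply: le_lt_trans (hf n) _; apply: lim.
- apply/eqP; rewrite -subr_eq0; apply/eqP; apply: nrm_small => e e0.
  pose c := nrm y + (K + 1) * (2 * (C * nrm y)) + 1.
  have c0' : 0 < c.
    by rewrite /c ltr_wpDl // addr_ge0 ?nrm_ge0 // !mulr_ge0 // ?nrm_ge0 // addr_ge0 // ltW.
  have [n hn] := expr_small h2.1 h2.2 (divr_gt0 e0 c0').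
  have -> : y - (A l + f) = r n - (A (l - u n) + (f - w n)).
    have /eqP := rE n; rewrite subr_eq => /eqP {1}->; rewrite (linB lA); lmod R[i].
  apply: le_lt_trans (nrmB _ _) _.
  apply: le_lt_trans (lerD (hr n).2 (nrmD _ _)) _.
  apply: le_lt_trans (lerD (lexx _) (lerD (hK _) (hf n))) _.
  have := hl n; rewrite h3 invrK => hln.
  move: hn; rewrite ltr_pdivlMr // /c => hn.
  have p0 : (0:R) < 2^-1 ^+ n by rewrite exprn_gt0 // invr_gt0.
  nra.
- have := hl 0%N; rewrite /u big_ord0 subr0 expr0 mulr1 h3 invrK; lra.
- have := hf 0%N; rewrite /w big_ord0 subr0 expr0 mulr1 h3 invrK; lra.
Qed.

(** Baire's argument followed by successive approximation. The summand F makes room for a complement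
    of the range, as needed in [closed_rng_fdm]. *)
Lemma banach_open M F A : closed_subspace M -> closed_subspace F -> bounded_op A ->
  closed (sumS (rngM M A) F) ->
  exists2 C : R, 0 < C & forall y, sumS (rngM M A) F y ->
    exists x f, [/\ M x, F f, y = A x + f, nrm x <= C * nrm y & nrm f <= C * nrm y].
Proof.
move=> hM hF hA cY; have lA := bounded_lin hA.
set Y := sumS _ _ in cY *.
have hY : subspace Y by apply: subspace_sum hF.1; apply: subspace_rng hM.1.
pose W n w := exists x f, [/\ M x, F f, w = A x + f, nrm x <= n%:R & nrm f <= n%:R].
(* If no [W n] were dense in a ball of Y, one could shrink balls [q n] so that the closed ball
   [q n.+1] misses [W n]; their common point lies in Y, hence in some [W N.+1], a contradiction. *)
have [n [y0 [r [Yy0 r0 hW]]]] : exists n y0 r, [/\ Y y0, 0 < r &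
    forall y, Y y -> nrm (y - y0) < r -> forall e, 0 < e -> exists2 w, W n w & nrm (y - w) < e].
  apply: contrapT => nW.
  have /choice[g hg] : forall p : nat * (X * R), exists q : X * R, Y p.2.1 -> 0 < p.2.2 ->
      [/\ Y q.1, 0 < q.2, nrm (q.1 - p.2.1) + q.2 <= p.2.2, q.2 <= p.2.2 / 2 &
         forall w, W p.1 w -> q.2 < nrm (q.1 - w)].
    move=> [n [y r]] /=; have [Yy|] := pselect (Y y); last by exists (0, 0).
    have [r0|] := pselect (0 < r); last by exists (0, 0).
    have [y' [s [Yy' yy' s0 hs]]] : exists y' (s : R), [/\ Y y', nrm (y' - y) < r / 2, 0 < s &
        forall w, W n w -> s <= nrm (y' - w)].
      apply: contrapT => h; apply: nW; exists n, y, (r / 2); split=> //; first by rewrite divr_gt0.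
      move=> y' Yy' yy' e e0; apply: contrapT => h'; apply: h; exists y', e; split=> // w Ww.
      by rewrite leNgt; apply/negP => we; apply: h'; exists w.
    exists (y', Num.min r s / 2) => _ _ /=.
    have [rs|rs] := leP r s; split=> //; try (move=> w /hs); lra.
  pose q n := nat_rect (fun=> (X * R)%type) (0, 1) (fun n p => g (n, p)) n.
  have hq n : Y (q n).1 /\ 0 < (q n).2.
    elim: n => [|n [h1 h2]] /=; first by split=> //; apply: subsp0.
    by have [] := hg (n, q n) h1 h2.
  have hqS n : [/\ nrm ((q n.+1).1 - (q n).1) + (q n.+1).2 <= (q n).2, (q n.+1).2 <= (q n).2 / 2 &
         forall w, W n w -> (q n.+1).2 < nrm ((q n.+1).1 - w)].
    by have [] := hg (n, q n) (hq n).1 (hq n).2.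
  have q2 n : (q n).2 <= 2^-1 ^+ n.
    elim: n => [|n IH] //=; have [_ h _] := hqS n; apply: le_trans h _; rewrite exprS; lra.
  have nest n k : nrm ((q (n + k)%N).1 - (q n).1) + (q (n + k)%N).2 <= (q n).2.
    elim: k => [|k IH]; first by rewrite addn0 subrr nrm0 add0r.
    rewrite addnS; have [h _ _] := hqS (n + k)%N.
    have := nrm_tri (q (n + k).+1).1 (q (n + k)%N).1 (q n).1; lra.
  have h2 : (0 : R) <= 2^-1 /\ (2^-1 : R) < 1 by split; lra.
  have [n|l hl] := @cvg_geometric R X (fun n => (q n).1) 1 _ h2.1 h2.2 ler01.
    have [h _ _] := hqS n; have := q2 n; have := (hq n.+1).2; rewrite mul1r; lra.
  have hl' n : nrm (l - (q n).1) <= (q n).2.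
    apply/ler_addgt0Pr => e e0.
    have [k hk] := expr_small h2.1 h2.2 (divr_gt0 e0 (ltr0Sn R 1)).
    have := nest n k; have := hl (n + k)%N; have := nrm_tri l (q (n + k)%N).1 (q n).1.
    have : (2^-1 : R) ^+ (n + k) <= 2^-1 ^+ k.
      by rewrite exprD ler_piMl ?exprn_ge0 ?exprn_ile1 ?h2.1 ?(ltW h2.2).
    have -> : 1 - 2^-1 = 2^-1 :> R by lra.
    have := (hq (n + k)%N).2; rewrite invrK; lra.
  have Yl : Y l.
    move/closedE: cY; apply => e e0.
    have [k hk] := expr_small h2.1 h2.2 e0; exists (q k).1; first by have [] := hq k.
    by apply: le_lt_trans hk; apply: le_trans (q2 k).
  have [_ [f [[x Mx <-] [Ff lE]]]] := Yl.
  pose N := Num.truncn (nrm x + nrm f).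
  have hN : nrm x + nrm f < N.+1%:R by apply: truncnS_gt.
  have [_ _ hw] := hqS N.+1.
  have /hw : W N.+1 l.
    by exists x, f; split=> //; have := nrm_ge0 x; have := nrm_ge0 f; lra.
  by rewrite nrmBC ltNge hl'.
(* Subtracting an approximation of y0 from one of y + y0 moves the ball of density to the origin and
   doubles the bound n. *)
have hW2 y e : Y y -> nrm y < r -> 0 < e -> exists x f, [/\ M x, F f, nrm (y - (A x + f)) < e,
    nrm x <= 2 * n%:R & nrm f <= 2 * n%:R].
  move=> Yy yr e0; have e2 : 0 < e / 2 by rewrite divr_gt0.
  have [|w1 [x [f [Mx Ff -> bx bf]]] h1] := hW (y + y0) (subspD hY Yy Yy0) _ _ e2.
    by rewrite addrK.
  have [|w2 [x' [f' [Mx' Ff' -> bx' bf']]] h2] := hW y0 Yy0 _ _ e2.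
    by rewrite subrr nrm0.
  exists (x - x'), (f - f'); split; try by apply: subspB => //; first [exact: hM.1|exact: hF.1].
  - have -> : y - (A (x - x') + (f - f')) = (y + y0 - (A x + f)) - (y0 - (A x' + f')).
      rewrite (linB lA); lmod R[i].
    apply: le_lt_trans (nrmB _ _) _; lra.
  - by apply: le_trans (nrmB _ _) _; lra.
  - by apply: le_trans (nrmB _ _) _; lra.
have n0 : (0 : R) <= n%:R by [].
(* y is rescaled to norm r / 2 and approximated within r / 4, half of that norm; undoing the scale b
   = r / (2 |y|) turns the bound 2 n into 4 n |y| / r. The final + 1 keeps the constant positive
   when n = 0. *)
pose C := 4 * n%:R / r.
have C0 : 0 <= C by rewrite divr_ge0 ?mulr_ge0 // ltW.
exists (2 * C + 1); first lra.
move=> y Yy; have [|x [f [Mx Ff yE bx bf]]] := @approx_surj M F A Y C hM hF hA C0 _ y Yy; last first.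
  by exists x, f; split=> //; have := nrm_ge0 y; lra.
move=> {y Yy} y Yy; have [->|y0'] := eqVneq y 0.
  exists 0, 0; rewrite (lin0 lA) addr0 subr0 nrm0 mulr0 mul0r; split=> //; [exact: subsp0 hM.1|exact: subsp0 hF.1|].
  by split=> //; apply: subsp0.
have ny : 0 < nrm y by rewrite nrm_gt0.
pose b : R := r / 2 / nrm y; have b0 : 0 < b by rewrite !divr_gt0.
pose a : R[i] := b%:C%C.
have ca : cn a = b by rewrite /a cnR ger0_norm // ltW.
have a0 : a != 0 by rewrite -cn_gt0 ca.
have nay : nrm (a *: y) = r / 2 by rewrite nrmZ ca divfK ?gt_eqF.
have [||x [f [Mx Ff h bx bf]]] := @hW2 (a *: y) (r / 4) (subspZ hY _ Yy).
- by rewrite nay; lra.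
- by rewrite divr_gt0.
have Cb : b * (C * nrm y) = 2 * n%:R by rewrite /b /C; field; rewrite !gt_eqF.
have sc z : nrm z <= 2 * n%:R -> nrm (a^-1 *: z) <= C * nrm y.
  by rewrite nrmZ cnV ca ler_pdivrMl // Cb.
exists (a^-1 *: x), (a^-1 *: f); split; try exact: sc.
- by apply: subspZ => //; exact: hM.1.
- by apply: subspZ => //; exact: hF.1.
have Exf : A (a^-1 *: x) + a^-1 *: f = a^-1 *: (A x + f) by rewrite (linZ lA) scalerDr.
split; last first.
  apply: subspB => //; rewrite Exf; apply: subspZ => //.
  by exists (A x), f; split=> //; exists x.
rewrite Exf -[y in nrm (y - _)](scalerK a0) -scalerBr nrmZ cnV ca ler_pdivrMl //.
have -> : b * (nrm y / 2) = r / 4 by rewrite /b; field; rewrite gt_eqF.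
exact: ltW.
Qed.

Lemma closed_rng_open M A : closed_subspace M -> bounded_op A -> closed (rngM M A) ->
  exists2 C : R, 0 < C & forall y, rngM M A y ->
    exists x, [/\ M x, A x = y & nrm x <= C * nrm y].
Proof.
move=> hM hA cR.
have RE : sumS (rngM M A) [set 0] = rngM M A.
  apply/seteqP; split; last exact: sumS_l subspace_set0.
  have hR := subspace_rng (bounded_lin hA) hM.1.
  by apply: sumS_min => //; apply: set0_sub.
have [|C C0 h] := banach_open hM closed_subspace0 hA; first by rewrite RE.
exists C => // y; rewrite -{1}RE => /h[x [f [Mx -> -> bx _]]].
by exists x; rewrite addr0 in bx *.
Qed.

(** Independence of t modulo the range makes the component of y in span t unique, and the open
    mapping bound makes it small near the range: y and y - A z have the same component, of norm at
    most C |y - A z|. It vanishes at every limit of the range. *)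
Lemma closed_rng_fdm M A : closed_subspace M -> bounded_op A -> invariant A M ->
  fdm M (rngM M A) -> closed (rngM M A).
Proof.
move=> hM hA iM [s hs]; have lA := bounded_lin hA.
have hR := subspace_rng lA hM.1.
have RM : rngM M A `<=` M by move=> _ [x Mx <-]; apply: iM.
have [t [_ tM ME ti]] := sub_span_mod hR hM.1 RM hs.
have [|C C0 h] := banach_open hM (closed_span t) hA; first by rewrite -ME; exact: hM.2.
apply/closedE => y hy.
have My : M y.
  by move/closedE: hM.2; apply => e /hy[z /RM Mz yz]; exists z.
have := My; rewrite {1}ME => /[dup] Sy /h[x [f [Mx tf yE _ _]]].
suff f0 : f = 0 by rewrite yE f0 addr0; exists x.
apply: nrm_small => e e0.
have [|_ [z Mz <-] yz] := hy (e / C); first by rewrite divr_gt0.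
have : sumS (rngM M A) (spanS t) (y - A z) by rewrite -ME; apply: subspB => //; [exact: hM.1|exact: iM].
move=> /h[z' [f' [Mz' tf' yzE _ bf']]].
suff -> : f = f' by apply: le_lt_trans bf' _; rewrite mulrC -ltr_pdivlMr.
apply/eqP; rewrite -subr_eq0; apply/eqP; apply: (indep_meet hR ti).
  by apply: subspB => //; apply: subspace_span.
exists (z + z' - x); first by apply: subspB hM.1 _ _ _ _ => //; apply: subspD => //; exact: hM.1.
rewrite (linB lA) (linD lA).
have -> : f' = y - A z - A z' by rewrite yzE addrC addKr.
by rewrite yE; lmod R[i].
Qed.

(** A preimage in M of a limit of A(E) is approximated by points of E + N(A), which is closed
    because the kernel is finite-dimensional. *)
Lemma closed_rng_sub M E A : closed_subspace M -> closed_subspace E -> bounded_op A -> E `<=` M ->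
  closed (rngM M A) -> fdm (kerM M A) [set 0] -> closed (rngM E A).
Proof.
move=> hM hE hA EM cR kM; have lA := bounded_lin hA.
have [C C0 h] := closed_rng_open hM hA cR.
have [s ks] := (fin_dimP (subspace_ker lA hM.1)).2 kM.
have [_ cEs] := closed_sum_span s hE.
apply/closedE => y hy.
have : rngM M A y.
  by move/closedE: cR; apply => e /hy[_ [z Ez <-] yz]; exists (A z) => //; exists z => //; apply: EM.
move=> [x Mx xy].
suff : sumS E (spanS s) x.
  rewrite -ks => -[z [k [Ez [[_ Ak] xE]]]]; exists z => //.
  by rewrite -xy xE linD // Ak addr0.
move/closedE: cEs; apply => e e0.
have [|_ [z Ez <-] yz] := hy (e / C); first by rewrite divr_gt0.
have [|u [Mu Au bu]] := h (y - A z).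
  by exists (x - z); [apply: subspB => //; [exact: hM.1|exact: EM]|rewrite linB // xy].
exists (x - u); last first.
  rewrite opprB addrCA subrr addr0; apply: le_lt_trans bu _; by rewrite mulrC -ltr_pdivlMr.
exists z, (x - u - z); split=> //; split; last by lmod R[i].
rewrite -ks; split; last by rewrite !(linB lA) Au xy; lmod R[i].
have hM1 := hM.1.
by apply: (subspB hM1); [apply: (subspB hM1)|exact: EM].
Qed.

End Banach.

(** * Browder operators *)
Section Perturbation.
Context {R : realType} {X : completeNormedModType R[i]}.
Implicit Types (x y z v : X) (M N D E F Y : set X) (A B : X -> X) (l m : R[i]).

(** 0 belongs to the closure of the set of l with A - l invertible on M; l = 0 itself is allowed. *)
Definition near_bij M A :=
  forall e : R, 0 < e -> exists2 l, cn l < e & bij_on M (shift A l).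

Lemma shift0 A : shift A 0 = A.
Proof. by apply/funext => x; rewrite /shift scale0r subr0. Qed.
Lemma shiftD A l m : shift (shift A l) m = shift A (l + m).
Proof. by apply/funext => x; rewrite /shift; lmod R[i]. Qed.
Lemma bounded_comp A B : bounded_op A -> bounded_op B -> bounded_op (A \o B).
Proof.
move=> /bounded_opP[lA [C C0 hC]] /bounded_opP[lB [C' C0' hC']]; apply/bounded_opP.
split; first exact: lin_comp.
exists (C * C'); first exact: mulr_gt0.
by move=> x /=; apply: le_trans (hC _) _; rewrite -mulrA ler_pM2l.
Qed.
Lemma bounded_id : bounded_op (id : X -> X).
Proof. by apply/bounded_opP; split=> //; exists 1 => // x; rewrite mul1r. Qed.
Lemma bounded_iter A n : bounded_op A -> bounded_op (iter n A).
Proof.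
move=> hA; elim: n => [|n IH]; first exact: bounded_id.
exact: (bounded_comp hA IH).
Qed.
Lemma bounded_shift A l : bounded_op A -> bounded_op (shift A l).
Proof.
move=> /bounded_opP[lA [C C0 hC]]; apply/bounded_opP; split; first exact: lin_shift.
exists (C + cn l); first by rewrite ltr_pwDl // cn_ge0.
by move=> x; apply: le_trans (nrmB _ _) _; rewrite nrmZ mulrDl lerD.
Qed.
Lemma invariant_iter A M n : invariant A M -> invariant (iter n A) M.
Proof. by move=> h; elim: n => [|n IH] x Mx //=; apply: h; apply: IH. Qed.
Lemma invariant_shift A M l : subspace M -> invariant A M -> invariant (shift A l) M.
Proof. by move=> hM h x Mx; apply: subspB => //; [exact: h|exact: subspZ]. Qed.
Lemma invariantT A : invariant A setT. Proof. by []. Qed.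

Lemma rng_iterS D A n : rngM D (iter n.+1 A) = rngM (rngM D (iter n A)) A.
Proof.
apply/seteqP; split=> [_ [x Dx <-]|_ [_ [x Dx <-] <-]]; last by exists x.
by exists (iter n A x) => //; exists x.
Qed.
Lemma rng_iterD D A n k : rngM D (iter (n + k) A) = rngM (rngM D (iter k A)) (iter n A).
Proof.
apply/seteqP; split=> [_ [x Dx <-]|_ [_ [x Dx <-] <-]]; last by exists x; rewrite ?iterD.
by exists (iter k A x); [exists x|rewrite iterD].
Qed.
Lemma rng_iter_sub D A n k : invariant A D -> rngM D (iter (n + k) A) `<=` rngM D (iter n A).
Proof. by move=> iA _ [x Dx <-]; exists (iter k A x); rewrite ?iterD //; apply: invariant_iter. Qed.
Lemma iter_shiftC A l n x : lin A -> iter n A (shift A l x) = shift A l (iter n A x).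
Proof.
by move=> lA; rewrite /shift (linB (lin_iter n lA)) (linZ (lin_iter n lA)) -iterS iterSr.
Qed.

(** If A x = y, then x solves (A - l) x = y up to l x, of norm at most |l| C |y| <= |y| / 2. *)
Lemma onto_shift M A (C : R) l : closed_subspace M -> bounded_op A -> 0 <= C -> cn l * C <= 2^-1 ->
  (forall y, M y -> exists x, [/\ M x, A x = y & nrm x <= C * nrm y]) ->
  forall y, M y -> exists2 x, M x & shift A l x = y.
Proof.
move=> hM hA C0 lC h y My; have hM1 := hM.1.
have [|x [f [Mx -> -> _ _]]] := @approx_surj R X M [set 0] (shift A l) M C hM
  closed_subspace0 (bounded_shift l hA) C0 _ y My; last by exists x; rewrite ?addr0.
move=> {y My} y My; have [x [Mx Ax bx]] := h y My.
have E : y - (shift A l x + 0) = l *: x by rewrite /shift Ax; lmod R[i].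
exists x, 0; rewrite E nrmZ; split=> //; first by rewrite nrm0 mulr_ge0 ?nrm_ge0.
split; last exact: subspZ.
apply: le_trans (ler_wpM2l (cn_ge0 _) bx) _; rewrite mulrA mulrC.
by apply: ler_wpM2l; rewrite ?nrm_ge0.
Qed.

Lemma bij_open M A : closed_subspace M -> bounded_op A -> invariant A M -> bij_on M A ->
  exists2 C : R, 0 < C & forall x, M x -> nrm x <= C * nrm (A x).
Proof.
move=> hM hA iM [inj surj].
have RM : rngM M A = M.
  by apply/seteqP; split=> [_ [x Mx <-]|y /surj[x Mx <-]]; [exact: iM|exists x].
have [|C C0 h] := closed_rng_open hM hA; first by rewrite RM; exact: hM.2.
exists C => // x Mx; have [|x' [Mx' E b]] := h (A x); first by exists x.
suff <- : x' = x by rewrite E.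
apply/eqP; rewrite -subr_eq0; apply/eqP; apply: inj; first by apply: subspB => //; exact: hM.1.
by rewrite (linB (bounded_lin hA)) E subrr.
Qed.

Lemma bij_on_near M A : closed_subspace M -> bounded_op A -> invariant A M -> bij_on M A ->
  exists2 r : R, 0 < r & forall l, cn l < r -> bij_on M (shift A l).
Proof.
move=> hM hA iM bA; have [C C0 h] := bij_open hM hA iM bA.
exists (2 * C)^-1; first by rewrite invr_gt0 mulr_gt0.
move=> l hl; have lC : cn l * C <= 2^-1.
  by move: hl; rewrite invfM ltr_pdivlMr // => /ltW.
split; last first.
  apply: (onto_shift hM hA (ltW C0) lC) => y My; have [x Mx Ax] := bA.2 y My.
  by exists x; split=> //; rewrite -Ax; apply: h.
move=> x Mx /eqP; rewrite subr_eq0 => /eqP Ax.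
have := h x Mx; rewrite Ax nrmZ => b; apply/eqP; rewrite -nrm_eq0.
have := nrm_ge0 x; rewrite eq_le => ->; rewrite andbT; nra.
Qed.

(* A kernel vector x0 lies in the hyperrange, where A can be inverted with norm
   control, so (A - l) x = l x0 has a solution x with |x| < |x0| for small l; then
   x0 + x is in the kernel of A - l. *)
Lemma Kato_bij M A : closed_subspace M -> bounded_op A -> invariant A M -> Kato M A ->
  near_bij M A -> bij_on M A.
Proof.
move=> hM hA iM [cR kR] nb; have lA := bounded_lin hA; have hM1 := hM.1.
have [C C0 h] := closed_rng_open hM hA cR.
pose Y := [set x | forall n, rngM M (iter n A) x].
have hY : subspace Y.
  split=> [n|a x y hx hy n]; first exact: subsp0 (subspace_rng (lin_iter n lA) hM1).
  exact: (subspace_rng (lin_iter n lA) hM1).2.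
(* A maps the hyperrange onto itself: two preimages of y differ by a kernel vector, which the Kato
   condition puts into every R(A^n). *)
have liftY y : Y y -> exists x, [/\ Y x, A x = y & nrm x <= C * nrm y].
  move=> Yy; have [x [Mx Ax bx]] := h y (Yy 1%N); exists x; split=> // n.
  have [z Mz Az] := Yy n.+1.
  have /(kR n) : kerM M A (x - iter n A z).
    split; first by apply: subspB => //; apply: invariant_iter.
    by rewrite (linB lA) Ax -iterS Az subrr.
  move=> [w Mw E]; exists (w + z); first exact: subspD.
  by rewrite (linD (lin_iter n lA)) E subrK.
have inj x0 : M x0 -> A x0 = 0 -> x0 = 0.
  move=> Mx0 Ax0; apply: contrapT => /eqP x00.
  have n0 : 0 < nrm x0 by rewrite nrm_gt0.
  have Yx0 : Y x0 by move=> n; apply: kR.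
  (* With |l| C < 1/4 the solution satisfies |x| <= 2 C |l| |x0| < |x0| / 2, which rules out x = -
     x0. *)
  have [|l hl [il _]] := nb (4 * C)^-1; first by rewrite invr_gt0 mulr_gt0.
  have lC : cn l * C < 4^-1.
    by move: hl; rewrite invfM ltr_pdivlMr.
  have [|x [f [Mx -> xE bx _]]] := @approx_surj R X M [set 0] (shift A l) Y C hM
     closed_subspace0 (bounded_shift l hA) (ltW C0) _ (l *: x0) (subspZ hY _ Yx0).
    move=> y Yy; have [x [Yx Ax bx]] := liftY y Yy.
    have E : y - (shift A l x + 0) = l *: x by rewrite /shift Ax; lmod R[i].
    exists x, 0; rewrite E nrmZ; split=> //; first by have [z Mz <-] := Yx 0%N.
      by rewrite nrm0 mulr_ge0 ?nrm_ge0 // ltW.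
    split; last exact: (subspZ hY).
    have := nrm_ge0 y; have := cn_ge0 l; nra.
  have /eqP : x + x0 = 0.
    apply: il; first exact: subspD.
    rewrite (linD (lin_shift l lA)); move: xE; rewrite addr0 => <-.
    by rewrite /shift Ax0; lmod R[i].
  rewrite addr_eq0 => /eqP xx0; move: bx; rewrite xx0 nrmN nrmZ; nra.
have bb x : M x -> nrm x <= C * nrm (A x).
  move=> Mx; have [|x' [Mx' E b]] := h (A x); first by exists x.
  suff <- : x' = x by rewrite E.
  apply/eqP; rewrite -subr_eq0; apply/eqP; apply: inj; first exact: subspB.
  by rewrite (linB lA) E subrr.
split=> // y My.
have [|l hl [il sl]] := nb (4 * C)^-1; first by rewrite invr_gt0 mulr_gt0.
have lC : cn l * C < 4^-1 by move: hl; rewrite invfM ltr_pdivlMr.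
(* A is regarded as the perturbation of A - l by - l: |x| <= C |A x| and |l| C < 1/4 bound preimages
   under A - l with constant 2 C. *)
have <- : shift (shift A l) (- l) = A by rewrite shiftD subrr shift0.
apply: (@onto_shift M (shift A l) (2 * C)) => //; first exact: bounded_shift.
- by rewrite mulr_ge0 // ltW.
- rewrite cnN; lra.
move=> z /sl[x Mx xz]; exists x; split=> //.
have := bb x Mx; have -> : A x = z + l *: x by rewrite -xz /shift; lmod R[i].
have := nrmD z (l *: x); rewrite nrmZ; have := nrm_ge0 x; have := nrm_ge0 z; nra.
Qed.

Section Core.
Variables (D : set X) (A : X -> X).
Hypotheses (hD : closed_subspace D) (hA : bounded_op A) (iA : invariant A D).
Let lA : lin A := bounded_lin hA.
Let RD n : rngM D (iter n A) `<=` D.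
Proof. by move=> _ [x Dx <-]; apply: invariant_iter. Qed.
Let hR n : subspace (rngM D (iter n A)).
Proof. by apply: subspace_rng hD.1; apply: lin_iter. Qed.
Let iR n : invariant A (rngM D (iter n A)).
Proof. by move=> _ [x Dx <-]; exists (A x); [exact: iA|rewrite -iterSr]. Qed.

Lemma FredholmP : Fredholm D A <-> fdm (kerM D A) [set 0] /\ fdm D (rngM D A).
Proof.
have hk := subspace_ker lA hD.1; have RD1 := @RD 1%N.
have cd := fin_codimP hD.1 (hR 1) RD1.
split=> [[[/(fin_dimP hk) h1 _] /cd h2]//|[h1 h2]]; split; last by apply/cd.
by split; [apply/(fin_dimP hk)|apply: closed_rng_fdm].
Qed.

Lemma fdm_rng_iter n : fdm D (rngM D A) -> fdm D (rngM D (iter n A)).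
Proof.
move=> h; elim: n => [|n IH]; first by apply: fdm_refl => x Dx; exists x.
apply: fdm_trans h _; rewrite (_ : rngM D (iter n.+1 A) = rngM (rngM D (iter n A)) A).
  exact: fdm_rng.
exact: rng_iterS.
Qed.

Lemma fdm_ker_iter n : fdm (kerM D A) [set 0] -> fdm (kerM D (iter n A)) [set 0].
Proof.
move=> h; elim: n => [|n IH]; first by apply: fdm_refl => x [_ /= ->].
have hk := subspace_ker (lin_iter n.+1 lA) hD.1.
apply: (fdm_ker lA hk).
  by apply: fdmS IH => // _ [x [Dx Ax] <-]; split; [exact: iA|rewrite -iterSr].
by apply: fdmS h => // x [[Dx _] Ax].
Qed.

Lemma near_bij_rng n : near_bij D A -> near_bij (rngM D (iter n A)) A.
Proof.
move=> nb e /nb[l hl [inj surj]]; exists l => //; split.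
  by move=> x /RD; apply: inj.
move=> _ [d /surj[x Dx <-] <-]; exists (iter n A x); first by exists x.
by rewrite iter_shiftC.
Qed.

Lemma Kato_core n : closed (rngM D (iter n A)) -> closed (rngM D (iter n.+1 A)) ->
  (forall k, kerM D A `&` rngM D (iter n A) `<=` rngM D (iter (k + n) A)) ->
  near_bij D A -> bij_on (rngM D (iter n A)) A.
Proof.
move=> c1 c2 hk nb; apply: Kato_bij => //; last exact: near_bij_rng.
split; first by rewrite -rng_iterS.
by move=> k x [Rx Ax]; rewrite -rng_iterD; apply: hk; split=> //; split=> //; apply: RD Rx.
Qed.

Lemma Phi_plus_core : Phi_plus D A -> near_bij D A ->
  exists n, bij_on (rngM D (iter n A)) A.
Proof.
move=> [fk cR] nb; have [s ks] := fk.
have hk := subspace_ker lA hD.1; have fk' := (fin_dimP hk).1 fk.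
have cRn n : closed (rngM D (iter n A)).
  elim: n => [|n IH].
    rewrite (_ : rngM _ _ = D); first exact: hD.2.
    by apply/seteqP; split=> [_ [x Dx <-]|x Dx] //; exists x.
  by rewrite rng_iterS; apply: (@closed_rng_sub R X D) => //; apply: RD.
have [|||n0 hn0] := @decr_chain _ X (fun n => kerM D A `&` rngM D (iter n A)) s.
- by move=> n; apply: subspaceI.
- by move=> n; rewrite -ks; apply: subIsetl.
- by move=> n x [kx Rx]; split=> //; move: Rx; rewrite -addn1; apply: rng_iter_sub.
exists n0; apply: Kato_core => // k x hx.
by have [] := hn0 (k + n0)%N (leq_addl _ _) x hx.
Qed.

Lemma Phi_minus_core : Phi_minus D A -> near_bij D A ->
  exists n, bij_on (rngM D (iter n A)) A.
Proof.
move=> /(fin_codimP hD.1 (hR 1) (@RD 1%N)) fR nb; have [s Ds] := fR.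
have cRn n : closed (rngM D (iter n A)).
  apply: closed_rng_fdm => //; [exact: bounded_iter|exact: invariant_iter|].
  exact: fdm_rng_iter.
have hk n := subspace_ker (lin_iter n lA) hD.1.
have [||||n0 hn0] := @incr_chain _ X (fun n => sumS (rngM D A) (kerM D (iter n A))) (rngM D A) s (hR 1).
- by move=> n; apply: subspace_sum => //; exact: (hR 1).
- by move=> n; apply: sumS_l.
- move=> n; apply: subset_trans Ds; apply: sumS_min; [exact: hD.1|exact: (@RD 1%N)|].
  by move=> x [].
- move=> n; apply: sumS_min; first by apply: subspace_sum => //; exact: (hR 1).
    exact: sumS_l.
  apply: subset_trans (sumS_r (hR 1)) => x [Dx Ax]; split=> //=; by rewrite Ax lin0.
(* If x = A^(k+n0) y is in N(A), then y is in N(A^(k+n0+1)), hence in R(A) + N(A^n0) by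
   stabilisation; writing y = A w + v with A^n0 v = 0 gives x = A^(k+1+n0) w. *)
exists n0; apply: Kato_core => //; elim=> [|k IH] x [kx Rx]; first by [].
have [y Dy yx] := IH x (conj kx Rx); rewrite -yx.
have [_ [v [[w Dw <-] [[Dv Av] yE]]]] : sumS (rngM D A) (kerM D (iter (k + n0) A)) y.
  have : sumS (rngM D A) (kerM D (iter n0 A)) y.
    apply: (hn0 (k + n0).+1); first by rewrite -addSn leq_addl.
    by apply: (sumS_r (hR 1)); split=> //=; rewrite yx; case: kx.
  move=> [a [b [Ra [[Db Ab] ->]]]]; exists a, b; split=> //; split=> //; split=> //.
  by rewrite iterD Ab (lin0 (lin_iter k lA)).
exists w => //; rewrite addSn iterSr yE (linD (lin_iter _ lA)) Av addr0 //.
Qed.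

(** Fitting decomposition: A^n maps R(A^n) onto itself, so A^n d = A^n r with r in R(A^n), and d - r
    is in N(A^n). Directness of the sum is [core_meet]. *)
Lemma core_split n : bij_on (rngM D (iter n A)) A -> forall d, D d ->
  exists r k, [/\ rngM D (iter n A) r, kerM D (iter n A) k & d = r + k].
Proof.
move=> [inj surj] d Dd.
have onto k y : rngM D (iter n A) y -> exists2 x, rngM D (iter n A) x & iter k A x = y.
  elim: k y => [|k IH] y Ry; first by exists y.
  by have [x Rx <-] := IH y Ry; have [z Rz <-] := surj x Rx; exists z => //; rewrite iterSr.
have [|r Rr rE] := onto n (iter n A d); first by exists d.
exists r, (d - r); split=> //; last by rewrite addrC subrK.
split; first by apply: subspB => //; [exact: hD.1|exact: RD Rr].
by rewrite (linB (lin_iter n lA)) rE subrr.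
Qed.

Lemma core_meet n x : bij_on (rngM D (iter n A)) A -> rngM D (iter n A) x ->
  forall k, iter k A x = 0 -> x = 0.
Proof.
move=> [inj _] Rx k; elim: k => [//|k IH] /= Ax; apply: IH.
apply: inj Ax; elim: k => [//|k IH] /=; exact: iR.
Qed.

Lemma core_codim n : bij_on (rngM D (iter n A)) A -> fdm (kerM D A) [set 0] -> fdm D (rngM D A).
Proof.
move=> bA /(fdm_ker_iter n)[s hs]; exists s => d /(core_split bA)[r [k [Rr Kk ->]]].
have [_ [w [-> [sw ->]]]] := hs k Kk; rewrite add0r.
exists r, w; split=> //; have [z /RD Dz <-] := bA.2 r Rr; by exists z.
Qed.

(** Modulo R(A^n), generators of D may be replaced by their components in N(A^n). These span N(A),
    because the remaining part of a kernel vector lies in R(A^n) and is killed by A^(n+1). *)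
Lemma core_dim n : bij_on (rngM D (iter n A)) A -> fdm D (rngM D A) -> fdm (kerM D A) [set 0].
Proof.
move=> bA /(fdm_rng_iter n)[s hs].
have [t [_ tD DE _]] := sub_span_mod (hR n) hD.1 (@RD n) hs.
have /choice[g hg] : forall v, exists k, D v -> kerM D (iter n A) k /\ rngM D (iter n A) (v - k).
  move=> v; have [Dv|nDv] := pselect (D v); last by exists 0.
  by have [r [k [Rr Kk ->]]] := core_split bA Dv; exists k; rewrite addrK.
have hk := subspace_ker (lin_iter n lA) hD.1.
exists (map g t) => x [Dx Ax].
have hS : subspace (sumS (rngM D (iter n A)) (spanS (map g t))).
  by apply: subspace_sum => //; apply: subspace_span.
have [r [w [Rr [tw xE]]]] : sumS (rngM D (iter n A)) (spanS (map g t)) x.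
  have : sumS (rngM D (iter n A)) (spanS t) x by rewrite -DE.
  apply: sumS_min => //; first by apply: sumS_l; apply: subspace_span.
  apply: span_min => // v vt; have [_ Rv] := hg v (tD v vt).
  rewrite -[v](subrK (g v)); apply: subspD => //; first by apply: sumS_l Rv; apply: subspace_span.
  by apply: sumS_r => //; apply: span_mem; apply: map_f.
have [_ Aw] : kerM D (iter n A) w.
  by apply: span_min tw => // _ /mapP[v vt ->]; have [] := hg v (tD v vt).
suff r0 : r = 0 by exists 0, w; rewrite xE r0.
apply: (core_meet bA Rr (k := n.+1)).
have -> : r = x - w by rewrite xE addrK.
by rewrite (linB (lin_iter _ lA)) iterSr Ax (lin0 (lin_iter n lA)) iterS Aw (lin0 lA) subrr.
Qed.

Lemma BrowderP : Browder D A <-> Fredholm D A /\ exists n, bij_on (rngM D (iter n A)) A.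
Proof.
have hk n := subspace_ker (lin_iter n lA) hD.1.
split=> [[hF [[p hp] [q hq]]]|[hF [n [inj surj]]]]; split=> //; last first.
  split; exists n; apply/seteqP; split=> x.
  - by move=> [Dx Ax]; split=> //=; rewrite Ax lin0.
  - by move=> [Dx /= Ax]; split=> //; apply: inj Ax; exists x.
  - by move=> /surj[_ [d Dd <-] <-]; exists d.
  - by rewrite -addn1; apply: rng_iter_sub.
(* On R(A^(p+q)) the ascent p gives injectivity and the descent q surjectivity. *)
exists (p + q)%N; split.
  move=> _ [d Dd <-] Ad; move: Ad; rewrite iterD -iterS => Ad.
  have : kerM D (iter p.+1 A) (iter q A d) by split=> //; apply: invariant_iter.
  by rewrite -hp => -[_ ->].
move=> _ [d Dd <-].
have : rngM D (iter q A) (iter q A d) by exists d.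
rewrite hq => -[d' Dd' E]; exists (iter (p + q) A d'); first by exists d'.
by rewrite [RHS]iterD -E -iterD addnS iterS.
Qed.

Lemma core_Browder n : bij_on (rngM D (iter n A)) A ->
  fdm (kerM D A) [set 0] \/ fdm D (rngM D A) -> Browder D A.
Proof.
move=> bA h; apply/BrowderP; split; last by exists n.
apply/FredholmP; case: h => h; split=> //; [exact: core_codim bA h|exact: core_dim bA h].
Qed.

Lemma near_bij_Browder : Phi_plus D A \/ Phi_minus D A -> near_bij D A -> Browder D A.
Proof.
case=> h nb.
  have [n bA] := Phi_plus_core h nb; apply: core_Browder bA _; left.
  by apply/fin_dimP; [apply: subspace_ker lA hD.1|case: h].
have [n bA] := Phi_minus_core h nb; apply: core_Browder bA _; right.
by apply/fin_codimP => //; [exact: hD.1|exact: (hR 1)|exact: (@RD 1%N)].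
Qed.

Lemma rng_iter0 : rngM D (iter 0 A) = D.
Proof. by apply/seteqP; split=> [_ [x Dx <-]|x Dx] //; exists x. Qed.

Lemma bij_Browder : bij_on D A -> Browder D A.
Proof.
move=> bA; apply: (@core_Browder 0%N); rewrite ?rng_iter0 //.
by left; apply: fdm_refl => x [Dx] /(bA.1 x Dx).
Qed.

(* On the range of A^n, A - l is invertible for small l; the rest is algebra, as
   A^n y - l^n y is a multiple of (A - l) y. *)
Lemma Browder_near : Browder D A ->
  exists2 r : R, 0 < r & forall l, l != 0 -> cn l < r -> bij_on D (shift A l).
Proof.
move=> /BrowderP[/FredholmP[_ fR] [n bA]].
have cR : closed_subspace (rngM D (iter n A)).
  split=> //; apply: closed_rng_fdm => //; [exact: bounded_iter|exact: invariant_iter|].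
  exact: fdm_rng_iter.
have [r r0 hr] := bij_on_near cR hA (@iR n) bA.
exists r => // l l0 /hr[inj surj].
have pw k x : shift A l x = 0 -> iter k A x = l ^+ k *: x.
  move=> /eqP; rewrite subr_eq0 => /eqP Ax; elim: k => [|k IH]; first by rewrite scale1r.
  by rewrite iterSr Ax (linZ (lin_iter k lA)) IH scalerA -exprS.
have dif k y : D y -> exists2 w, D w & iter k A y - l ^+ k *: y = shift A l w.
  move=> Dy; elim: k => [|k [w Dw E]].
    by exists 0; [exact: subsp0 hD.1|rewrite scale1r subrr (lin0 (lin_shift l lA))].
  exists (iter k A y + l *: w); first by apply: subspD hD.1 _ _ _ _; [apply: invariant_iter|apply: subspZ hD.1 _ _ _].
  rewrite (linD (lin_shift l lA)) (linZ (lin_shift l lA)) -E iterS exprS /shift; lmod R[i].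
split=> [x Dx Ax|y Dy].
  have := pw n x Ax => Anx; apply: inj => //.
  by exists (l ^- n *: x); [apply: subspZ hD.1 _ _ _|rewrite (linZ (lin_iter n lA)) Anx scalerA mulVf ?expf_neq0 // scale1r].
have [|z Rz E] := surj (iter n A y); first by exists y.
have [w Dw E'] := dif n y Dy.
exists (l ^- n *: (z - w)); first by apply: subspZ hD.1 _ _ _; apply: subspB hD.1 _ _ _ _ => //; apply: RD Rz.
rewrite (linZ (lin_shift l lA)) (linB (lin_shift l lA)) E -E' opprB addrC subrK.
by rewrite scalerA mulVf ?expf_neq0 // scale1r.
Qed.

End Core.

(** As A is invertible on M, R(A^k) = M + A^k(N) and N(A) is contained in N, so bijectivity on
    R(A^n) passes from N to X. *)
Lemma sum_Browder M N A : closed_subspace M -> closed_subspace N -> bounded_op A ->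
  invariant A M -> invariant A N -> direct_sum_decomp M N ->
  bij_on M A -> Browder N A -> Browder setT A.
Proof.
move=> hM hN hA iM iN [MNT MN0] [injM surjM] bN; have lA := bounded_lin hA.
have [/(FredholmP hN hA iN)[fk _] [n [injN surjN]]] := (BrowderP hN hA iN).1 bN.
have hT := @closed_subspaceT R X.
have meet x : M x -> N x -> x = 0 by move=> Mx Nx; have : (M `&` N) x by []; rewrite MN0.
have split x : exists a b, [/\ M a, N b & x = a + b].
  by have [a [b [Ma [Nb ->]]]] : sumS M N x; [rewrite MNT|exists a, b].
have RT k x : rngM setT (iter k A) x <-> exists a b, [/\ M a, rngM N (iter k A) b & x = a + b].
  split=> [[y _ <-]|[a [_ [Ma [b Nb <-] ->]]]].
    have [a [b [Ma Nb ->]]] := split y; exists (iter k A a), (iter k A b).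
    by rewrite (linD (lin_iter k lA)); split=> //; [apply: invariant_iter|exists b].
  have [c Mc <-] : exists2 c, M c & iter k A c = a.
    elim: k a Ma => [|k IH] a Ma; first by exists a.
    by have [c /IH[d Md <-] <-] := surjM a Ma; exists d.
  by exists (c + b) => //; rewrite (linD (lin_iter k lA)).
have kE a b : M a -> N b -> A (a + b) = 0 -> a = 0 /\ A b = 0.
  move=> Ma Nb; rewrite (linD lA) => E; have Aa : A a = 0.
    apply: meet; first exact: iM.
    have -> : A a = - A b by apply/eqP; rewrite -addr_eq0 E.
    by apply: subspN; [exact: hN.1|exact: iN].
  by split; [apply: injM|move: E; rewrite Aa add0r].
apply: (@core_Browder setT A hT hA (@invariantT A) n).
  split=> [x /RT[a [b [Ma Rb ->]]] E|y /RT[a [b [Ma Rb ->]]]].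
    have Nb : N b by have [c Nc <-] := Rb; apply: invariant_iter.
    have [-> Ab] := kE a b Ma Nb E; rewrite add0r; exact: injN.
  have [c Mc <-] := surjM a Ma; have [d Rd <-] := surjN b Rb.
  by exists (c + d); [apply/RT; exists c, d|rewrite (linD lA)].
left; apply: fdmS fk => // x [_]; have [a [b [Ma Nb ->]]] := split x.
by move=> /(kE a b Ma Nb)[-> Ab]; rewrite add0r; split.
Qed.

End Perturbation.

(** * Continuation and compactness in the complex plane *)
Section ComplexPlane.
Context {R : realType}.
Implicit Types (l m : R[i]).

(** [punctured] leaves the centre free, while [adherent] may be witnessed by the centre itself. The
    former is what survives at a Kato-Riesz point, the latter is all that a limit of good points
    provides. *)
Definition punctured (P : R[i] -> Prop) l :=
  exists2 r : R, 0 < r & forall m, m != l -> cn (m - l) < r -> P m.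
Definition adherent (P : R[i] -> Prop) l :=
  forall e : R, 0 < e -> exists2 m, cn (m - l) < e & P m.

Lemma small_neq0 (e : R) : 0 < e -> exists2 m, m != 0 & cn m < e.
Proof.
move=> e0; exists (e / 2)%:C%C; last by rewrite cnR gtr0_norm; lra.
by rewrite -cn_gt0 cnR gtr0_norm; lra.
Qed.

Lemma punctured_adherent P l : punctured P l -> adherent P l.
Proof.
move=> [r r0 h] e e0; have [|d d0 dr] := @small_neq0 (Num.min e r).
  by rewrite lt_min e0.
move: dr; rewrite lt_min => /andP[de dr].
have E : l + d - l = d by rewrite addrC addKr.
by exists (l + d); [rewrite E|apply: h; [rewrite -subr_eq0 E|rewrite E]].
Qed.

Lemma punctured_near P l : punctured P l ->
  exists2 r : R, 0 < r & forall m, m != l -> cn (m - l) < r -> punctured P m.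
Proof.
move=> [r r0 h]; exists (r / 2); first by rewrite divr_gt0.
move=> m ml hm; exists (cn (m - l)); first by rewrite cn_gt0 subr_eq0.
move=> k km hk; apply: h.
  by apply: contraTneq hk => ->; rewrite cnBC ltxx.
by have := cn_tri k m l; lra.
Qed.

(* Continuous induction along a ray from [l] to infinity avoiding [F]. *)
Lemma ray_induction (P : R[i] -> Prop) (F : set R[i]) (C : R) :
  finite_set F -> (forall m, C < cn m -> P m) ->
  (forall l, ~ F l -> adherent P l -> punctured P l) ->
  forall l, ~ F l -> punctured P l.
Proof.
move=> /finite_seqP[s ->] {F} hC hP l nl.
(* With a slope k above those of all f - l, the ray l + t (1 + i k), t > 0, misses s, since f on it
   would have slope exactly k. If Re (f - l) = 0 the quotient is 0 by convention, and f is off the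
   ray because t > 0. *)
have [k hk] : exists k : R, forall f, f \in s ->
    complex.Im (f - l) / complex.Re (f - l) < k.
  elim: s {nl hP} => [|f s [k hk]]; first by exists 0.
  exists (Num.max k (complex.Im (f - l) / complex.Re (f - l) + 1)) => g.
  rewrite inE lt_max => /orP[/eqP->|/hk->//]; by rewrite ltrDl ltr01 orbT.
pose d : R[i] := (1 +i* k)%C.
have d1 : 1 <= cn d by apply: le_trans (Re_le_cn d).
pose p (t : R) := l + t%:C%C * d.
have pB t u : cn (p t - p u) = `|t - u| * cn d.
  by rewrite -cnR -cnM; congr cn; rewrite /p rmorphB /=; ring.
have pF t : 0 <= t -> p t \notin s.
  rewrite le_eqVlt => /orP[/eqP<-|t0]; first by rewrite /p mul0r addr0; apply/negP.
  apply/negP => /hk; have -> : p t - l = t%:C%C * d by rewrite /p addrC addKr.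
  by rewrite /d /=; simpc; rewrite /= mulrAC divff ?gt_eqF // mul1r ltxx.
have far t : C + cn l + 1 < t -> punctured P (p t).
  move=> ht; exists 1 => // m _ hm; apply: hC.
  have := cn_tri (p t) m l; have := cn_tri (m) (0) l; rewrite subr0 sub0r cnN.
  have -> : p t - l = t%:C%C * d by rewrite /p addrC addKr.
  rewrite cnM cnR cnBC in hm *; have := ler_norm t; have := normr_ge0 t; nra.
apply: contrapT => nG.
(* Let z be the supremum of the bad parameters. Points just beyond z are good, so [p z] is a limit
   of good points and becomes punctured; then so do all nearby [p t], contrary to the choice of
   z. *)
pose B := [set t | 0 <= t /\ ~ punctured P (p t)].
have B0 : B 0 by split=> //; rewrite /p mul0r addr0.
have Bub : has_ubound B.
  by exists (C + cn l + 1) => t [_ nGt]; rewrite leNgt; apply/negP => /far.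
have hs : has_sup B by split=> //; exists 0.
set z := sup B.
have z0 : 0 <= z by apply: ub_le_sup.
have beyond t : z < t -> punctured P (p t).
  move=> zt; apply: contrapT => nGt; have : t <= z; last lra.
  by apply: ub_le_sup => //; split=> //; lra.
have cd : 0 < cn d by lra.
have : punctured P (p z).
  apply: hP => [|e e0]; first by apply/negP/pF.
  have e1 : 0 < e / 2 / cn d by rewrite !divr_gt0.
  have [|m hm Pm] := punctured_adherent (beyond (z + e / 2 / cn d) _) (divr_gt0 e0 (ltr0Sn R 1)).
    by rewrite ltrDl.
  exists m => //; have := cn_tri m (p (z + e / 2 / cn d)) (p z); rewrite pB.
  have -> : z + e / 2 / cn d - z = e / 2 / cn d by rewrite addrC addKr.
  rewrite gtr0_norm // divfK ?gt_eqF //; lra.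
move=> /[dup] Gz /punctured_near[r r0 hr].
have [t [t0 nGt] ht] := sup_adherent (divr_gt0 r0 cd) hs.
have tz : t <= z by apply: ub_le_sup.
have [tE|tz'] := eqVneq t z; first by apply: nGt; rewrite tE.
apply: nGt; apply: hr.
  by rewrite -subr_eq0 -cn_gt0 pB mulr_gt0 // normr_gt0 subr_eq0.
rewrite pB -ltr_pdivlMr // distrC ger0_norm ?subr_ge0 //; move: ht; rewrite -/z; lra.
Qed.

(** Compactness of a segment: [P u v] stands for a property of [u, v] that is additive and holds
    near each point. The supremum of the endpoints reachable from a cannot stop before b. *)
Lemma real_cover (P : R -> R -> Prop) a b :
  (forall x, exists2 r : R, 0 < r & forall u v, x - r < u -> v < x + r -> P u v) ->
  (forall u v w, u <= v -> v <= w -> P u v -> P v w -> P u w) -> a <= b -> P a b.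
Proof.
move=> loc trans ab; pose S := [set t | [/\ a <= t, t <= b & P a t]].
have Sa : S a by split=> //; have [r r0 h] := loc a; apply: h; lra.
have Sb : has_ubound S by exists b => t [].
have hS : has_sup S by split=> //; exists a.
have [r r0 h] := loc (sup S).
have as_ : a <= sup S by apply: ub_le_sup.
have sb : sup S <= b by apply: ge_sup => [|t []//]; exists a.
have [t [at_ tb Pt] ht] := sup_adherent r0 hS.
have ts : t <= sup S by apply: ub_le_sup.
have [bs|sb'] := leP b (sup S + r / 2).
  by apply: (trans _ t) => //; apply: h => //; lra.
suff : sup S + r / 2 <= sup S by lra.
apply: ub_le_sup => //; split; try lra.
by apply: (trans _ t) => //; [lra|apply: h => //; lra].
Qed.

(** Compactness of discs, phrased for an ideal Q of sets instead of open covers; Q will mean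
    finiteness or the existence of a bound. [real_cover] is applied along vertical segments, which
    gives strips, and then across the strips. *)
Lemma plane_cover (Q : set R[i] -> Prop) :
  (forall A B, A `<=` B -> Q B -> Q A) -> (forall A B, Q A -> Q B -> Q (A `|` B)) ->
  (forall l, exists2 r : R, 0 < r & Q [set m | cn (m - l) < r]) ->
  forall b : R, Q [set m | cn m <= b].
Proof.
move=> mono union loc b.
have [b0|b0] := leP 0 b; last first.
  have [r _ hr] := loc 0; apply: mono hr => m /= hm.
  by have := cn_ge0 m; lra.
have strip x : exists2 r : R, 0 < r &
    Q [set m | `|complex.Re m - x| < r /\ - b <= complex.Im m <= b].
  apply: (@real_cover (fun u v => exists2 r : R, 0 < r &
    Q [set m | `|complex.Re m - x| < r /\ u <= complex.Im m <= v])); last lra.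
    move=> y; have [r r0 hr] := loc (x +i* y)%C; exists (r / 2); first lra.
    move=> u v hu hv; exists (r / 2); first lra.
    apply: mono hr => -[x' y'] /= [hx /andP[h1 h2]].
    apply: le_lt_trans (cn_le_ReIm _ _) _.
    have : `|y' - y| < r / 2 by rewrite ltr_norml; lra.
    lra.
  move=> u v w uv vw [r r0 hr] [q q0 hq]; exists (Num.min r q).
    by rewrite lt_min r0.
  apply: mono (union _ _ hr hq) => m /= [].
  rewrite lt_min => /andP[h1 h2] /andP[h3 h4].
  by have [h|h] := leP (complex.Im m) v; [left|right]; split=> //; apply/andP; split=> //; apply: ltW.
have : Q [set m | - b <= complex.Re m <= b /\ - b <= complex.Im m <= b].
  apply: (@real_cover (fun u v =>
    Q [set m | u <= complex.Re m <= v /\ - b <= complex.Im m <= b])); last lra.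
    move=> x; have [r r0 hr] := strip x; exists r => // u v hu hv.
    apply: mono hr => m /= [h1 h2]; split=> //; rewrite ltr_norml; lra.
  move=> u v w uv vw h1 h2; apply: mono (union _ _ h1 h2) => m /= [/andP[h3 h4] h5].
  by have [h|h] := leP (complex.Re m) v; [left|right]; split=> //; apply/andP; split=> //; apply: ltW.
apply: mono => m /= hm; rewrite -!ler_norml.
by split; apply: le_trans hm; [apply: absRe_le_cn|apply: absIm_le_cn].
Qed.

End ComplexPlane.

(** * Finiteness of the Browder spectrum *)
Section Spectrum.
Context {R : realType} {X : completeNormedModType R[i]}.
Implicit Types (x y z v : X) (M N D : set X) (A T : X -> X) (l m : R[i]).

Section OnSubspace.
Variables (D : set X) (T : X -> X).
Hypotheses (hD : closed_subspace D) (hT : bounded_op T) (iT : invariant T D).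
Let hS l : bounded_op (shift T l). Proof. exact: bounded_shift. Qed.
Let iS l : invariant (shift T l) D. Proof. exact: invariant_shift hD.1 iT. Qed.

Lemma bij_far : exists C : R, forall l, C < cn l -> bij_on D (shift T l).
Proof.
have [lT [C C0 hC]] := (bounded_opP T).1 hT; exists (2 * C) => l hl.
have cl : 0 < cn l by lra.
have l0 : l != 0 by rewrite -cn_gt0.
split=> [x Dx /eqP|y Dy].
  rewrite subr_eq0 => /eqP E; have := hC x; rewrite E nrmZ => b.
  apply/eqP; rewrite -nrm_eq0; have := nrm_ge0 x; rewrite eq_le => ->; rewrite andbT; nra.
have [||x [f [Dx -> -> _ _]]] := @approx_surj R X D [set 0] (shift T l) D (cn l)^-1 hD
  closed_subspace0 (hS l) _ _ y Dy; last by exists x; rewrite ?addr0.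
  by rewrite invr_ge0 ltW.
(* - y / l solves (T - l) x = y up to T y / l, of norm at most |y| / 2 once |l| > 2 C. *)
move=> {y Dy} y Dy; exists (- (l^-1 *: y)), 0.
have E : y - (shift T l (- (l^-1 *: y)) + 0) = l^-1 *: T y.
  by rewrite /shift (linN lT) (linZ lT); lmod R[i]; field.
rewrite E nrmN !nrmZ cnV nrm0; split=> //.
- by apply: subspN hD.1 _ _; apply: subspZ hD.1 _ _ _.
- by rewrite mulr_ge0 ?nrm_ge0 // invr_ge0 ltW.
split; last by apply: subspZ hD.1 _ _ _; apply: iT.
rewrite ler_pdivrMl //; apply: le_trans (hC y) _; have := nrm_ge0 y; nra.
Qed.

Lemma Browder_punctured l : Browder D (shift T l) ->
  punctured (fun m => bij_on D (shift T m)) l.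
Proof.
move=> /(Browder_near hD (hS l) (@iS l))[r r0 hr]; exists r => // m ml hm.
by rewrite -(subrKC l m) -shiftD; apply: hr; rewrite ?subr_eq0.
Qed.

(** A Browder point need not be invertible, but invertible points surround it; two steps of length
    below e / 2 reach one from l. *)
Lemma adherent_near_bij l : adherent (fun m => Browder D (shift T m)) l ->
  near_bij D (shift T l).
Proof.
move=> h e e0; have e2 : 0 < e / 2 by rewrite divr_gt0.
have [m hm /Browder_punctured /punctured_adherent Pm] := h _ e2.
have [k hk bk] := Pm _ e2.
exists (k - l); first by have := cn_tri k m l; lra.
by rewrite shiftD subrKC.
Qed.

Lemma bij_Browder_shift l : bij_on D (shift T l) -> Browder D (shift T l).
Proof. exact: bij_Browder. Qed.

Lemma punctured_bij_Browder l : punctured (fun m => bij_on D (shift T m)) l ->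
  punctured (fun m => Browder D (shift T m)) l.
Proof. by move=> [r r0 hr]; exists r => // m ml hm; apply: bij_Browder_shift; apply: hr. Qed.

Lemma Browder_far : exists C : R, forall l, C < cn l -> Browder D (shift T l).
Proof. by have [C hC] := bij_far; exists C => l /hC /bij_Browder_shift. Qed.

(** [key] promotes a limit of Browder points outside F to a Browder point. It serves twice: as the
    step of the ray induction and, at the end, at l itself. *)
Lemma semiFredholm_Browder (F : set R[i]) : finite_set F ->
  (forall l, ~ F l -> Phi_plus D (shift T l) \/ Phi_minus D (shift T l)) ->
  forall l, ~ F l -> Browder D (shift T l).
Proof.
move=> fF hF l nl; have [C hC] := Browder_far.
have key k : ~ F k -> adherent (fun m => Browder D (shift T m)) k -> Browder D (shift T k).
  by move=> nk /adherent_near_bij; apply: near_bij_Browder (hF k nk).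
apply: (key l nl); apply: punctured_adherent; apply: (ray_induction fF hC) => // k nk ak.
by apply: punctured_bij_Browder; apply: Browder_punctured; apply: key.
Qed.

Lemma Riesz_Browder : Riesz D T -> forall l, l != 0 -> Browder D (shift T l).
Proof.
move=> hR l l0; apply: (@semiFredholm_Browder [set 0]) => //; last by apply/eqP.
by move=> k /eqP /hR[? _]; left.
Qed.

End OnSubspace.

Lemma near_bij_summand M N A : subspace M -> subspace N -> lin A -> invariant A M -> invariant A N ->
  direct_sum_decomp M N -> near_bij setT A -> near_bij M A.
Proof.
move=> hM hN lA iM iN [MNT MN0] nb e /nb[l hl [inj surj]]; exists l => //.
split=> [x _|y My]; first exact: inj.
have lS := lin_shift l lA.
have [x _ xy] := surj y I.
have [a [b [Ma [Nb xE]]]] : sumS M N x by rewrite MNT.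
suff b0 : b = 0 by exists a => //; rewrite -xy xE b0 addr0.
have Sb : shift A l b = y - shift A l a.
  by rewrite -xy xE (linD lS) addrC addKr.
apply: inj => //; have : (M `&` N) (shift A l b); last by rewrite MN0.
split; last exact: invariant_shift.
by rewrite Sb; apply: subspB => //; apply: invariant_shift.
Qed.

Lemma gKato_Riesz_punctured T l : bounded_op T -> gKato_Riesz (shift T l) ->
  adherent (fun m => Browder setT (shift T m)) l ->
  punctured (fun m => Browder setT (shift T m)) l.
Proof.
move=> hT [M [N [hM [hN [iM [iN [dMN [kM rN]]]]]]]] al.
have hX := @closed_subspaceT R X.
have hA : bounded_op (shift T l) by apply: bounded_shift.
have nb := adherent_near_bij hX hT (@invariantT _ _ T) al.
have bM := Kato_bij hM hA iM kM (near_bij_summand hM.1 hN.1 (bounded_lin hA) iM iN dMN nb).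
have [r r0 hr] := bij_on_near hM hA iM bM.
exists r => // m ml hm; rewrite -(subrKC l m) -shiftD.
apply: (sum_Browder hM hN) => //; first exact: bounded_shift.
- exact: invariant_shift hM.1 iM.
- exact: invariant_shift hN.1 iN.
- exact: hr.
- by apply: Riesz_Browder; rewrite ?subr_eq0.
Qed.

Lemma gKato_Riesz_ray T (F : set R[i]) : bounded_op T -> finite_set F ->
  (forall l, ~ F l -> gKato_Riesz (shift T l)) ->
  forall l, ~ F l -> punctured (fun m => Browder setT (shift T m)) l.
Proof.
move=> hT fF hF; have [C hC] := Browder_far (@closed_subspaceT R X) hT (@invariantT _ _ T).
by apply: (ray_induction fF hC) => l nl; apply: gKato_Riesz_punctured => //; apply: hF.
Qed.

Lemma fin_dim_Fredholm N A : closed_subspace N -> bounded_op A -> invariant A N -> fin_dim N ->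
  Fredholm N A.
Proof.
move=> hN hA iN /(fin_dimP hN.1) fN; apply/FredholmP => //.
split; first by apply: fdmS fN => // x [].
by apply: fdmS fN => //; apply: set0_sub; apply: subspace_rng (bounded_lin hA) hN.1.
Qed.

Lemma essentially_Kato_gKR A : bounded_op A -> essentially_Kato A -> gKato_Riesz A.
Proof.
move=> hA [M [N [hM [hN [iM [iN [dMN [fN [kM _]]]]]]]]].
exists M, N; do 6 (split; first by []); move=> l _.
by apply: fin_dim_Fredholm => //; [exact: bounded_shift|exact: invariant_shift hN.1 iN].
Qed.

Lemma essentially_Kato_Browder A : bounded_op A -> essentially_Kato A -> near_bij setT A ->
  Browder setT A.
Proof.
move=> hA [M [N [hM [hN [iM [iN [dMN [fN [kM [k nN]]]]]]]]]] nb; have lA := bounded_lin hA.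
have bM := Kato_bij hM hA iM kM (near_bij_summand hM.1 hN.1 lA iM iN dMN nb).
apply: (sum_Browder hM hN) => //; apply/BrowderP => //; split; first exact: fin_dim_Fredholm.
(* A^k vanishes on N, so its range there is zero and bijectivity is trivial. *)
exists k; split=> [_ [x Nx <-] _|_ [x Nx <-]]; first exact: nN.
by rewrite nN //; exists 0; rewrite ?lin0 //; exists 0; [exact: subsp0 hN.1|rewrite (lin0 (lin_iter k lA))].
Qed.

(** The Fitting summands R(A^n) and N(A^n). They give the Kato decomposition and reduce the index to
    a finite-dimensional space. *)
Lemma Browder_decomp A : bounded_op A -> Browder setT A ->
  exists M N, [/\ closed_subspace M, closed_subspace N, invariant A M, invariant A N &
    [/\ direct_sum_decomp M N, fin_dim N, bij_on M A & nilpotent_on N A]].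
Proof.
move=> hA bA; have lA := bounded_lin hA; have hX := @closed_subspaceT R X.
have iX := @invariantT R X A.
have [/(FredholmP hX hA iX)[fk fR] [n bn]] := (BrowderP hX hA iX).1 bA.
have iR : invariant A (rngM setT (iter n A)).
  by move=> _ [x _ <-]; exists (A x) => //; rewrite -iterSr.
exists (rngM setT (iter n A)), (kerM setT (iter n A)); split=> //.
- split; first exact: subspace_rng (lin_iter n lA) hX.1.
  apply: closed_rng_fdm => //; first exact: bounded_iter.
  exact: fdm_rng_iter.
- exact: closed_ker (bounded_iter n hA) hX.
- by move=> x [_ Ax]; split=> //; rewrite -iterSr /= Ax lin0.
split=> //.
- split; apply/seteqP; split=> // x.
  + by move=> _; have [r [k [Rr Kk ->]]] := core_split hX hA iX bn (I : setT x); exists r, k.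
  + by move=> [Rx [_ Ax]] /=; apply: core_meet Rx _ Ax.
  + by move=> ->; split; apply: subsp0; [apply: subspace_rng|apply: subspace_ker] => //; apply: lin_iter.
- apply/fin_dimP; first exact: subspace_ker (lin_iter n lA) hX.1.
  exact: fdm_ker_iter.
- by exists n => x [].
Qed.

Lemma bij_Kato M A : closed_subspace M -> invariant A M -> bij_on M A -> lin A -> Kato M A.
Proof.
move=> hM iM [inj surj] lA; have RM : rngM M A = M.
  by apply/seteqP; split=> [_ [x Mx <-]|y /surj[x Mx <-]]; [exact: iM|exists x].
split; first by rewrite RM; exact: hM.2.
move=> n x [Mx Ax]; rewrite (inj x Mx Ax).
by exists 0; [exact: subsp0 hM.1|rewrite (lin0 (lin_iter n lA))].
Qed.

Lemma Browder_essentially_Kato A : bounded_op A -> Browder setT A -> essentially_Kato A.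
Proof.
move=> hA /(Browder_decomp hA)[M [N [hM hN iM iN [dMN fN bM nN]]]].
exists M, N; do 6 (split; first by []); split; last by [].
exact: bij_Kato (bounded_lin hA).
Qed.

Section FiniteSpectra.
Variables (T : X -> X) (hT : bounded_op T).
Let hX := @closed_subspaceT R X.
Let iX := @invariantT R X T.

Lemma sub_spec (P Q : (X -> X) -> Prop) :
  (forall A, bounded_op A -> P A -> Q A) ->
  finite_set (spec P T) -> finite_set (spec Q T).
Proof.
move=> PQ; apply: sub_finite_set => l nQ Pl; apply: nQ; apply: PQ => //; exact: bounded_shift.
Qed.

Lemma finite_spec_Browder : (forall l, punctured (fun m => Browder setT (shift T m)) l) ->
  finite_set (spec (Browder setT) T).
Proof.
move=> h; have [C hC] := Browder_far hX hT iX.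
(* Sets meeting the Browder spectrum in finitely many points form an ideal containing a disc about
   each l, where only l can be spectral; the whole spectrum lies in the disc of radius C. *)
have := @plane_cover R (fun S => finite_set (S `&` spec (Browder setT) T)) _ _ _ C.
rewrite (_ : _ `&` _ = spec (Browder setT) T); last first.
  by apply/setIidr => l nl /=; rewrite leNgt; apply/negP => /hC.
apply.
- by move=> A B AB; apply: sub_finite_set => l [/AB].
- by move=> A B fA fB; rewrite setIUl finite_setU.
move=> l; have [r r0 hr] := h l; exists r => //.
apply: (sub_finite_set _ (finite_set1 l)) => m [/= hm nm].
by apply: contrapT => /eqP ml; apply: nm; apply: hr.
Qed.

Lemma spec_gKR_Browder : spec gKato_Riesz T = set0 -> finite_set (spec (Browder setT) T).
Proof.
move=> s0; apply: finite_spec_Browder => l.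
apply: (@gKato_Riesz_ray T set0) => // k _; apply: contrapT => nk.
by have : spec gKato_Riesz T k by []; rewrite s0.
Qed.

Lemma spec_semiFredholm_Browder (P : (X -> X) -> Prop) :
  (forall A, P A -> Phi_plus setT A \/ Phi_minus setT A) ->
  finite_set (spec P T) -> finite_set (spec (Browder setT) T).
Proof.
move=> hP fP; apply: sub_finite_set (fP) => l nB Pl; apply: nB.
apply: (@semiFredholm_Browder setT T hX hT iX _ fP) => [k nk|]; last by move=> /(_ Pl).
by apply: hP; apply: contrapT.
Qed.

(** The ray argument, run with the weaker Kato-Riesz property, gives Browder points only around l;
    the finite-dimensional nilpotent part then makes l itself Browder. *)
Lemma spec_eK_Browder : finite_set (spec essentially_Kato T) -> finite_set (spec (Browder setT) T).
Proof.
move=> fP; apply: sub_finite_set (fP) => l nB Pl; apply: nB.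
apply: essentially_Kato_Browder => //; first exact: bounded_shift.
apply: (adherent_near_bij hX hT iX); apply: punctured_adherent.
apply: (gKato_Riesz_ray hT fP) => [k nk|]; last by move=> /(_ Pl).
by apply: essentially_Kato_gKR; [exact: bounded_shift|exact: contrapT].
Qed.

End FiniteSpectra.
End Spectrum.

(** * The index of a Browder operator *)
Section Coordinates.
Context {K : numFieldType} {V : normedModType K}.
Variables (d : nat) (b : 'I_d -> V).

(** Row vectors are used so that an operator becomes right multiplication by a matrix and spans
    become row spaces. *)
Definition comb (c : 'rV[K]_d) : V := \sum_i c 0 i *: b i.

Lemma combB c e : comb (c - e) = comb c - comb e.
Proof. by rewrite /comb -sumrB; apply: eq_bigr => i _; rewrite !mxE scalerBl. Qed.
Lemma combD c e : comb (c + e) = comb c + comb e.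
Proof. by rewrite /comb -big_split; apply: eq_bigr => i _; rewrite !mxE scalerDl. Qed.
Lemma comb_mul k (a : 'rV[K]_k) (C : 'M[K]_(k, d)) :
  comb (a *m C) = \sum_i a 0 i *: comb (row i C).
Proof.
rewrite /comb; under eq_bigr do rewrite !mxE scaler_suml.
rewrite exchange_big; apply: eq_bigr => i _; rewrite scaler_sumr.
by apply: eq_bigr => j _; rewrite !mxE scalerA.
Qed.
Lemma subspace_comb k (C : 'M[K]_(k, d)) : subspace [set x | exists a : 'rV_k, x = comb (a *m C)].
Proof.
split=> [|a _ _ [u ->] [v ->]].
  by exists 0; rewrite mul0mx /comb big1 // => i _; rewrite mxE scale0r.
exists (a *: u + v); rewrite mulmxDl combD -scalemxAl; congr (_ + _).
by rewrite /comb scaler_sumr; apply: eq_bigr => i _; rewrite !mxE scalerA.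
Qed.

Definition comb_rows k (C : 'M[K]_(k, d)) : seq V := [seq comb (row i C) | i <- enum 'I_k].

Lemma size_comb_rows k (C : 'M[K]_(k, d)) : size (comb_rows C) = k.
Proof. by rewrite size_map size_enum_ord. Qed.

Lemma span_comb_rows k (C : 'M[K]_(k, d)) x :
  spanS (comb_rows C) x <-> exists a : 'rV_k, x = comb (a *m C).
Proof.
split=> [|[a ->]].
  apply: (span_min (subspace_comb C)) => _ /mapP[i _ ->].
  by exists (delta_mx 0 i); rewrite -rowE.
rewrite comb_mul; apply: subsp_sum; first exact: subspace_span.
move=> i; apply: subspZ; first exact: subspace_span.
by apply: span_mem; apply: map_f; rewrite mem_enum.
Qed.

Lemma comb_coords t : (forall v, v \in t -> exists c, v = comb c) ->
  exists C : 'M[K]_(size t, d), forall x, spanS t x -> exists a : 'rV_(size t), x = comb (a *m C).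
Proof.
move=> h; have /choice[g hg] : forall i : 'I_(size t), exists c, t`_i = comb c.
  by move=> i; apply: h; rewrite mem_nth.
exists (\matrix_i g i) => x [c ->]; exists (\row_i c i); rewrite comb_mul.
by apply: eq_bigr => i _; rewrite rowK mxE hg.
Qed.
End Coordinates.

Lemma indep_free (K : numFieldType) (V : normedModType K) (s : seq V) (c : 'I_(size s) -> K) :
  indep [set 0] s -> \sum_i c i *: s`_i = 0 -> forall i, c i = 0.
Proof.
elim: s c => [|v s IH] c /=; first by move=> _ _ [].
move=> [si nv]; rewrite big_ord_recl /= => E.
have c0 : c ord0 = 0.
  apply/eqP; apply: contrapT => /negP c0; apply: nv.
  exists 0, (- ((c ord0)^-1 *: \sum_(i < size s) c (lift ord0 i) *: s`_i)); split=> //.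
  split; first by apply: subspN (subspace_span _) _ _; apply: subspZ (subspace_span _) _ _ _; eexists.
  move/eqP: E; rewrite addr_eq0 => /eqP E; rewrite add0r -scalerN -E.
  by rewrite scalerA mulVf // scale1r.
move=> i; case: (unliftP ord0 i) => [j ->|-> //].
by apply: (IH (fun j => c (lift ord0 j)) si); move: E; rewrite c0 scale0r add0r.
Qed.

(** Invertibility on M moves kernel and cokernel to N, where A is a d x d matrix B whose nullity and
    corank are both d - rank B. As [has_dim] and [has_codim_in] speak of minimal generating lists,
    each equality is two inequalities: a list is exhibited, and the rank of the given list is
    estimated. *)
Lemma bij_on_index (K : numFieldType) (V : normedModType K) (M N : set V) (A : V -> V) k n :
  subspace M -> subspace N -> lin A -> invariant A M -> invariant A N ->
  direct_sum_decomp M N -> fin_dim N -> bij_on M A ->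
  has_dim (kerM setT A) k -> has_codim_in setT (rngM setT A) n -> k = n.
Proof.
move=> hM hN lA iM iN [MNT MN0] /(fin_dimP hN)[s0 Ns0] [injM surjM].
move=> [[t [<- tk]] mink] [[u [<- [_ uT]]] minn] {k n}.
have [s [_ sN NE si]] := sub_span_mod subspace_set0 hN (set0_sub hN) Ns0.
pose d := size s; pose phi := comb (fun i : 'I_d => s`_i).
have phiN c : N (phi c) by apply: subsp_sum => // i; apply: subspZ => //; apply: sN; rewrite mem_nth.
have phi_inj c : phi c = 0 -> c = 0.
  by move=> h; apply/rowP => i; rewrite mxE; apply: (indep_free si (c := fun i => c 0 i)).
have phi_surj x : N x -> exists c, x = phi c.
  rewrite NE => -[_ [_ [-> [[c ->] ->]]]]; exists (\row_i c i); rewrite add0r.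
  by apply: eq_bigr => i _; rewrite mxE.
have /choice[g hg] : forall i : 'I_d, exists c, A s`_i = phi c.
  by move=> i; apply: phi_surj; apply: iN; apply: sN; rewrite mem_nth.
pose B := \matrix_i g i.
have Aphi c : A (phi c) = phi (c *m B).
  by rewrite /phi comb_mul (lin_sum lA); apply: eq_bigr => i _; rewrite (linZ lA) hg rowK.
have meet x : M x -> N x -> x = 0 by move=> Mx Nx; have : (M `&` N) x by []; rewrite MN0.
have split x : exists a b, [/\ M a, N b & x = a + b].
  by have [a [b [Ma [Nb ->]]]] : sumS M N x; [rewrite MNT|exists a, b].
have kerN x : kerM setT A x -> N x.
  move=> [_]; have [a [b [Ma Nb ->]]] := split x; rewrite (linD lA) => E.
  suff -> : a = 0 by rewrite add0r.
  apply: injM => //; apply: meet; first exact: iM.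
  have -> : A a = - A b by apply/eqP; rewrite -addr_eq0 E.
  by apply: subspN => //; exact: iN.
have inj_eq c e : phi c = phi e -> c = e.
  by move=> E; apply/eqP; rewrite -subr_eq0; apply/eqP; apply: phi_inj; rewrite /phi combB -/phi E subrr.
have kerB c : kerM setT A (phi c) <-> (c <= kermx B)%MS.
  split=> [[_]|/sub_kermxP h]; last by split=> //; rewrite Aphi h /phi /comb big1 // => i _; rewrite mxE scale0r.
  by rewrite Aphi => /phi_inj /sub_kermxP.
have k1 : (size t <= d - \rank B)%N.
  rewrite -mxrank_ker -(size_comb_rows (fun i : 'I_d => s`_i) (row_base (kermx B))); apply: mink.
  apply/seteqP; split=> x.
    move=> /[dup] /kerN /phi_surj[c ->] /kerB; rewrite -(eq_row_base (kermx B)) => /submxP[a ->].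
    by apply/span_comb_rows; exists a.
  move=> /span_comb_rows[a ->]; apply/kerB.
  by rewrite (submx_trans (submxMl _ _)) // eq_row_base.
have k2 : (d - \rank B <= size t)%N.
  have [|C hC] := @comb_coords K V d (fun i : 'I_d => s`_i) t.
    by move=> v vt; apply: phi_surj; apply: kerN; rewrite tk; apply: span_mem.
  rewrite -mxrank_ker; apply: leq_trans (rank_leq_row C); apply: mxrankS.
  apply/row_subP => i; have /kerB : (row i (kermx B) <= kermx B)%MS by apply: row_sub.
  by rewrite tk => /hC[a /inj_eq ->]; apply: submxMl.
have n1 : (size u <= d - \rank B)%N.
  rewrite -mxrank_compl -(size_comb_rows (fun i : 'I_d => s`_i) (row_base (B^C)%MS)).
  apply: minn => //; apply/seteqP; split=> // x _.
  have [a [b [Ma /phi_surj[c ->] ->]]] := split x.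
  have [a' Ma' <-] := surjM a Ma.
  have /sub_addsmxP[[v w] /= ->] : (c <= B + B^C)%MS by rewrite submx_full ?addsmx_compl_full.
  have /submxP[w' ->] : (w *m B^C <= row_base B^C)%MS by rewrite eq_row_base submxMl.
  exists (A (a' + phi v)), (phi (w' *m row_base (B^C)%MS)); split; first by exists (a' + phi v).
  split; first by apply/span_comb_rows; exists w'.
  by rewrite (linD lA) Aphi /phi combD addrA.
(* The N-components of u, with coordinates C, together with the rows of B span all of N, so d <=
   rank B + size u. *)
have n2 : (d - \rank B <= size u)%N.
  have /choice[h hh] : forall v, exists b, N b /\ M (v - b).
    by move=> v; have [a [b [Ma Nb ->]]] := split v; exists b; rewrite addrK.
  have [|C hC] := @comb_coords K V d (fun i : 'I_d => s`_i) (map h u).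
    by move=> _ /mapP[v _ ->]; apply: phi_surj; have [] := hh v.
  rewrite leq_subLR; have : (1%:M <= B + C)%MS.
    apply/row_subP => i; set c := row i _.
    have : setT (phi c) by [].
    rewrite uT => -[_ [w [[x _ <-] [uw E]]]].
    have [a [b [Ma Nb xE]]] := split x.
    have : sumS M (spanS (map h u)) w.
      apply: (span_min _ _ uw); first by apply: subspace_sum => //; apply: subspace_span.
      move=> v vu; have [Nv Mv] := hh v; exists (v - h v), (h v); rewrite subrK.
      by split=> //; split=> //; apply: span_mem; apply: map_f.
    move=> [m [w' [Mm [/hC[e eE] wE]]]].
    have [f fE] := phi_surj b Nb.
    suff -> : c = f *m B + e *m C by apply: addmx_sub_adds; apply: submxMl.
    rewrite -/phi in eE; apply: inj_eq; rewrite /phi combD -/phi -Aphi -fE -eE.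
    apply/eqP; rewrite -subr_eq0; apply/eqP; apply: meet.
      have -> : phi c - (A b + w') = A a + m by rewrite E xE wE (linD lA); lmod K.
      by apply: subspD => //; apply: iM.
    apply: subspB => //; apply: subspD => //; first exact: iN.
    by rewrite eE; apply: phiN.
  move=> /mxrankS; rewrite mxrank1 => /leq_trans; apply.
  apply: leq_trans (mxrank_adds_leqif B C) _.
  by rewrite leq_add2l -(size_map h u) rank_leq_row.
by apply/eqP; rewrite eqn_leq (leq_trans k1 n2) (leq_trans n1 k2).
Qed.

Lemma Browder_Weyl (R : realType) (X : completeNormedModType R[i]) (A : X -> X) :
  bounded_op A -> Browder setT A -> Weyl setT A.
Proof.
move=> hA bA; split; first by case: bA.
have [M [N [[hM _] [hN _] iM iN [dMN fN bM _]]]] := Browder_decomp hA bA.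
by move=> k n; apply: (bij_on_index hM hN (bounded_lin hA) iM iN dMN fN bM).
Qed.

(** * Polynomially Riesz operators *)
Section Polynomials.
Context {R : realType} {X : completeNormedModType R[i]}.
Implicit Types (x y : X) (A B T G : X -> X) (l m c : R[i]) (p q : {poly R[i]}).

Lemma bounded_lincomb A B c : bounded_op A -> bounded_op B ->
  bounded_op (fun x => A x + c *: B x).
Proof.
move=> /bounded_opP[lA [C C0 hC]] /bounded_opP[lB [C' C0' hC']]; apply/bounded_opP.
split; first by move=> a x y; rewrite lA lB; lmod R[i].
exists (C + cn c * C'); first by rewrite ltr_pwDl // mulr_ge0 ?cn_ge0 // ltW.
move=> x; apply: le_trans (nrmD _ _) _; rewrite nrmZ mulrDl lerD // -mulrA.
by rewrite ler_wpM2l ?cn_ge0.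
Qed.

Section PolyOp.
Variables (A : X -> X) (hA : bounded_op A).
Let lA : lin A := bounded_lin hA.

Lemma poly_op_wide p n x : (size p <= n)%N ->
  poly_op p A x = \sum_(i < n) p`_i *: iter i A x.
Proof.
move=> pn; rewrite /poly_op (big_ord_widen n (fun i => p`_i *: iter i A x)) //.
rewrite big_mkcond; apply: eq_bigr => i _; case: ltnP => // h.
by rewrite nth_default // scale0r.
Qed.
Lemma poly_opC c x : poly_op c%:P A x = c *: x.
Proof.
by rewrite (@poly_op_wide _ 1) ?size_polyC_leq1 // big_ord1 coefC.
Qed.
Lemma poly_opD p q x : poly_op (p + q) A x = poly_op p A x + poly_op q A x.
Proof.
rewrite !(@poly_op_wide _ (maxn (size p) (size q))) ?leq_maxl ?leq_maxr ?size_polyD //.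
by rewrite -big_split; apply: eq_bigr => i _; rewrite coefD scalerDl.
Qed.
Lemma poly_opMX p x : poly_op (p * 'X) A x = poly_op p A (A x).
Proof.
rewrite (@poly_op_wide _ (size p).+1); last first.
  have [->|p0] := eqVneq p 0; first by rewrite mul0r size_poly0.
  by rewrite size_mulX.
rewrite big_ord_recl coefMX eqxx scale0r add0r; apply: eq_bigr => i _.
by rewrite coefMX /= -iterSr.
Qed.
Lemma poly_op_ind (P : (X -> X) -> Prop) : (P (fun=> 0)) ->
  (forall B c, P B -> P (fun x => B (A x) + c *: x)) -> forall p, P (poly_op p A).
Proof.
move=> P0 PS; elim/poly_ind => [|p c IH].
  by rewrite (_ : poly_op 0 A = fun=> 0) //; apply/funext => x; rewrite /poly_op size_poly0 big_ord0.
rewrite (_ : poly_op _ A = fun x => poly_op p A (A x) + c *: x); first exact: PS.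
by apply/funext => x; rewrite poly_opD poly_opMX poly_opC.
Qed.
Lemma bounded_poly_op p : bounded_op (poly_op p A).
Proof.
apply: poly_op_ind => [|B c hB].
  apply/bounded_opP; split=> [a x y|]; first by rewrite scaler0 addr0.
  by exists 1 => // x; rewrite nrm0 mul1r nrm_ge0.
by apply: (bounded_lincomb c (bounded_comp hB hA)); apply: bounded_id.
Qed.
Lemma poly_op_comm p x : poly_op p A (A x) = A (poly_op p A x).
Proof.
move: x; apply: (@poly_op_ind (fun B => forall x, B (A x) = A (B x))) => [x|B c hB x].
  by rewrite lin0.
by rewrite (linD lA) (linZ lA) hB.
Qed.
Lemma poly_opM p q x : poly_op (p * q) A x = poly_op p A (poly_op q A x).
Proof.
elim/poly_ind: p x => [|p c IH] x.
  by rewrite mul0r /poly_op size_poly0 !big_ord0.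
rewrite mulrDl mulrAC !poly_opD !poly_opMX IH poly_op_comm; congr (_ + _).
rewrite poly_opC mul_polyC (@poly_op_wide (c *: q) (size q)) ?size_scale_leq //.
rewrite /poly_op scaler_sumr.
by apply: eq_bigr => i _; rewrite coefZ scalerA.
Qed.
Lemma poly_op_shift p c : poly_op (p - c%:P) A = shift (poly_op p A) c.
Proof. by apply/funext => x; rewrite poly_opD -polyCN poly_opC scaleNr. Qed.
Lemma poly_opXsubC c : poly_op ('X - c%:P) A = shift A c.
Proof.
rewrite poly_op_shift; congr shift; apply/funext => x.
by rewrite -['X]mul1r poly_opMX poly_opC scale1r.
Qed.
End PolyOp.

Let hX := @closed_subspaceT R X.

Lemma Fredholm_comp A B : bounded_op A -> bounded_op B ->
  Fredholm setT A -> Fredholm setT B -> Fredholm setT (A \o B).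
Proof.
move=> hA hB /(FredholmP hX hA)[//|kA rA] /(FredholmP hX hB)[//|kB rB].
apply/FredholmP => //; first exact: bounded_comp.
split.
  apply: (fdm_ker (bounded_lin hB)).
  - by apply: subspace_ker => //; apply: lin_comp; apply: bounded_lin.
  - by apply: fdmS kA => // _ [x [_ h] <-].
  - by apply: fdmS kB => // x [[_ _] h].
apply: (fdm_trans rA); apply: fdmS (fdm_rng (bounded_lin hA) rB) => //.
by move=> _ [_ [x _ <-] <-]; exists x.
Qed.

(** N(A) lies in N(A B) by commutation, and R(A B) lies in R(A). *)
Lemma Fredholm_factor A B : bounded_op A -> bounded_op B -> (forall x, A (B x) = B (A x)) ->
  Fredholm setT (A \o B) -> Fredholm setT A.
Proof.
move=> hA hB AB /(FredholmP hX (bounded_comp hA hB))[//|k r].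
apply/FredholmP => //; split.
  by apply: fdmS k => // x [_ Ax]; split=> //=; rewrite AB Ax (lin0 (bounded_lin hB)).
by apply: fdmS r => // _ [x _ <-]; exists (B x).
Qed.

Lemma Fredholm_polynomially_Riesz T : bounded_op T ->
  finite_set (spec (Fredholm setT) T) -> polynomially_Riesz T.
Proof.
move=> hT /finite_seqP[s hs].
(* The factor X keeps p nonconstant when s is empty, so that p - m is nonzero for every m. A root of
   p - m with m nonzero is not in s, as p vanishes on s. *)
pose p : {poly R[i]} := 'X * \prod_(z <- s) ('X - z%:P).
have mp : p \is monic by rewrite monicMl ?monicX // monic_prod_XsubC.
have root_p z : z \in s -> root p z by move=> zs; rewrite rootM root_prod_XsubC zs orbT.
exists p; split; first exact: monic_neq0.
move=> m m0; rewrite -poly_op_shift //.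
set q := p - m%:P.
have sp : (1 < size p)%N.
  by rewrite /p mulrC size_mulX ?monic_neq0 ?monic_prod_XsubC // ltnS size_prod_XsubC.
have q0 : q != 0.
  have sm : (size (- m%:P) < size p)%N by rewrite size_polyN (leq_ltn_trans (size_polyC_leq1 _)).
  by rewrite -size_poly_gt0 /q size_polyDl // ltnW.
have [r qE] := closed_field_poly_normal q.
have hr z : z \in r -> Fredholm setT (shift T z).
  move=> zr; apply: contrapT => nz.
  have zs : z \in s by have : spec (Fredholm setT) T z by []; rewrite hs.
  have : root q z by rewrite qE rootZ ?lead_coef_eq0 // root_prod_XsubC.
  rewrite /root /q hornerD hornerN hornerC; have /eqP -> := root_p z zs.
  by rewrite sub0r oppr_eq0 (negPf m0).
have bc c : c != 0 -> Fredholm setT (poly_op c%:P T).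
  move=> c0; have [] // : Browder setT (poly_op c%:P T).
  apply: bij_Browder => //; first exact: bounded_poly_op.
  split=> [x _|y _]; first by rewrite poly_opC // => /eqP; rewrite scaler_eq0 (negPf c0) => /eqP.
  by exists (c^-1 *: y) => //; rewrite poly_opC // scalerA divff // scale1r.
rewrite qE -mul_polyC.
have step (u v : {poly R[i]}) : Fredholm setT (poly_op u T) -> Fredholm setT (poly_op v T) ->
    Fredholm setT (poly_op (u * v) T).
  move=> hu hv; rewrite (_ : poly_op _ T = poly_op u T \o poly_op v T).
    by apply: Fredholm_comp => //; apply: bounded_poly_op.
  by apply/funext => x; rewrite poly_opM.
apply: (step); first by apply: bc; rewrite lead_coef_eq0.
elim: r {qE} hr => [|z r IH] hr; first by rewrite big_nil; apply: bc; exact: oner_neq0.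
rewrite big_cons; apply: (step); first by rewrite poly_opXsubC //; apply: hr; rewrite inE eqxx.
by apply: IH => w wr; apply: hr; rewrite inE wr orbT.
Qed.

(** T - l is a factor of p(T) - p(l), which is Fredholm as soon as p(l) is nonzero. *)
Lemma polynomially_Riesz_Fredholm T : bounded_op T ->
  polynomially_Riesz T -> finite_set (spec (Fredholm setT) T).
Proof.
move=> hT [p [p0 hp]]; have [r pE] := closed_field_poly_normal p.
apply: (@sub_finite_set _ _ [set` r]); last exact: finite_seq.
move=> l nl /=; apply: contrapT => /negP lr; apply: nl.
have pl : p.[l] != 0.
  have : ~~ root p l by rewrite pE rootZ ?lead_coef_eq0 // root_prod_XsubC.
  by [].
have := hp _ pl; rewrite -poly_op_shift //.
have /factor_theorem[q ->] : root (p - p.[l]%:P) l.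
  by rewrite /root hornerD hornerN hornerC subrr.
rewrite mulrC (_ : poly_op _ T = shift T l \o poly_op q T); last first.
  by apply/funext => x; rewrite poly_opM // poly_opXsubC.
apply: Fredholm_factor; [exact: bounded_shift|exact: bounded_poly_op|].
by move=> x; rewrite -(poly_opXsubC T) -!poly_opM // mulrC.
Qed.

End Polynomials.

(** * Spectral projections *)
Section DyadicRoots.
Context {R : realType}.

(** For the root z nearer to 1, |z - 1|^2 + |z + 1|^2 = 4 gives |z + 1|^2 >= 2, so |z - 1| = |w - 1|
    / |z + 1| is at most |w - 1| / sqrt 2; 3/4 is a rational bound for 1 / sqrt 2. *)
Lemma near_sqrt (w : R[i]) : cn w = 1 ->
  exists z, [/\ z ^+ 2 = w, cn z = 1 & cn (z - 1) <= 3 / 4 * cn (w - 1)].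
Proof.
move=> w1.
have main z : z ^+ 2 = w -> cn (z - 1) <= cn (z + 1) ->
    [/\ z ^+ 2 = w, cn z = 1 & cn (z - 1) <= 3 / 4 * cn (w - 1)].
  move=> zw h; have z1 : cn z = 1.
    have : cn z ^+ 2 = 1 by rewrite -cnX zw.
    have := cn_ge0 z; nra.
  split=> //; have := cn_square z; rewrite z1 => sq.
  have -> : w - 1 = (z - 1) * (z + 1) by rewrite -zw; ring.
  rewrite cnM; have := cn_ge0 (z - 1); have := cn_ge0 (z + 1); nra.
have zw := sqr_sqrtc w; set z := sqrtc w in zw.
have [h|h] := leP (cn (z - 1)) (cn (z + 1)); first by exists z; apply: main.
exists (- z); apply: main; first by rewrite sqrrN.
rewrite -cnN opprD !opprK; have -> : - z + 1 = - (z - 1) by ring.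
by rewrite cnN ltW.
Qed.

Lemma dyadic_roots : exists w : nat -> R[i], forall k,
  [/\ w k ^+ (2 ^ k) = -1, cn (w k) = 1 & cn (w k - 1) <= 2 * (3 / 4) ^+ k].
Proof.
have /choice[g hg] : forall w : R[i], exists z, cn w = 1 ->
    [/\ z ^+ 2 = w, cn z = 1 & cn (z - 1) <= 3 / 4 * cn (w - 1)].
  move=> w; have [/near_sqrt[z hz]|n1] := pselect (cn w = 1); first by exists z.
  by exists 0.
exists (fun k => iter k g (-1)); elim=> [|k [IH1 IH2 IH3]].
  rewrite /= expr1 cnN cn1; split=> //; apply: le_trans (cnD _ _) _.
  by rewrite !cnN cn1 expr0; lra.
have [h1 h2 h3] := hg _ IH2; split=> //=; first by rewrite expnS exprM h1.
apply: le_trans h3 _; rewrite exprS; lra.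
Qed.
End DyadicRoots.

Section Projection.
Context {R : realType} {X : completeNormedModType R[i]}.
Implicit Types (x y z : X) (A B G : X -> X) (u v : R[i]).

Variables (B : X -> X) (L : R).
Hypotheses (hB : bounded_op B) (L0 : 0 <= L).
Hypothesis B_below : forall u x, cn u = 1 -> nrm x <= L * nrm (x - u *: B x).
Hypothesis B_onto : forall u y, cn u = 1 -> exists x, x - u *: B x = y.
Let lB : lin B := bounded_lin hB.

(** The operator 1 - (u B)^(2^k). For k = 0 and |u| = 1 the hypotheses make it invertible, with
    inverse bounded by L. *)
Let U k u x := x - u ^+ (2 ^ k) *: iter (2 ^ k) B x.

Let linU k u : lin (U k u).
Proof. by move=> a x y; rewrite /U (lin_iter _ lB); move: (u ^+ _) => c; lmod R[i]. Qed.

Let UC k u v x : U k u (U k v x) = U k v (U k u x).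
Proof.
have lI := lin_iter (2 ^ k) lB.
by rewrite /U !(linB lI) !(linZ lI); move: (u ^+ _) (v ^+ _) => c e; lmod R[i].
Qed.

Let w := projT1 (cid (@dyadic_roots R)).
Let wP k : [/\ w k ^+ (2 ^ k) = -1, cn (w k) = 1 & cn (w k - 1) <= 2 * (3 / 4) ^+ k].
Proof. exact: projT2 (cid (@dyadic_roots R)) k. Qed.

(** 1 - a^2 = (1 - a)(1 + a) for a = (u B)^(2^k); as [w k] is a 2^k-th root of -1, the second factor
    is 1 - (u w_k B)^(2^k). *)
Let US k u x : U k.+1 u x = U k u (U k (u * w k) x).
Proof.
have lI := lin_iter (2 ^ k) lB; have [wk _ _] := wP k.
rewrite /U exprMn wk expnS mul2n -addnn iterD exprD !(linB lI) !(linZ lI).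
by move: (u ^+ _) => c; lmod R[i].
Qed.

Let F u y := if pselect (cn u = 1) is left h then projT1 (cid (B_onto y h)) else 0.

Let FP u y : cn u = 1 -> F u y - u *: B (F u y) = y.
Proof. by rewrite /F; case: pselect => // h _; case: cid. Qed.

(* [PP k u] is the inverse of 1 - (u B)^(2^k), an average of resolvents of [B] over
   the (2^k)-th roots of unity, i.e. a Riemann sum for the Riesz projection. *)
Fixpoint PP k u x : X :=
  if k is k'.+1 then 2^-1 *: (PP k' u x + PP k' (u * w k') x) else F u x.

Let u1 k u : cn u = 1 -> cn (u * w k) = 1.
Proof. by have [_ h _] := wP k; rewrite cnM h mulr1. Qed.

(** Partial fractions: 2 / (1 - a^2) = 1 / (1 - a) + 1 / (1 + a). *)
Let U_PP k u x : cn u = 1 -> U k u (PP k u x) = x.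
Proof.
elim: k u x => [|k IH] u x hu; first by rewrite /U /= !expr1 FP.
have lU := @linU k.+1 u.
rewrite /= (linZ lU) (linD lU) !US (UC k u (u * w k) (PP k u x)).
rewrite (IH _ _ (u1 k hu)) (IH _ _ hu).
have [wk _ _] := wP k.
by rewrite /U exprMn wk; move: (u ^+ _) => c; lmod R[i]; field.
Qed.

Let PP_U k u x : cn u = 1 -> PP k u (U k u x) = x.
Proof.
elim: k u x => [|k IH] u x hu.
  have lU := @linU 0%N u.
  apply/eqP; rewrite -subr_eq0 -nrm_eq0 eq_le nrm_ge0 andbT.
  apply: le_trans (B_below _ hu) _; rewrite le_eqVlt; apply/orP; left; apply/eqP.
  have -> : PP 0 u (U 0 u x) - x - u *: B (PP 0 u (U 0 u x) - x) = U 0 u (PP 0 u (U 0 u x) - x).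
    by rewrite /U !expr1.
  by rewrite (linB lU) U_PP // subrr nrm0 mulr0.
rewrite /= US {1}(IH _ _ hu) -(UC k (u * w k) u) (IH _ _ (u1 k hu)).
have [wk _ _] := wP k.
by rewrite /U exprMn wk; move: (u ^+ _) => c; lmod R[i]; field.
Qed.

Let linPP k u : cn u = 1 -> lin (PP k u).
Proof.
move=> hu a x y; rewrite -{1}(U_PP k x hu) -{1}(U_PP k y hu) -(linU k u).
exact: PP_U.
Qed.

Let PP_comm G k u x : lin G -> (forall x, G (B x) = B (G x)) -> cn u = 1 ->
  PP k u (G x) = G (PP k u x).
Proof.
move=> lG GB hu; rewrite -{1}(U_PP k x hu).
have GI n z : G (iter n B z) = iter n B (G z) by elim: n => //= n <-.
have -> : G (U k u (PP k u x)) = U k u (G (PP k u x)).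
  by rewrite /U (linB lG) (linZ lG) GI.
exact: PP_U.
Qed.

Let CB : R := projT1 (cid2 ((bounded_opP B).1 hB).2).
Let CB0 : 0 < CB. Proof. by rewrite /CB; case: cid2. Qed.
Let CBP x : nrm (B x) <= CB * nrm x. Proof. by rewrite /CB; case: cid2. Qed.

Let PP_bound k u x : cn u = 1 -> nrm (PP k u x) <= L * nrm x.
Proof.
elim: k u => [|k IH] u hu; first by apply: le_trans (B_below _ hu) _; rewrite FP.
rewrite /= nrmZ cnV; have -> : cn 2 = 2 :> R by rewrite -[2]/(2%:R) -(rmorph_nat (real_complex R)) cnR ger0_norm.
rewrite ler_pdivrMl //; apply: le_trans (nrmD _ _) _.
have := IH _ hu; have := IH _ (u1 k hu); lra.
Qed.

(** For k = 0 this is the resolvent identity F_u - F_v = (u - v) F_u B F_v. Averaging preserves the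
    constant, because multiplication by the unimodular [w k] does not change |u - v|. *)
Let PP_lip k u v x : cn u = 1 -> cn v = 1 ->
  nrm (PP k u x - PP k v x) <= L * CB * L * cn (u - v) * nrm x.
Proof.
elim: k u v => [|k IH] u v hu hv /=.
  apply: le_trans (B_below _ hu) _.
  have -> : F u x - F v x - u *: B (F u x - F v x) = (u - v) *: B (F v x).
    have := FP x hv; have := FP x hu; rewrite (linB lB); move: (F u x) (F v x) => a b ha hb.
    transitivity ((a - u *: B a) - (b - u *: B b)); first by lmod R[i].
    by rewrite ha -hb; lmod R[i].
  rewrite nrmZ; have := PP_bound 0 x hv; rewrite /= => b.
  have := le_trans (CBP (F v x)) (ler_wpM2l (ltW CB0) b) => b'.
  have := ler_wpM2l (cn_ge0 (u - v)) b' => b''.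
  apply: le_trans (ler_wpM2l L0 b'') _; rewrite le_eqVlt; apply/orP; left; apply/eqP; ring.
have -> : 2^-1 *: (PP k u x + PP k (u * w k) x) - 2^-1 *: (PP k v x + PP k (v * w k) x) =
   2^-1 *: ((PP k u x - PP k v x) + (PP k (u * w k) x - PP k (v * w k) x)) by lmod R[i].
rewrite nrmZ cnV; have -> : cn 2 = 2 :> R by rewrite -[2]/(2%:R) -(rmorph_nat (real_complex R)) cnR ger0_norm.
rewrite ler_pdivrMl //; apply: le_trans (nrmD _ _) _.
have := IH _ _ (u1 k hu) (u1 k hv); have := IH _ _ hu hv.
rewrite -mulrBl cnM; have [_ -> _] := wP k; rewrite mulr1; lra.
Qed.

(** Consecutive means differ by half of [PP k (w k)] - [PP k 1], and |w_k - 1| <= 2 (3/4)^k, so the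
    Lipschitz bound gives geometric convergence in operator norm. The last clause records the
    approximants (1 - B^n)^-1, through which P is studied afterwards. *)
Lemma Riesz_projection : exists P, [/\ bounded_op P, forall x, P (P x) = P x,
  (forall G, bounded_op G -> (forall x, G (B x) = B (G x)) -> forall x, P (G x) = G (P x)) &
  forall e : R, 0 < e -> exists n Pn, [/\ (0 < n)%N, bounded_op Pn,
    (forall x, Pn (x - iter n B x) = x /\ Pn x - iter n B (Pn x) = x),
    (forall G, lin G -> (forall x, G (B x) = B (G x)) -> forall x, Pn (G x) = G (Pn x)) &
    forall x, nrm (P x - Pn x) <= e * nrm x]].
Proof.
have c1 := @cn1 R; pose p k := PP k 1.
pose C := L * CB * L; have C0 : 0 <= C by rewrite !mulr_ge0 // ltW.
have h34 : (0 : R) <= 3 / 4 /\ (3 / 4 : R) < 1 by split; lra.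
have c2 : cn 2 = 2 :> R by rewrite -[2]/(2%:R) -(rmorph_nat (real_complex R)) cnR ger0_norm.
have step x k : nrm (p k.+1 x - p k x) <= C * nrm x * (3 / 4) ^+ k.
  have -> : p k.+1 x - p k x = 2^-1 *: (PP k (w k) x - PP k 1 x).
    by rewrite /p /= mul1r; lmod R[i]; field.
  have [_ wk1 wk2] := wP k.
  rewrite nrmZ cnV c2 ler_pdivrMl //; apply: le_trans (PP_lip k x wk1 c1) _.
  rewrite -/C; have := ler_wpM2l (mulr_ge0 C0 (nrm_ge0 x)) wk2; lra.
have /choice[P hP] : forall x, exists l, forall k, nrm (l - p k x) <= C * nrm x * (3 / 4) ^+ k / (1 - 3 / 4).
  by move=> x; apply: (cvg_geometric h34.1 h34.2 (mulr_ge0 C0 (nrm_ge0 x)) (step x)).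
pose c k : R := 4 * C * (3 / 4) ^+ k.
have {}hP x k : nrm (P x - p k x) <= c k * nrm x.
  apply: le_trans (hP x k) _; rewrite /c le_eqVlt; apply/orP; left; apply/eqP; by field.
have ck0 k : 0 <= c k by rewrite /c mulr_ge0 ?exprn_ge0 ?h34.1 // mulr_ge0.
have cS k : c k.+1 <= c k.
  by rewrite /c exprS; have : 0 <= (3 / 4 : R) ^+ k; [rewrite exprn_ge0 ?h34.1|nra].
have c_small e : 0 < e -> exists2 k, c k < e & 0 <= c k.
  move=> e0; have e1 : 0 < e / (4 * C + 1) by rewrite divr_gt0 //; lra.
  have [k hk] := expr_small h34.1 h34.2 e1; exists k => //.
  move: hk; rewrite ltr_pdivlMr; last lra.
  have : 0 <= (3 / 4 : R) ^+ k by rewrite exprn_ge0 ?h34.1.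
  rewrite /c; nra.
clearbody c.
have lp k : lin (p k) := @linPP k 1 c1.
have bp k x : nrm (p k x) <= L * nrm x := PP_bound k x c1.
have zero (z : X) K : 0 <= K -> (forall k, nrm z <= c k * K) -> z = 0.
  move=> K0 h; apply: nrm_small => e e0.
  have [|k hk ck] := c_small (e / (K + 1)); first by rewrite divr_gt0 //; lra.
  apply: le_lt_trans (h k) _; move: hk; rewrite ltr_pdivlMr; last lra.
  nra.
have lP : lin P.
  move=> a x y; apply/eqP; rewrite -subr_eq0; apply/eqP.
  apply: (zero _ (nrm (a *: x + y) + cn a * nrm x + nrm y)).
    by rewrite !addr_ge0 ?mulr_ge0 ?nrm_ge0 ?cn_ge0.
  move=> k; have -> : P (a *: x + y) - (a *: P x + P y) =
     (P (a *: x + y) - p k (a *: x + y)) - (a *: (P x - p k x) + (P y - p k y)).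
    by rewrite (lp k); lmod R[i].
  apply: le_trans (nrmB _ _) _; apply: le_trans (lerD (hP _ _) (nrmD _ _)) _.
  rewrite nrmZ; have := ler_wpM2l (cn_ge0 a) (hP x k); have := hP y k; lra.
have [K K0 bP] : exists2 K : R, 0 <= K & forall x, nrm (P x) <= K * nrm x.
  exists (c 0%N + L); first by rewrite addr_ge0.
  move=> x; rewrite -[P x](subrK (p 0%N x)); apply: le_trans (nrmD _ _) _.
  by rewrite mulrDl lerD.
exists P; split.
- apply/bounded_opP; split=> //; exists (K + 1); first by rewrite ltr_wpDl.
  by move=> x; apply: le_trans (bP x) _; have := nrm_ge0 x; nra.
- move=> x.
  (* With b = B^(2^k): p_k = 1 / (1 - b), 2 p_k - 1 = (1 + b) / (1 - b) and p_{k+1} = 1 / (1 - b^2),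
     so both sides are 1 / (1 - b)^2. In the limit P (2 P - 1) = P^2, that is P^2 = P. *)
  have key k : p k.+1 (2 *: p k x - x) = p k (p k x).
    rewrite -[RHS](PP_U k.+1 _ c1); congr (PP _ _ _).
    have [wk _ _] := wP k.
    rewrite US UC (U_PP k (p k x) c1) mul1r.
    have : U k 1 (p k x) = x := U_PP k x c1.
    move: (p k x) => a <-; rewrite /U wk expr1n; lmod R[i].
  have : P (2 *: P x - x) - P (P x) = 0.
    (* K comes from applying P to the error at x, 2 L + 1 from the size of 2 p_k x - x, and L from
       that of p_k x. *)
    apply: (zero _ ((K + 3 * L + 1) * nrm x)).
      by rewrite !(addr_ge0, mulr_ge0) ?nrm_ge0.
    move=> k; have -> : P (2 *: P x - x) - P (P x) = P (P x - p k x) +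
        (P (2 *: p k x - x) - p k.+1 (2 *: p k x - x)) - (P (p k x) - p k (p k x)).
      by rewrite key !(linB lP) !(linZ lP); lmod R[i].
    have nx := nrm_ge0 x; have ck := ck0 k.
    have ckS := cS k.
    have h1 : nrm (P (P x - p k x)) <= K * (c k * nrm x).
      by apply: le_trans (bP _) _; rewrite ler_wpM2l ?hP.
    have h2 : nrm (2 *: p k x - x) <= (2 * L + 1) * nrm x.
      apply: le_trans (nrmB _ _) _; rewrite nrmZ c2; have := bp k x; lra.
    have h3 := hP (2 *: p k x - x) k.+1; have h4 := hP (p k x) k.
    have h5 := ler_wpM2l ck (bp k x).
    have h6 := le_trans h3 (ler_pM (ck0 _) (nrm_ge0 _) ckS h2).
    apply: le_trans (nrmB _ _) _; apply: le_trans (lerD (nrmD _ _) (lexx _)) _; lra.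
  rewrite (linB lP) (linZ lP) => E; apply/eqP; rewrite -subr_eq0; apply/eqP.
  by rewrite -E; lmod R[i].
- move=> G hG GB x; apply/eqP; rewrite -subr_eq0; apply/eqP.
  have [lG [KG KG0 hG']] := (bounded_opP G).1 hG.
  apply: (zero _ (nrm (G x) + KG * nrm x)).
    by rewrite addr_ge0 ?mulr_ge0 ?nrm_ge0 // ltW.
  move=> k; have -> : P (G x) - G (P x) = (P (G x) - p k (G x)) - G (P x - p k x).
    by rewrite (linB lG) -(PP_comm k x lG GB c1) -/(p k); lmod R[i].
  apply: le_trans (nrmB _ _) _; apply: le_trans (lerD (hP _ _) (hG' _)) _.
  have := ler_wpM2l (ltW KG0) (hP x k); lra.
move=> e e0; have [k hk ck] := c_small e e0.
exists (2 ^ k)%N, (p k); split.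
- by rewrite expn_gt0.
- apply/bounded_opP; split; first exact: lp.
  exists (L + 1); first by rewrite ltr_wpDl.
  by move=> x; apply: le_trans (bp k x) _; have := nrm_ge0 x; nra.
- move=> x; have := PP_U k x c1; have := U_PP k x c1; rewrite /U expr1n !scale1r.
  by move=> h1 h2.
- by move=> G lG GB x; apply: PP_comm.
- by move=> x; apply: le_trans (hP x k) _; apply: ler_wpM2r; rewrite ?nrm_ge0 // ltW.
Qed.

End Projection.

(** * The operator on the kernel and on the range of the projection *)

Section ProjectionSplit.
Context {R : realType} {X : completeNormedModType R[i]}.
Implicit Types (x y z : X) (M N D : set X) (A B G P S T : X -> X) (l m u : R[i]).

(* The telescoping factor (B^n - m^n) / (B - m). *)
Lemma geometric_factor B n m : bounded_op B -> exists G, [/\ bounded_op G,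
  forall P, lin P -> (forall x, P (B x) = B (P x)) -> forall x, P (G x) = G (P x) &
  forall x, iter n B x - m ^+ n *: x = shift B m (G x)].
Proof.
move=> hB; have lB := bounded_lin hB.
elim: n => [|n [G [hG GC hE]]].
  exists (fun=> 0); split=> [|P lP _ x|x]; last 2 first.
  - exact: lin0.
  - by rewrite scale1r subrr /shift (lin0 lB) scaler0 subrr.
  apply/bounded_opP; split=> [a x y|]; first by rewrite scaler0 addr0.
  by exists 1 => // x; rewrite nrm0 mul1r nrm_ge0.
exists (fun x => iter n B x + m *: G x); split.
- by apply: bounded_lincomb => //; apply: bounded_iter.
- move=> P lP PB x; rewrite (linD lP) (linZ lP) (GC P lP PB); congr (_ + _).
  by elim: n {G hG GC hE} => //= n <-.
move=> x; rewrite (linD (lin_shift m lB)) (linZ (lin_shift m lB)) -hE iterS exprS /shift.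
by move: (m ^+ n) => c; lmod R[i].
Qed.

Section Split.
Variables (B P : X -> X).
Hypotheses (hB : bounded_op B) (hP : bounded_op P) (PP : forall x, P (P x) = P x).
Hypothesis PB : forall x, P (B x) = B (P x).
Hypothesis P_lim : forall e : R, 0 < e -> exists n Pn, [/\ (0 < n)%N, bounded_op Pn,
    (forall x, Pn (x - iter n B x) = x /\ Pn x - iter n B (Pn x) = x),
    (forall G, lin G -> (forall x, G (B x) = B (G x)) -> forall x, Pn (G x) = G (Pn x)) &
    forall x, nrm (P x - Pn x) <= e * nrm x].
Let lB := bounded_lin hB.
Let lP := bounded_lin hP.

Let closed_fix : closed_subspace [set x | P x = x].
Proof.
rewrite (_ : [set x | _] = kerM setT (shift P 1)).
  by apply: closed_ker; [apply: bounded_shift|apply: closed_subspaceT].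
apply/seteqP; split=> x /=; rewrite /kerM /shift /= scale1r; first by move=> ->; rewrite subrr.
by move=> [_ /eqP]; rewrite subr_eq0 => /eqP.
Qed.

(** On N(P), Pn = (1 - B^n)^-1 is small. If B x = 0 then Pn x = x, so x = 0; and - B^(n-1) Pn y
    solves B x = y up to Pn y, of norm at most |y| / 2. *)
Lemma bij_ker_projection : bij_on (kerM setT P) B.
Proof.
split=> [x [_ Px] Bx|y Ny].
  have [|n [Pn [n0 _ PnE _ Pnl]]] := P_lim (e := 2^-1); first by rewrite invr_gt0.
  have Pnx : Pn x = x.
    rewrite -{2}(PnE x).1; congr Pn; case: n n0 {Pnl PnE} => // n _.
    by rewrite iterSr Bx (lin0 (lin_iter n lB)) subr0.
  have := Pnl x; rewrite Px Pnx sub0r nrmN => h.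
  apply/eqP; rewrite -nrm_eq0 eq_le nrm_ge0 andbT; lra.
have hN := closed_ker hP (@closed_subspaceT R X).
have [|n [Pn [n0 hPn PnE PnC Pnl]]] := P_lim (e := 2^-1); first by rewrite invr_gt0.
have [K [K0 hK]] : exists C : R, 0 < C /\ forall x, nrm (iter n.-1 B (Pn x)) <= C * nrm x.
  by have [_ [C C0 hC]] := (bounded_opP _).1 (bounded_comp (bounded_iter n.-1 hB) hPn); exists C.
have [|x [f [Nx -> -> _ _]]] := @approx_surj R X _ [set 0] B (kerM setT P) K hN
  closed_subspace0 hB (ltW K0) _ y Ny; last by exists x; rewrite ?addr0.
move=> {y Ny} y [_ Py]; exists (- iter n.-1 B (Pn y)), 0.
have E : y - (B (- iter n.-1 B (Pn y)) + 0) = Pn y.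
  rewrite (linN lB) -iterS prednK //; have /eqP := (PnE y).2; rewrite subr_eq => /eqP Ey.
  by rewrite addr0 opprK; exact/esym.
have PPn x : P (Pn x) = Pn (P x) by rewrite (PnC P lP).
have PI k x : P (iter k B x) = iter k B (P x) by elim: k => //= k <-.
have lPn := bounded_lin hPn.
rewrite E nrmN nrm0; split=> //.
- by split=> //; rewrite (linN lP) PI PPn Py (lin0 lPn) (lin0 (lin_iter _ lB)) oppr0.
- by rewrite mulr_ge0 ?nrm_ge0 // ltW.
split; last by split=> //; rewrite PPn Py (lin0 lPn).
by have := Pnl y; rewrite Py sub0r nrmN; lra.
Qed.

(** On R(P), Pn is close to 1. If B x = m x then x - Pn x = - m^n Pn x, so Pn x is small as well as
    x - Pn x. For surjectivity, - m^-n G Pn y leaves the residual (1 - m^-n)(y - Pn y), of norm at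
    most 2 (1/4) |y|. *)
Lemma bij_fix_projection m : 1 <= cn m -> bij_on [set x | P x = x] (shift B m).
Proof.
move=> m1; have mn1 n : 1 <= cn (m ^+ n) by rewrite cnX exprn_ege1.
have m0 : m != 0 by rewrite -cn_gt0; lra.
split=> [x /= Px /eqP|y Ey].
  rewrite subr_eq0 => /eqP Bx.
  have [|n [Pn [n0 hPn PnE _ Pnl]]] := P_lim (e := 4^-1); first by rewrite invr_gt0.
  have pw k : iter k B x = m ^+ k *: x.
    by elim: k => [|k IH]; [rewrite scale1r|rewrite iterSr Bx (linZ (lin_iter k lB)) IH scalerA -exprS].
  have := (PnE x).1; rewrite pw (linB (bounded_lin hPn)) (linZ (bounded_lin hPn)) => E.
  have := Pnl x; rewrite Px => h.
  have h2 : nrm (x - Pn x) = cn (m ^+ n) * nrm (Pn x).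
    by rewrite -nrmZ -nrmN -{1}E; congr nrm; lmod R[i].
  have h3 := nrm_tri x (Pn x) 0; rewrite !subr0 in h3.
  have h4 := mn1 n; have h5 := nrm_ge0 (Pn x); have h6 := nrm_ge0 x.
  apply/eqP; rewrite -nrm_eq0 eq_le h6 andbT; nra.
have [|n [Pn [n0 hPn PnE PnC Pnl]]] := P_lim (e := 4^-1); first by rewrite invr_gt0.
have [G [hG GC hGE]] := geometric_factor n m hB.
have [K [K0 hK]] : exists C : R, 0 < C /\ forall x, nrm (G (Pn x)) <= C * nrm x.
  by have [_ [C C0 hC]] := (bounded_opP _).1 (bounded_comp hG hPn); exists C.
have cV : cn (m ^- n) <= 1 by rewrite cnV invf_le1 // (lt_le_trans ltr01).
have [|x [f [Nx -> -> _ _]]] := @approx_surj R X _ [set 0] (shift B m) _ K closed_fix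
  closed_subspace0 (bounded_shift m hB) (ltW K0) _ y Ey; last by exists x; rewrite ?addr0.
move=> {y Ey} y Py; exists (- (m ^- n *: G (Pn y))), 0.
have lS := lin_shift m lB.
have E : y - (shift B m (- (m ^- n *: G (Pn y))) + 0) = (y - Pn y) - m ^- n *: (y - Pn y).
  rewrite (linN lS) (linZ lS) -hGE.
  have : m ^+ n != 0 by rewrite expf_neq0.
  move: (PnE y).2; move: (m ^+ n) (iter n B (Pn y)) (Pn y) => c a b <- c0.
  by lmod R[i]; field.
have PPn x : P (Pn x) = Pn (P x) by rewrite (PnC P lP).
have yb : nrm (y - Pn y) <= 4^-1 * nrm y by rewrite -{1}Py.
rewrite E nrmN nrmZ nrm0; split=> //.
- by rewrite /= (linN lP) (linZ lP) (GC P lP PB) PPn Py.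
- apply: le_trans (hK y); have := nrm_ge0 (G (Pn y)); nra.
- by rewrite mulr_ge0 ?nrm_ge0 // ltW.
split; last by rewrite /= !(linB lP, linZ lP) PPn Py.
apply: le_trans (nrmB _ _) _; rewrite nrmZ; have := nrm_ge0 (y - Pn y); nra.
Qed.
End Split.
End ProjectionSplit.

(** * Generalized Drazin-Riesz inverses and isolating circles *)

Section DrazinRiesz.
Context {R : realType} {X : completeNormedModType R[i]}.
Implicit Types (x y z : X) (M N D : set X) (A B G P S T : X -> X) (l m u : R[i]).
Let hX := @closed_subspaceT R X.

(** A S is idempotent. On its range M, A is invertible with inverse S; on its kernel N, the Riesz
    operator A S A - A is - A. *)
Lemma gDrazin_Riesz_gKato A : bounded_op A -> gDrazin_Riesz_invertible A -> gKato_Riesz A.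
Proof.
move=> hA [S [hS [ASE [SASE rG]]]].
have AS x : A (S x) = S (A x) := congr1 (@^~ x) ASE.
have SAS x : S (A (S x)) = S x := congr1 (@^~ x) SASE.
have lA := bounded_lin hA; have lS := bounded_lin hS.
have hAS := bounded_comp hA hS; have lAS := bounded_lin hAS.
pose M := [set x | A (S x) = x]; pose N := kerM setT (A \o S).
have hM : closed_subspace M.
  rewrite (_ : M = kerM setT (shift (A \o S) 1)).
    by apply: closed_ker => //; apply: bounded_shift.
  apply/seteqP; split=> x; rewrite /M /kerM /shift /= scale1r; first by move=> ->; rewrite subrr.
  by move=> [_ /eqP]; rewrite subr_eq0 => /eqP.
have hN : closed_subspace N by apply: closed_ker.
have iM : invariant A M by move=> x Mx; rewrite /M /= -AS Mx.
have iN : invariant A N by move=> x [_ /= Nx]; split=> //=; rewrite -AS Nx lin0.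
have bM : bij_on M A.
  split=> [x Mx Ax|y My]; first by rewrite -Mx AS Ax lin0.
  by exists (S y) => //; rewrite /M /= AS SAS.
have QN x : N (x - A (S x)).
  by split=> //=; rewrite (linB lS) SAS subrr lin0.
exists M, N; do 4 (split; first by []); split; last split.
- split; apply/seteqP; split=> // x.
    by move=> _; exists (A (S x)), (x - A (S x)); split; [rewrite /M /= SAS|split=> //; rewrite addrC subrK].
  by move=> [Mx [_ /= Nx]]; rewrite /= -Mx.
  by move=> ->; split; apply: subsp0; [exact: hM.1|exact: hN.1].
- exact: bij_Kato.
move=> l l0; apply/FredholmP => //; [exact: bounded_shift|exact: invariant_shift hN.1 iN|].
set G := fun x => A (S (A x)) - A x in rG.
have hG : bounded_op G.
  have := bounded_lincomb (-1) (bounded_comp hAS hA) hA.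
  by congr bounded_op; apply/funext => x; rewrite /G scaleN1r.
have GN x : N x -> shift G (- l) x = - shift A l x.
  by move=> [_ /= Nx]; rewrite /shift /G -AS Nx (lin0 lA); lmod R[i].
have hGl := bounded_shift (- l) hG.
have nl0 : - l != 0 by rewrite oppr_eq0.
have [k r] := (FredholmP hX hGl (@invariantT R X _)).1 (rG (- l) nl0).
split.
  by apply: fdmS k => // x [Nx Ax]; split=> //; rewrite GN // Ax oppr0.
(* Q = 1 - A S projects onto N and commutes with G + l, which is - (A - l) on N; applying Q carries
   finite codimension from X to N. *)
pose Q x := x - A (S x).
have lQ : lin Q by move=> a x y; rewrite /Q lS lA; lmod R[i].
apply: fdmS (fdm_rng lQ r).
  by move=> x [_ /= Nx]; exists x => //; rewrite /Q Nx subr0.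
move=> _ [_ [x _ <-] <-]; exists (- Q x); first by apply: subspN hN.1 _ _; apply: QN.
have lAl := lin_shift l lA.
rewrite (linN lAl) -GN; last exact: QN.
rewrite /Q /shift /G !(linB lA) !(linB lS) !(linB lA) !(linZ lS) !(linZ lA).
have ASS y : A (S (S y)) = S y by rewrite AS SAS.
rewrite -!AS !ASS; lmod R[i].
Qed.

Lemma avoid_finite (s : seq R) (a b : R) : a < b -> exists2 r, a <= r <= b & r \notin s.
Proof.
elim: s a b => [|v s IH] a b ab; first by exists a => //; rewrite lexx ltW.
have [va|va] := leP v ((a + b) / 2).
  have [|r /andP[r1 r2] rs] := IH ((a + 3 * b) / 4) b; first lra.
  exists r; first by apply/andP; split; lra.
  by rewrite inE negb_or rs andbT; apply/eqP => rv; lra.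
have [|r /andP[r1 r2] rs] := IH a ((3 * a + b) / 4); first lra.
exists r; first by apply/andP; split; lra.
by rewrite inE negb_or rs andbT; apply/eqP => rv; lra.
Qed.

Section Circle.
Variables (T : X -> X) (l : R[i]).
Hypothesis hT : bounded_op T.
Let iT := @invariantT R X T.

(** Browder points on the circle are not enough, since 1 - u B must be invertible there. Around each
    point of the annulus a / 2 <= |m - l| <= a, non-invertible points are isolated; by compactness
    they are finitely many, and some radius avoids them. *)
Lemma free_circle : finite_set (spec (Browder setT) T) -> exists r : R, [/\ 0 < r,
  forall m, m != l -> cn (m - l) <= r -> Browder setT (shift T m) &
  forall m, cn (m - l) = r -> bij_on setT (shift T m)].
Proof.
move=> /finite_seqP[s hs].
have [a a0 ha] : exists2 a : R, 0 < a & forall f, f \in s -> f != l -> a < cn (f - l).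
  elim: s {hs} => [|f s [a a0 ha]]; first by exists 1.
  have [fl|fl] := eqVneq f l.
    by exists a => // g; rewrite inE => /orP[/eqP-> /eqP//|]; apply: ha.
  have fl0 : 0 < cn (f - l) by rewrite cn_gt0 subr_eq0.
  exists (Num.min a (cn (f - l) / 2)); first by rewrite lt_min a0 divr_gt0.
  move=> g; rewrite inE gt_min => /orP[/eqP-> _|gs gl]; last by rewrite ha.
  by apply/orP; right; lra.
have aB m : m != l -> cn (m - l) <= a -> Browder setT (shift T m).
  move=> ml hm; apply: contrapT => nB.
  have : spec (Browder setT) T m by [].
  by rewrite hs => /ha /(_ ml); rewrite ltNge hm.
clear hs; pose bad := [set m | a / 2 <= cn (m - l) <= a /\ ~ bij_on setT (shift T m)].
have : finite_set bad.
  have := @plane_cover R (fun S : set R[i] => finite_set (S `&` bad)) _ _ _ (cn l + a).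
  rewrite (_ : _ `&` bad = bad); last first.
    apply/setIidr => m [/andP[_ h] _] /=; have := cn_tri m l 0; rewrite !subr0; lra.
  apply.
  - by move=> A B AB; apply: sub_finite_set => m [/AB].
  - by move=> A B fA fB; rewrite setIUl finite_setU.
  move=> m.
  have bads (r : R) : (forall k, k != m -> cn (k - m) < r -> ~ bad k) ->
      finite_set ([set k | cn (k - m) < r] `&` bad).
    move=> h; apply: (sub_finite_set _ (finite_set1 m)) => k [/= hk bk].
    by apply: contrapT => /eqP km; apply: (h k).
  have [ml|ml] := eqVneq m l.
    exists (a / 2); first by rewrite divr_gt0.
    by apply: bads => k _ hk [/andP[h _] _]; rewrite ml in hk; lra.
  have [ma|ma] := leP (cn (m - l)) a.
    have [r r0 hr] := Browder_punctured hX hT iT (aB m ml ma).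
    by exists r => //; apply: bads => k km hk [_]; apply; apply: hr.
  exists (cn (m - l) - a); first lra.
  apply: bads => k _ hk [/andP[_ h] _]; have := cn_tri m k l; rewrite cnBC in hk; lra.
move=> /finite_seqP[b hb].
have [|r /andP[r1 r2] rb] := @avoid_finite [seq cn (m - l) | m <- b] (a / 2) a; first lra.
exists r; split=> [||m mr]; first lra.
  by move=> m ml hm; apply: aB => //; lra.
apply: contrapT => nb; move/negP: rb; apply; apply/mapP; exists m => //.
have : bad m by split=> //; rewrite mr r1 r2.
by rewrite hb.
Qed.

(** The resolvent bound at one point of the circle holds nearby with twice the constant; bounds over
    two sets are merged by adding the constants. *)
Lemma circle_bound (r : R) : (forall m, cn (m - l) = r -> bij_on setT (shift T m)) ->
  exists2 L : R, 0 <= L & forall m x, cn (m - l) = r -> nrm x <= L * nrm (shift T m x).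
Proof.
move=> hr; pose Q (S : set R[i]) := exists2 L : R, 0 <= L &
  forall m, S m -> forall x, cn (m - l) = r -> nrm x <= L * nrm (shift T m x).
have [||m|L L0 hL] := @plane_cover R Q _ _ _ (cn l + r).
- by move=> A B AB [L L0 hL]; exists L => // m /AB; apply: hL.
- move=> A B [L L0 hL] [L' L0' hL']; exists (L + L'); first by rewrite addr_ge0.
  move=> m Sm x mr; rewrite mulrDl; have h := nrm_ge0 (shift T m x).
  case: Sm => Sm; [have := hL m Sm x mr|have := hL' m Sm x mr];
    have := mulr_ge0 L0 h; have := mulr_ge0 L0' h; lra.
- have [mr|mr] := eqVneq (cn (m - l)) r; last first.
    exists (`|cn (m - l) - r|); first by rewrite normr_gt0 subr_eq0.
    exists 0 => // k /= hk x kr; exfalso; move: hk; rewrite -kr ltNge => /negP; apply.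
    have h1 := cn_tri m k l; have h2 := cn_tri k m l; rewrite (cnBC m k) in h1.
    by rewrite ler_norml; lra.
  have [C C0 hC] := bij_open hX (bounded_shift m hT) (@invariantT R X _) (hr m mr).
  exists (2 * C)^-1; first by rewrite invr_gt0 mulr_gt0.
  exists (2 * C) => [|k /= hk x kr]; first by rewrite mulr_ge0 // ltW.
  have kC : cn (k - m) * C < 2^-1 by move: hk; rewrite invfM ltr_pdivlMr.
  have := hC x I; have -> : shift T m x = shift T k x + (k - m) *: x by rewrite /shift; lmod R[i].
  have := nrmD (shift T k x) ((k - m) *: x); rewrite nrmZ.
  have := nrm_ge0 x; have := nrm_ge0 (shift T k x); nra.
exists L => // m x mr; apply: hL => //=.
by have := cn_tri m l 0; rewrite !subr0; lra.
Qed.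

Lemma spectral_projection : finite_set (spec (Browder setT) T) -> exists P,
  [/\ bounded_op P, forall x, P (P x) = P x, forall x, P (T x) = T (P x),
    bij_on (kerM setT P) (shift T l) &
    forall m, m != l -> Browder setT (shift T m) \/ bij_on [set x | P x = x] (shift T m)].
Proof.
move=> /free_circle[r [r0 rB rb]].
have [L L0 hL] := circle_bound rb.
pose c : R[i] := r%:C%C; have cr : cn c = r by rewrite cnR gtr0_norm.
have c0 : c != 0 by rewrite -cn_gt0 cr.
pose A := shift T l; have hA : bounded_op A by apply: bounded_shift.
have lA := bounded_lin hA; have lT := bounded_lin hT.
pose B x := c^-1 *: A x.
have hB : bounded_op B.
  have := bounded_lincomb (c^-1 - 1) hA hA; congr bounded_op; apply/funext => x.
  by rewrite /B; lmod R[i].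
have lB := bounded_lin hB.
(* As u runs over the unit circle, l + c / u runs over the circle of radius r about l, so 1 - u B
   inherits invertibility and the bound L r. *)
have BE u x : u != 0 -> x - u *: B x = - (u / c) *: shift T (l + c / u) x.
  by move=> u0; rewrite /B /A /shift; lmod R[i]; field; rewrite ?c0 ?u0.
have on_circle u : cn u = 1 -> u != 0 /\ cn (l + c / u - l) = r.
  move=> u1; split; first by rewrite -cn_gt0 u1.
  by rewrite addrC addKr cnM cnV u1 invr1 mulr1.
have below u x : cn u = 1 -> nrm x <= (L * r) * nrm (x - u *: B x).
  move=> u1; have [u0 h] := on_circle u u1; apply: le_trans (hL _ x h) _.
  rewrite BE // nrmZ cnN cnM u1 mul1r cnV cr -mulrA; apply: ler_wpM2l => //.
  by rewrite mulrA divff ?mul1r // gt_eqF.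
have onto u y : cn u = 1 -> exists x, x - u *: B x = y.
  move=> u1; have [u0 h] := on_circle u u1.
  have [_ /(_ (- (c / u) *: y) I)[x _ E]] := rb _ h.
  by exists x; rewrite BE // E; lmod R[i]; field; rewrite ?c0 ?u0.
have [P [hP PP PC Pl]] := Riesz_projection hB (mulr_ge0 L0 (ltW r0)) below onto.
have lP := bounded_lin hP.
have PB x : P (B x) = B (P x) by apply: PC.
have PA x : P (A x) = A (P x) by apply: PC => // z; rewrite /B (linZ lA).
have PT x : P (T x) = T (P x).
  have := PA x; rewrite /A /shift (linB lP) (linZ lP) => /eqP.
  by rewrite (can_eq (subrK _)) => /eqP.
exists P; split=> //.
  have [injB surjB] := bij_ker_projection hB hP PB Pl.
  split=> [x Nx Ax|y Ny]; first by apply: injB => //; rewrite /B /A Ax scaler0.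
  have [|x Nx E] := surjB (c^-1 *: y); first by apply: subspZ => //; apply: subspace_ker.
  by exists x => //; apply: (scalerI (invr_neq0 c0)).
move=> m ml; have [h|h] := leP (cn (m - l)) r; [left; exact: rB|right].
have [|injB surjB] := @bij_fix_projection R X B P hB hP PB Pl ((m - l) / c).
  by rewrite cnM cnV cr ler_pdivlMr // mul1r ltW.
have SE x : shift B ((m - l) / c) x = c^-1 *: shift T m x.
  by rewrite /shift /B /A /shift; lmod R[i]; field.
split=> [x Px E|y Py]; first by apply: injB => //; rewrite SE E scaler0.
have [|x Px E] := surjB (c^-1 *: y); first by rewrite /= (linZ lP) Py.
by exists x => //; apply: (scalerI (invr_neq0 c0)); rewrite -SE.
Qed.

(** S inverts A on N(P) and vanishes on R(P), so A S A - A = - A P. *)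
Lemma Browder_gDrazin_Riesz : finite_set (spec (Browder setT) T) ->
  gDrazin_Riesz_invertible (shift T l).
Proof.
move=> /spectral_projection[P [hP PP PT bN bE]].
set A := shift T l in bN *; have hA : bounded_op A by apply: bounded_shift.
have lA := bounded_lin hA; have lP := bounded_lin hP; have lT := bounded_lin hT.
have PS k x : P (shift T k x) = shift T k (P x).
  by rewrite /shift (linB lP) (linZ lP) PT.
have hN := closed_ker hP hX.
have iN : invariant A (kerM setT P).
  by move=> x [_ Px]; split=> //; rewrite PS Px (lin0 (lin_shift l lT)).
have QN x : kerM setT P (x - P x) by split=> //; rewrite (linB lP) PP subrr.
have /choice[S hS] : forall x, exists s, kerM setT P s /\ A s = x - P x.
  by move=> x; have [s Ns <-] := bN.2 _ (QN x); exists s.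
have SU x s : kerM setT P s -> A s = x - P x -> S x = s.
  move=> Ns As; have [NS AS] := hS x; apply/eqP; rewrite -subr_eq0; apply/eqP.
  by apply: bN.1; [apply: subspB hN.1 _ _ _ _|rewrite (linB lA) AS As subrr].
have bS : bounded_op S.
  have [C C0 hC] := bij_open hN hA iN bN.
  have [_ [K K0 hK]] := (bounded_opP P).1 hP.
  apply/bounded_opP; split=> [a x y|].
    have [Nx Ax] := hS x; have [Ny Ay] := hS y.
    apply: SU; first exact: hN.1.2.
    by rewrite lA lP Ax Ay; lmod R[i].
  exists (C * (1 + K)); first by rewrite mulr_gt0 // addr_gt0.
  move=> x; have [Nx Ax] := hS x; apply: le_trans (hC _ Nx) _; rewrite Ax -mulrA.
  apply: ler_wpM2l; first exact: ltW.
  by apply: le_trans (nrmB _ _) _; rewrite mulrDl mul1r lerD.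
have SA x : S (A x) = x - P x.
  by apply: SU; [exact: QN|rewrite (linB lA) PS].
exists S; split=> //; split; first by apply/funext => x /=; rewrite SA; case: (hS x).
split.
  apply/funext => x /=; have [NS AS] := hS x.
  by rewrite SA; have [_ ->] := NS; rewrite subr0.
have -> : (fun x => A (S (A x)) - A x) = (fun x => - A (P x)).
  by apply/funext => x; rewrite SA (linB lA); lmod R[i].
move=> m m0.
have hH : bounded_op (fun x => - A (P x)).
  have := bounded_lincomb (-2) (bounded_comp hA hP) (bounded_comp hA hP).
  by congr bounded_op; apply/funext => x /=; lmod R[i].
have hHm := bounded_shift m hH.
(* H is - (A + m) on R(P) and multiplication by - m on N(P), so only A + m = T - (l - m) on R(P)
   matters, and l - m differs from l. *)
set H := shift _ m in hHm *; have lH := bounded_lin hHm.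
have HE x : P x = x -> H x = - shift A (- m) x.
  by move=> Px; rewrite /H /shift Px; lmod R[i].
have HN x : P x = 0 -> H x = - m *: x.
  by move=> Px; rewrite /H /shift Px (lin0 lA) oppr0 sub0r scaleNr.
have AmE : shift A (- m) = shift T (l - m) by rewrite shiftD.
have lm : l - m != l by rewrite -subr_eq0 addrAC subrr sub0r oppr_eq0.
pose E := [set x | P x = x].
have kerE x : H x = 0 -> E x.
  move=> Hx; have : (- m) *: (x - P x) = 0; last first.
    by move/eqP; rewrite scaler_eq0 oppr_eq0 (negPf m0) subr_eq0 => /eqP.
  rewrite -HN; last by have [] := QN x.
  rewrite (linB lH) Hx sub0r; have := PS l x.
  have -> : H (P x) = P (H x).
    by rewrite /H /shift (linB lP) (linN lP) (linZ lP) PS.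
  by rewrite Hx (lin0 lP) oppr0.
have [kE rE] : fdm (kerM E (shift A (- m))) [set 0] /\ fdm E (rngM E (shift A (- m))).
  rewrite AmE; case: (bE _ lm) => [|[inj surj]]; last first.
    split; first by apply: fdm_refl => x [/inj h /h].
    by apply: fdm_refl => x /surj[y Ey <-]; exists y.
  move=> [/(FredholmP hX (bounded_shift _ hT))[//|k r] _]; split.
    by apply: fdmS k => // x [].
  apply: fdmS (fdm_rng lP r) => [x Ex|_ [_ [x _ <-] <-]]; first by exists x.
  by exists (P x); [exact: PP|rewrite PS].
apply/FredholmP => //; split.
  apply: fdmS kE => // x [_ Hx]; have Ex := kerE x Hx; split=> //.
  by apply/eqP; rewrite -oppr_eq0 -HE // Hx.
(* If P x = (A + m) e + w, then H maps - e to (A + m) e, and - (x - P x) / m to x - P x. *)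
have [s hs] := rE; exists s => x _.
have [_ [w [[e Ee <-] [sw PxE]]]] := hs (P x) (PP x).
exists (H (- e - m^-1 *: (x - P x))), w; split; first by exists (- e - m^-1 *: (x - P x)).
split=> //; rewrite (linB lH) (linN lH) (linZ lH) HE // HN; last by have [] := QN x.
by rewrite opprK -[LHS](subrK (P x)) {2}PxE; lmod R[i]; field.
Qed.
End Circle.
End DrazinRiesz.

Theorem theorem3p18 (R : realType) (X : completeNormedModType R[i])
  (Xinf : ~ fin_dim (setT : set X)) (T : X -> X) (hT : bounded_op T) :
  [<-> spec gKato_Riesz T = set0;
       spec gDrazin_Riesz_invertible T = set0;
       polynomially_Riesz T;
       finite_set (spec (Browder setT) T);
       finite_set (spec essentially_Kato T);
       finite_set (spec (Phi_plus setT) T);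
       finite_set (spec (Phi_minus setT) T);
       finite_set (spec (Fredholm setT) T);
       finite_set (spec (Weyl_plus setT) T);
       finite_set (spec (Weyl_minus setT) T);
       finite_set (spec (Weyl setT) T);
       finite_set (spec (Browder_plus setT) T);
       finite_set (spec (Browder_minus setT) T)].
Proof.
have semi P := @spec_semiFredholm_Browder R X T hT P.
have B_gDR : finite_set (spec (Browder setT) T) -> spec gDrazin_Riesz_invertible T = set0.
  move=> fB; apply/seteqP; split=> // l /=; apply; exact: Browder_gDrazin_Riesz.
have B_theta P : (forall A, bounded_op A -> Browder setT A -> P A) ->
    finite_set (spec (Browder setT) T) -> finite_set (spec P T).
  by move=> h; apply: sub_spec.
have from_F P : (forall A, Fredholm setT A -> P A) -> forall A : X -> X, bounded_op A ->
    Browder setT A -> P A.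
  by move=> h A _ [/h].
tfae.
- by move=> /(spec_gKR_Browder hT)/B_gDR.
(* The route is through the Kato-Riesz spectrum and the Browder spectrum to a finite Fredholm
   spectrum, whose points become roots of p. *)
- move=> gDR; apply: Fredholm_polynomially_Riesz => //.
  apply: (B_theta (Fredholm setT)); first by move=> A _ [].
  apply: spec_gKR_Browder => //; apply/seteqP; split=> // l /=; apply.
  apply: gDrazin_Riesz_gKato; first exact: bounded_shift.
  by apply: contrapT => nD; have : spec gDrazin_Riesz_invertible T l by []; rewrite gDR.
- by move=> /(polynomially_Riesz_Fredholm hT)/semi; apply => A [? _]; left.
- by apply: B_theta => A hA; apply: Browder_essentially_Kato.
- by move=> /(spec_eK_Browder hT); apply: B_theta => A _ [[]].
- by move=> /semi fB; apply: B_theta (fB _) => [A _ [[]]|A]; [|left].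
- by move=> /semi fB; apply: B_theta (fB _) => [A _ []|A]; [|right].
- by move=> /semi fB; apply: B_theta (fB _) => [A hA /(Browder_Weyl hA)[[? _] h]|A []];
    [split=> // k n hk hn; rewrite (h k n)|left].
- by move=> /semi fB; apply: B_theta (fB _) => [A hA /(Browder_Weyl hA)[[_ ?] h]|A []];
    [split=> // k n hk hn; rewrite (h k n)|left].
- by move=> /semi fB; apply: B_theta (fB _) => [A hA /(Browder_Weyl hA)|A []]; [|right].
- by move=> /semi fB; apply: B_theta (fB _) => [A _ [[? _] [? _]]|A [[]]]; [split|left].
- by move=> /semi fB; apply: B_theta (fB _) => [A _ [[_ ?] [_ ?]]|A []]; [split|left].
move=> /semi fB; apply/seteqP; split=> // l /=; apply.
apply: gDrazin_Riesz_gKato; first exact: bounded_shift.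
have /B_gDR gDR : finite_set (spec (Browder setT) T) by apply: fB => A []; right.
by apply: contrapT => nD; have : spec gDrazin_Riesz_invertible T l by []; rewrite gDR.
Qed.
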